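(* Let $\lambda\in\mathfrak{h}_{so(7,\mathbb{C})}^*$, and for $\delta\in\mathfrak{h}_{\mathfrak{g}_2}^*$ put $\mu=\lambda|_{\mathfrak{h}_{\mathfrak{g}_2}}-\delta$. Then, in the Grothendieck group of $\mathcal{O}^{\mathfrak{b}_{\mathfrak{g}_2}}$, $$M_{\mathfrak{b}_{so(7,\mathbb{C})}}^{so(7,\mathbb{C})}(\lambda)\big|_{\mathfrak{g}_2}=\bigoplus_{\substack{\delta\in\mathfrak{h}_{\mathfrak{g}_2}^*\\ \mu(H_{3\alpha_1+\alpha_2})\in\mathbb{N}\\ \mu(H_{3\alpha_1+2\alpha_2})\in\mathbb{N}}}\bigl(1+\min\{\mu(H_{3\alpha_1+\alpha_2}),\mu(H_{3\alpha_1+2\alpha_2})\}\bigr)\,M_{\mathfrak{b}_{\mathfrak{g}_2}}^{\mathfrak{g}_2}(\delta).$$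
   Context: $\mathbb{N}$ denotes the nonnegative integers. $\mathcal{O}^{\mathfrak{b}_{\mathfrak{g}_2}}$ is the BGG category $\mathcal{O}$ of $\mathfrak{g}_2$ for $\mathfrak{b}_{\mathfrak{g}_2}$. The restricted module is a union of $\mathfrak{g}_2$-submodules lying in this category; the identity in the Grothendieck group is between formal (possibly infinite) sums, i.e. every simple highest weight $\mathfrak{g}_2$-module has the same, finite, composition multiplicity on both sides. Setting for $so(7,\mathbb{C})$: it is realized as the Lie algebra of $7\times7$ complex matrices skew-adjoint relative to the quadratic form $2(z_1z_4+z_2z_5+z_3z_6)+z_7^2$. Its Cartan subalgebra $\mathfrak{h}_{so(7,\mathbb{C})}$ has basis $H_i=E_{ii}-E_{i+3,i+3}$ ($i=1,2,3$), with dual basis $\varepsilon_1,\varepsilon_2,\varepsilon_3$. Roots: $\pm\varepsilon_i\pm\varepsilon_j$ ($i<j$) and $\pm\varepsilon_k$; simple roots: $\varepsilon_1-\varepsilon_2,\varepsilon_2-\varepsilon_3,\varepsilon_3$. Embedding of $\mathfrak{g}_2$: $\mathfrak{g}_2\subset so(7,\mathbb{C})$ has Cartan subalgebra $\mathfrak{h}_{\mathfrak{g}_2}\subset\mathfrak{h}_{so(7,\mathbb{C})}$ spanned by $H_{\alpha_1}=H_1-H_2+2H_3$ and $H_{\alpha_2}=H_2-H_3$, and root vectors $X_{\alpha_2}=X_{\varepsilon_2-\varepsilon_3}$, $X_{3\alpha_1+\alpha_2}=-X_{\varepsilon_1+\varepsilon_3}$, $X_{3\alpha_1+2\alpha_2}=-X_{\varepsilon_1+\varepsilon_2}$,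 $X_{\alpha_1}=X_{\varepsilon_3}+X_{\varepsilon_1-\varepsilon_2}$, $X_{\alpha_1+\alpha_2}=X_{\varepsilon_2}-X_{\varepsilon_1-\varepsilon_3}$, $X_{2\alpha_1+\alpha_2}=-X_{\varepsilon_1}-X_{\varepsilon_2+\varepsilon_3}$, $X_{-\alpha_2}=X_{\varepsilon_3-\varepsilon_2}$, $X_{-3\alpha_1-\alpha_2}=X_{-\varepsilon_1-\varepsilon_3}$, $X_{-3\alpha_1-2\alpha_2}=X_{-\varepsilon_1-\varepsilon_2}$, $X_{-\alpha_1}=X_{-\varepsilon_3}+X_{\varepsilon_2-\varepsilon_1}$, $X_{-\alpha_1-\alpha_2}=X_{-\varepsilon_2}-X_{\varepsilon_3-\varepsilon_1}$, $X_{-2\alpha_1-\alpha_2}=-X_{-\varepsilon_1}-X_{-\varepsilon_2-\varepsilon_3}$, where $X_\gamma$ denotes a nonzero root vector of $so(7,\mathbb{C})$ for $\gamma$, normalized (as in the Levasseur–Smith Chevalley basis) so that these elements and $\mathfrak{h}_{\mathfrak{g}_2}$ span a Lie subalgebra isomorphic to $\mathfrak{g}_2$. The simple roots of $\mathfrak{g}_2$ are $\alpha_1=(\varepsilon_1-\varepsilon_2)|_{\mathfrak{h}_{\mathfrak{g}_2}}=\varepsilon_3|_{\mathfrak{h}_{\mathfrak{g}_2}}$ (short) and $\alpha_2=(\varepsilon_2-\varepsilon_3)|_{\mathfrak{h}_{\mathfrak{g}_2}}$ (long). For a root $\beta$ of $\mathfrak{g}_2$, $H_\beta$ is its coroot;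 thus $H_{3\alpha_1+\alpha_2}=H_1+H_3$, $H_{3\alpha_1+2\alpha_2}=H_1+H_2$. $\mathfrak{b}_{so(7,\mathbb{C})}$ and $\mathfrak{b}_{\mathfrak{g}_2}$ are the Borel subalgebras attached to the simple systems $\{\varepsilon_1-\varepsilon_2,\varepsilon_2-\varepsilon_3,\varepsilon_3\}$ of $so(7,\mathbb{C})$ and $\{\alpha_1,\alpha_2\}$ of $\mathfrak{g}_2$, respectively, and $M_{\mathfrak{b}_{\mathfrak{g}}}^{\mathfrak{g}}(\lambda)=U(\mathfrak{g})\otimes_{U(\mathfrak{b}_{\mathfrak{g}})}\mathbb{C}_\lambda$ is the Verma module of highest weight $\lambda$. *)

(* Defs.v *)
From HB Require Import structures.
From mathcomp Require Import all_boot all_order all_algebra.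
From mathcomp Require Import complex boolp classical_sets cardinality reals.
From mathcomp Require Import monalg.

Set Implicit Arguments.
Unset Strict Implicit.
Unset Printing Implicit Defensive.

Import GRing.Theory.

Local Open Scope ring_scope.

Section LieModules.

Variables (K : fieldType) (n : nat).

Definition lieb (x y : 'M[K]_n) : 'M[K]_n := x *m y - y *m x.

Record linLie := LinLie {
  lie_space :> {vspace 'M[K]_n};
  lie_closed : forall x y,
    x \in lie_space -> y \in lie_space -> lieb x y \in lie_space }.

Implicit Type g : linLie.

Definition lie_br g (x y : subvs_of g) : subvs_of g :=
  vsproj g (lieb (vsval x) (vsval y)).

Lemma vsval_lie_br g (x y : subvs_of g) :
  vsval (lie_br x y) = lieb (vsval x) (vsval y).
Proof. by rewrite vsprojK // lie_closed ?subvsP. Qed.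

Record lieModule g := LieModule {
  lm_space :> lmodType K;
  lm_act : subvs_of g -> lm_space -> lm_space;
  lm_actDl : forall a x y v,
    lm_act (a *: x + y) v = a *: lm_act x v + lm_act y v;
  lm_actDr : forall x a u v,
    lm_act x (a *: u + v) = a *: lm_act x u + lm_act x v;
  lm_actB : forall x y v,
    lm_act (lie_br x y) v = lm_act x (lm_act y v) - lm_act y (lm_act x v) }.

Definition lm_iso g (M N : lieModule g) : Prop :=
  exists f : {linear M -> N},
    bijective f /\ forall x v, f (lm_act x v) = lm_act x (f v).

Section Restriction.

Variables (g g' : linLie) (sg'g : (g' <= g)%VS) (M : lieModule g).

Let act (x : subvs_of g') (v : M) : M := lm_act (vsproj g (vsval x)) v.

Let actDl a x y v : act (a *: x + y) v = a *: act x v + act y v.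
Proof. by rewrite /act !linearP lm_actDl. Qed.

Let actDr x a u v : act x (a *: u + v) = a *: act x u + act x v.
Proof. exact: lm_actDr. Qed.

Let actB x y v : act (lie_br x y) v = act x (act y v) - act y (act x v).
Proof.
rewrite /act -lm_actB; congr lm_act; apply: val_inj => /=.
have sub (z : subvs_of g') : vsval z \in g by rewrite (subvP sg'g) ?subvsP.
by rewrite vsval_lie_br !vsprojK ?vsval_lie_br ?lie_closed.
Qed.

Definition lm_restrict : lieModule g' := LieModule actDl actDr actB.

End Restriction.

Record lieSubmodule g (M : lieModule g) := LieSubmodule {
  sm_set :> set M;
  sm_0 : sm_set 0;
  sm_lin : forall a u v, sm_set u -> sm_set v -> sm_set (a *: u + v);
  sm_act : forall x v, sm_set v -> sm_set (lm_act x v) }.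

Section Submodule.

Variables (g : linLie) (M : lieModule g) (N : lieSubmodule M).

Definition sm_pred : {pred M} := fun v => `[< sm_set N v >].

Lemma sm_predE v : (v \in sm_pred) = `[< sm_set N v >]. Proof. by []. Qed.

Lemma sm_pred_closed : submod_closed sm_pred.
Proof.
split=> [|a u v]; first exact/asboolP/sm_0.
by rewrite !sm_predE => /asboolP Nu /asboolP Nv; apply/asboolP/sm_lin.
Qed.

HB.instance Definition _ := GRing.isSubmodClosed.Build K M sm_pred sm_pred_closed.

Record sm_sort := SmElt { sm_val : M; sm_valP : sm_val \in sm_pred }.

HB.instance Definition _ := [isSub for sm_val].
HB.instance Definition _ := [Choice of sm_sort by <:].
HB.instance Definition _ := [SubChoice_isSubLmodule of sm_sort by <:].

Lemma sm_val_lin a (u v : sm_sort) :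
  sm_val (a *: u + v) = a *: sm_val u + sm_val v.
Proof. exact: (linearP (\val : sm_sort -> M)). Qed.

Let act_subproof (x : subvs_of g) (v : sm_sort) :
  lm_act x (sm_val v) \in sm_pred.
Proof. by apply/asboolP/sm_act/asboolP; case: v. Qed.

Let act (x : subvs_of g) (v : sm_sort) : sm_sort := SmElt (act_subproof x v).

Let actDl a x y v : act (a *: x + y) v = a *: act x v + act y v.
Proof. by apply: val_inj; rewrite linearP /= lm_actDl. Qed.

Let actDr x a u v : act x (a *: u + v) = a *: act x u + act x v.
Proof. by apply: val_inj; rewrite linearP /= lm_actDr. Qed.

Let actB x y v : act (lie_br x y) v = act x (act y v) - act y (act x v).
Proof. by apply: val_inj; rewrite linearB /= lm_actB. Qed.

Definition submod : lieModule g := LieModule actDl actDr actB.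

End Submodule.

Section Quotient.

Local Open Scope quotient_scope.

Variables (g : linLie) (M : lieModule g) (N : lieSubmodule M).

Definition qm_sort : Type := Quotient.quot (sm_pred N).

HB.instance Definition _ := GRing.Zmodule.on qm_sort.

Definition qm_pi (v : M) : qm_sort := \pi_(Quotient.quot (sm_pred N)) v.

Definition qm_repr (q : qm_sort) : M := repr (q : Quotient.quot (sm_pred N)).

Lemma qm_reprK : cancel qm_repr qm_pi. Proof. exact: reprK. Qed.

Lemma qm_piP u v : reflect (qm_pi u = qm_pi v) (u - v \in sm_pred N).
Proof. by rewrite Quotient.idealrBE; apply: eqP. Qed.

Lemma qm_piD u v : qm_pi (u + v) = qm_pi u + qm_pi v.
Proof. exact: Quotient.pi_add. Qed.

Lemma qm_piB u v : qm_pi (u - v) = qm_pi u - qm_pi v.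
Proof.
by rewrite qm_piD; congr (_ + _); apply: Quotient.pi_opp.
Qed.

Lemma qm_repr_pi v : qm_repr (qm_pi v) - v \in sm_pred N.
Proof. by apply/qm_piP; rewrite qm_reprK. Qed.

Let scale (a : K) (q : qm_sort) : qm_sort := qm_pi (a *: qm_repr q).

Let scaleE a v : scale a (qm_pi v) = qm_pi (a *: v).
Proof. by apply/qm_piP; rewrite -scalerBr rpredZ // qm_repr_pi. Qed.

Let qscaleA a b q : scale a (scale b q) = scale (a * b) q.
Proof. by rewrite -[q]qm_reprK !scaleE scalerA. Qed.

Let qscale1 : left_id 1 scale.
Proof. by move=> q; rewrite -[q]qm_reprK scaleE scale1r. Qed.

Let qscaleDr : right_distributive scale +%R.
Proof.
move=> a q r; rewrite -[q]qm_reprK -[r]qm_reprK.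
by rewrite -qm_piD !scaleE -qm_piD scalerDr.
Qed.

Let qscaleDl q : {morph scale^~ q : a b / a + b}.
Proof. by move=> a b; rewrite -[q]qm_reprK !scaleE -qm_piD scalerDl. Qed.

HB.instance Definition _ :=
  GRing.Zmodule_isLmodule.Build K qm_sort qscaleA qscale1 qscaleDr qscaleDl.

Lemma qm_piZ a v : qm_pi (a *: v) = a *: qm_pi v.
Proof. by rewrite -scaleE. Qed.

Let act (x : subvs_of g) (q : qm_sort) : qm_sort :=
  qm_pi (lm_act x (qm_repr q)).

Lemma qm_act_pi x v : act x (qm_pi v) = qm_pi (lm_act x v).
Proof.
apply/qm_piP; rewrite -[lm_act x v]scale1r -scaleNr addrC -lm_actDr scaleN1r.
by rewrite addrC; apply/asboolP/sm_act/asboolP/qm_repr_pi.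
Qed.

Let actDl a x y v : act (a *: x + y) v = a *: act x v + act y v.
Proof.
by rewrite -[v]qm_reprK !qm_act_pi lm_actDl qm_piD qm_piZ.
Qed.

Let actDr x a u v : act x (a *: u + v) = a *: act x u + act x v.
Proof.
rewrite -[u]qm_reprK -[v]qm_reprK -qm_piZ -qm_piD !qm_act_pi lm_actDr.
by rewrite qm_piD qm_piZ.
Qed.

Let actB x y v : act (lie_br x y) v = act x (act y v) - act y (act x v).
Proof. by rewrite -[v]qm_reprK !qm_act_pi lm_actB qm_piB. Qed.

Definition quotmod : lieModule g := LieModule actDl actDr actB.

End Quotient.

Section GeneratedSubmodule.

Variables (g : linLie) (M : lieModule g) (S : set M).

Let gen : set M :=
  [set v | forall N : lieSubmodule M, (S `<=` N)%classic -> sm_set N v].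

Let gen0 : gen 0. Proof. by move=> N _; apply: sm_0. Qed.

Let gen_lin a u v : gen u -> gen v -> gen (a *: u + v).
Proof. by move=> Gu Gv N SN; apply: sm_lin; [apply: Gu | apply: Gv]. Qed.

Let gen_act x v : gen v -> gen (lm_act x v).
Proof. by move=> Gv N SN; apply/sm_act/Gv. Qed.

Definition gen_submod : lieSubmodule M := LieSubmodule gen0 gen_lin gen_act.

End GeneratedSubmodule.

Section PreimageSubmodule.

Variables (g : linLie) (M : lieModule g) (N P : lieSubmodule M).

Let pre : set (submod N) := [set v | sm_set P (sm_val v)].

Let pre0 : pre 0. Proof. exact: sm_0. Qed.

Let pre_lin a u v : pre u -> pre v -> pre (a *: u + v).
Proof. exact: sm_lin. Qed.

Let pre_act x v : pre v -> pre (lm_act x v).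
Proof. exact: sm_act. Qed.

Definition sm_inside : lieSubmodule (submod N) :=
  LieSubmodule pre0 pre_lin pre_act.

End PreimageSubmodule.

Section DirectSum.

Variables (g : linLie) (I : Type) (V : I -> lieModule g).

Record dsum := Dsum {
  ds_fun :> forall i, V i;
  ds_fin : finite_set [set i | ds_fun i != 0] }.

HB.instance Definition _ := gen_eqMixin dsum.
HB.instance Definition _ := gen_choiceMixin dsum.

Lemma dsumP (f h : dsum) : (forall i, f i = h i) -> f = h.
Proof.
case: f h => [f ff] [h fh] /= fh_eq.
have {fh_eq} fh_eq : f = h by apply: functional_extensionality_dep.
by subst h; congr Dsum; apply: Prop_irrelevance.
Qed.

Let lin_fin (a : K) (f h : dsum) :
  finite_set [set i | a *: f i + h i != 0].
Proof.
have: finite_set ([set i | f i != 0] `|` [set i | h i != 0])%classic.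
  by rewrite finite_setU; split; apply: ds_fin.
apply: sub_finite_set => i /= nz.
case: (eqVneq (f i) 0) => [f0|]; last by left.
by right; move: nz; rewrite f0 scaler0 add0r.
Qed.

Let lin a f h := Dsum (lin_fin a f h).

Let zero_fin : finite_set [set i | (0 : V i) != 0].
Proof.
by rewrite (_ : [set i | _]%classic = set0%classic) //; apply/seteqP; split=> i //=; rewrite eqxx.
Qed.

Let zero := Dsum zero_fin.
Let add f h := lin 1 f h.
Let scale a f := lin a f zero.
Let opp f := scale (-1) f.

Let addA : associative add.
Proof. by move=> f h k; apply: dsumP => i /=; rewrite !scale1r addrA. Qed.

Let addC : commutative add.
Proof. by move=> f h; apply: dsumP => i /=; rewrite !scale1r addrC. Qed.

Let add0 : left_id zero add.
Proof. by move=> f; apply: dsumP => i /=; rewrite scaler0 add0r. Qed.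

Let addN : left_inverse zero opp add.
Proof.
by move=> f; apply: dsumP => i /=; rewrite scale1r addr0 scaleN1r addNr.
Qed.

HB.instance Definition _ := GRing.isZmodule.Build dsum addA addC add0 addN.

Let scaleA a b f : scale a (scale b f) = scale (a * b) f.
Proof. by apply: dsumP => i /=; rewrite !addr0 scalerA. Qed.

Let scale1 : left_id 1 scale.
Proof. by move=> f; apply: dsumP => i /=; rewrite addr0 scale1r. Qed.

Let scaleDr : right_distributive scale +%R.
Proof.
by move=> a f h; apply: dsumP => i /=; rewrite !scale1r !addr0 scalerDr.
Qed.

Let scaleDl f : {morph scale^~ f : a b / a + b}.
Proof.
by move=> a b; apply: dsumP => i /=; rewrite !scale1r !addr0 scalerDl.
Qed.

HB.instance Definition _ :=
  GRing.Zmodule_isLmodule.Build K dsum scaleA scale1 scaleDr scaleDl.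

Lemma dsumDE (f h : dsum) i : (f + h) i = f i + h i.
Proof. by rewrite /= scale1r. Qed.

Lemma dsumZE a (f : dsum) i : (a *: f) i = a *: f i.
Proof. by rewrite /= addr0. Qed.

Lemma dsumBE (f h : dsum) i : (f - h) i = f i - h i.
Proof. by rewrite dsumDE /= addr0 scaleN1r. Qed.

Let act_fin x (f : dsum) : finite_set [set i | lm_act x (f i) != 0].
Proof.
apply: sub_finite_set (ds_fin f) => i /=; apply: contra_neq => ->.
by have := lm_actDr x (-1) (0 : V i) 0; rewrite scaler0 addr0 scaleN1r addNr.
Qed.

Let act x f : dsum := Dsum (act_fin x f).

Let actDl a x y v : act (a *: x + y) v = a *: act x v + act y v.
Proof. by apply: dsumP => i; rewrite dsumDE dsumZE /= lm_actDl. Qed.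

Let actDr x a u v : act x (a *: u + v) = a *: act x u + act x v.
Proof.
apply: dsumP => i; rewrite dsumDE dsumZE.
by rewrite -[RHS]lm_actDr -dsumZE -dsumDE.
Qed.

Let actB x y v : act (lie_br x y) v = act x (act y v) - act y (act x v).
Proof. by apply: dsumP => i; rewrite dsumBE /= lm_actB. Qed.

Definition direct_sum : lieModule g := LieModule actDl actDr actB.

End DirectSum.

Section EnvelopingAlgebra.

Local Open Scope quotient_scope.

Variable g : linLie.

(* The tensor algebra of [g] is presented as the free algebra on the elements *)
(* of [g]; the linear relations are part of [U_rel].                          *)
Definition U_free := {malg K[{fmonom (subvs_of g)}]}.

HB.instance Definition _ := GRing.Lalgebra.on U_free.

Definition U_gen (x : subvs_of g) : U_free := mkmalgU (fmu x) 1.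

Inductive U_rel : U_free -> Prop :=
| U_rel_lin a x y : U_rel (U_gen (a *: x + y) - (a *: U_gen x + U_gen y))
| U_rel_br x y :
    U_rel (U_gen x * U_gen y - U_gen y * U_gen x - U_gen (lie_br x y)).

Record two_sided_ideal (I : set U_free) : Prop := TwoSidedIdeal {
  tsi_0 : I 0;
  tsi_B : forall s t, I s -> I t -> I (s - t);
  tsi_Ml : forall s t, I t -> I (s * t);
  tsi_Mr : forall s t, I s -> I (s * t) }.

Definition U_ideal : {pred U_free} := fun t =>
  `[< forall I : set U_free,
        two_sided_ideal I -> (U_rel `<=` I)%classic -> I t >].

Lemma U_ideal_rel t : U_rel t -> t \in U_ideal.
Proof. by move=> rt; apply/asboolP => I _; apply. Qed.

Lemma U_idealMl s t : t \in U_ideal -> s * t \in U_ideal.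
Proof. by move/asboolP=> It; apply/asboolP => I iI rI; apply: (tsi_Ml iI); apply: It. Qed.

Lemma U_idealMr s t : s \in U_ideal -> s * t \in U_ideal.
Proof. by move/asboolP=> It; apply/asboolP => I iI rI; apply: (tsi_Mr iI); apply: It. Qed.

Lemma U_ideal_closed : zmod_closed U_ideal.
Proof.
split=> [|s t /asboolP Is /asboolP It]; apply/asboolP => I iI rI.
  exact: (tsi_0 iI).
by apply: (tsi_B iI); [apply: Is|apply: It].
Qed.

HB.instance Definition _ := GRing.isZmodClosed.Build U_free U_ideal U_ideal_closed.

Lemma U_freeAr a (s t : U_free) : a *: (s * t) = s * (a *: t).
Proof.
apply/malgP => k; rewrite mcoeffZ (mcoeffMlw k (finmap.fsubset_refl _) (finmap.fsubset_refl _)).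
rewrite (mcoeffMlw k (finmap.fsubset_refl _) (msuppZ_le a t)) mulr_sumr.
apply: eq_bigr => i _; rewrite mulr_sumr; apply: eq_bigr => j _.
by rewrite mcoeffZ mulrnAr mulrCA.
Qed.

Definition Ug : Type := Quotient.quot U_ideal.

HB.instance Definition _ := GRing.Zmodule.on Ug.

Definition U_pi (t : U_free) : Ug := \pi_(Quotient.quot U_ideal) t.

Definition U_repr (u : Ug) : U_free := repr (u : Quotient.quot U_ideal).

Lemma U_reprK : cancel U_repr U_pi. Proof. exact: reprK. Qed.

Lemma U_piP s t : reflect (U_pi s = U_pi t) (s - t \in U_ideal).
Proof. by rewrite Quotient.idealrBE; apply: eqP. Qed.

Lemma U_piD s t : U_pi (s + t) = U_pi s + U_pi t.
Proof. exact: Quotient.pi_add. Qed.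

Lemma U_piB s t : U_pi (s - t) = U_pi s - U_pi t.
Proof. by rewrite U_piD; congr (_ + _); apply: Quotient.pi_opp. Qed.

Lemma U_repr_pi t : U_repr (U_pi t) - t \in U_ideal.
Proof. by apply/U_piP; rewrite U_reprK. Qed.

Let mul (u v : Ug) : Ug := U_pi (U_repr u * U_repr v).

Let mulE s t : mul (U_pi s) (U_pi t) = U_pi (s * t).
Proof.
apply/U_piP; set s' := U_repr _; set t' := U_repr _.
rewrite (_ : _ - _ = (s' - s) * t' + s * (t' - t)); last first.
  by rewrite mulrBl mulrBr addrA subrK.
by apply: rpredD; [apply: U_idealMr | apply: U_idealMl]; apply: U_repr_pi.
Qed.

Let mulA : associative mul.
Proof.
by move=> u v w; rewrite -[u]U_reprK -[v]U_reprK -[w]U_reprK !mulE mulrA.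
Qed.

Let mul1 : left_id (U_pi 1) mul.
Proof. by move=> u; rewrite -[u]U_reprK mulE mul1r. Qed.

Let mulr1 : right_id (U_pi 1) mul.
Proof. by move=> u; rewrite -[u]U_reprK mulE mulr1. Qed.

Let mulDl : left_distributive mul +%R.
Proof.
move=> u v w; rewrite -[u]U_reprK -[v]U_reprK -[w]U_reprK.
by rewrite -U_piD !mulE -U_piD mulrDl.
Qed.

Let mulDr : right_distributive mul +%R.
Proof.
move=> u v w; rewrite -[u]U_reprK -[v]U_reprK -[w]U_reprK.
by rewrite -U_piD !mulE -U_piD mulrDr.
Qed.

HB.instance Definition _ :=
  GRing.Zmodule_isPzRing.Build Ug mulA mul1 mulr1 mulDl mulDr.

Lemma U_piM s t : U_pi (s * t) = U_pi s * U_pi t.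
Proof. by rewrite -mulE. Qed.

Let scale (a : K) (u : Ug) : Ug := U_pi (a *: U_repr u).

Let scaleE a t : scale a (U_pi t) = U_pi (a *: t).
Proof.
apply/U_piP; rewrite -scalerBr -[_ - _]mul1r scalerAl.
exact/U_idealMl/U_repr_pi.
Qed.

Let scaleA a b u : scale a (scale b u) = scale (a * b) u.
Proof. by rewrite -[u]U_reprK !scaleE scalerA. Qed.

Let scale1 : left_id 1 scale.
Proof. by move=> u; rewrite -[u]U_reprK scaleE scale1r. Qed.

Let scaleDr : right_distributive scale +%R.
Proof.
move=> a u v; rewrite -[u]U_reprK -[v]U_reprK.
by rewrite -U_piD !scaleE -U_piD scalerDr.
Qed.

Let scaleDl u : {morph scale^~ u : a b / a + b}.
Proof. by move=> a b; rewrite -[u]U_reprK !scaleE -U_piD scalerDl. Qed.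

HB.instance Definition _ :=
  GRing.Zmodule_isLmodule.Build K Ug scaleA scale1 scaleDr scaleDl.

Lemma U_piZ a t : U_pi (a *: t) = a *: U_pi t.
Proof. by rewrite -scaleE. Qed.

Definition U_iota (x : subvs_of g) : Ug := U_pi (U_gen x).

Lemma U_iotaP a x y : U_iota (a *: x + y) = a *: U_iota x + U_iota y.
Proof.
rewrite /U_iota -U_piZ -U_piD; apply/U_piP; exact/U_ideal_rel/U_rel_lin.
Qed.

Lemma U_iota_br x y :
  U_iota (lie_br x y) = U_iota x * U_iota y - U_iota y * U_iota x.
Proof.
rewrite /U_iota -!U_piM -U_piB; apply/esym/U_piP; exact/U_ideal_rel/U_rel_br.
Qed.

Lemma U_scaleAl a (u v : Ug) : a *: (u * v) = (a *: u) * v.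
Proof.
by rewrite -[u]U_reprK -[v]U_reprK -[U_pi _ * _]U_piM -!U_piZ -[RHS]U_piM scalerAl.
Qed.

Lemma U_scaleAr a (u v : Ug) : a *: (u * v) = u * (a *: v).
Proof.
by rewrite -[u]U_reprK -[v]U_reprK -[U_pi _ * _]U_piM -!U_piZ -[RHS]U_piM U_freeAr.
Qed.

Let act (x : subvs_of g) (u : Ug) : Ug := U_iota x * u.

Let actDl a x y v : act (a *: x + y) v = a *: act x v + act y v.
Proof. by rewrite /act U_iotaP mulrDl U_scaleAl. Qed.

Let actDr x a u v : act x (a *: u + v) = a *: act x u + act x v.
Proof. by rewrite /act mulrDr U_scaleAr. Qed.

Let actB x y v : act (lie_br x y) v = act x (act y v) - act y (act x v).
Proof. by rewrite /act U_iota_br mulrBl !mulrA. Qed.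

Definition U_regular : lieModule g := LieModule actDl actDr actB.

End EnvelopingAlgebra.

Definition hdual (h : {vspace 'M[K]_n}) := 'Hom(subvs_of h, K^o).

Definition wt_at (h : {vspace 'M[K]_n}) (nu : hdual h) (x : 'M[K]_n) : K :=
  nu (vsproj h x).

Definition hdual_res (h h' : {vspace 'M[K]_n}) (nu : hdual h) : hdual h' :=
  linfun (fun x : subvs_of h' => nu (vsproj h (vsval x))).

Lemma hdual_resE (h h' : {vspace 'M[K]_n}) (nu : hdual h) (x : subvs_of h') :
  hdual_res h' nu x = nu (vsproj h (vsval x)).
Proof. exact: (lfunE (nu \o (vsproj h \o vsval))). Qed.

(* A Lie algebra with a Cartan subalgebra [bd_cartan] and the nilradical       *)
(* [bd_nil] of a Borel subalgebra [bd_cartan + bd_nil].                        *)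
Record borelData := BorelData {
  bd_lie :> linLie;
  bd_cartan : {vspace 'M[K]_n};
  bd_nil : {vspace 'M[K]_n};
  bd_sub : (bd_cartan + bd_nil <= bd_lie)%VS }.

Section CategoryO.

Variable D : borelData.

Local Notation h := (bd_cartan D).
Local Notation n_ := (bd_nil D).
Local Notation lieModule := (lieModule D).

Definition act_at (M : lieModule) (x : 'M[K]_n) (v : M) : M :=
  lm_act (vsproj D x) v.

(* The Verma module U(g) (x)_{U(b)} C_nu. As C_nu is a line, U(g) (x) C_nu over *)
(* the base field is U(g) itself; x + e, with x in the Cartan subalgebra and e *)
(* in the nilradical, acts on C_nu by nu(x), so tensoring over U(b) divides    *)
(* out all u (x + e) - nu(x) u. These form the left ideal, equivalently the    *)
(* submodule of the left regular module, generated by all x + e - nu(x).       *)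
Definition verma_rel (nu : hdual h) : set (U_regular D) :=
  [set u | exists x e, [/\ x \in h, e \in n_ &
     u = U_iota (vsproj D (x + e)) - wt_at nu x *: (1 : Ug D)]].

Definition verma (nu : hdual h) : lieModule := quotmod (gen_submod (verma_rel nu)).

Definition weight_vector (M : lieModule) (nu : hdual h) (v : M) : Prop :=
  forall x, x \in h -> act_at x v = wt_at nu x *: v.

Definition simple_module (M : lieModule) : Prop :=
  (exists v : M, v != 0) /\
  forall N : lieSubmodule M, N = [set 0]%classic :> set M \/ N = setT :> set M.

Definition simple_highest_weight (L : lieModule) : Prop :=
  simple_module L /\
  exists (nu : hdual h) (v : L), [/\ v != 0, weight_vector nu v &
    forall e, e \in n_ -> act_at e v = 0].

Definition fin_generated (M : lieModule) : Prop :=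
  exists s : seq M, gen_submod [set` s]%classic = setT :> set M.

Definition weight_module (M : lieModule) : Prop :=
  forall v : M, exists s : seq M, v = \sum_(w <- s) w /\
    forall w, w \in s -> exists nu : hdual h, weight_vector nu w.

Definition lin_span (M : lmodType K) (s : seq M) : set M :=
  [set v | exists c : 'I_(size s) -> K, v = \sum_i c i *: s`_i].

Definition locally_nil_finite (M : lieModule) : Prop :=
  forall v : M, exists s : seq M, lin_span s v /\
    forall e w, e \in n_ -> lin_span s w -> lin_span s (act_at e w).

Definition in_O (M : lieModule) : Prop :=
  [/\ fin_generated M, weight_module M & locally_nil_finite M].

Definition union_of_O (M : lieModule) : Prop :=
  forall v : M, exists N : lieSubmodule M, sm_set N v /\ in_O (submod N).

Definition filtration (M : lieModule) (k : nat) (F : nat -> lieSubmodule M) : Prop :=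
  [/\ F 0%N = [set 0]%classic :> set M, F k = setT :> set M &
      forall i, (i < k)%N -> (F i `<=` F i.+1)%classic].

Definition factor (M : lieModule) (F : nat -> lieSubmodule M) (i : nat) : lieModule :=
  quotmod (sm_inside (F i.+1) (F i)).

Definition nb_factors (M L : lieModule) (k : nat) (F : nat -> lieSubmodule M) : nat :=
  #|[pred i : 'I_k | `[< lm_iso (factor F i) L >]]|.

(* For [M] of possibly infinite length, the multiplicity of the simple module  *)
(* [L] is the largest number of factors isomorphic to [L] in a finite          *)
(* filtration of [M] by submodules.                                            *)
Definition comp_mult (M L : lieModule) (m : nat) : Prop :=
  (exists k F, @filtration M k F /\ nb_factors L k F = m) /\
  (forall k F, @filtration M k F -> (nb_factors L k F <= m)%N).

(* Equality in the Grothendieck group of unions of modules in category O. The  *)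
(* simple objects of category O are the simple highest weight modules.         *)
Definition eq_Groth (M N : lieModule) : Prop :=
  [/\ union_of_O M, union_of_O N &
      forall L, simple_highest_weight L ->
        exists m, comp_mult M L m /\ comp_mult N L m].

End CategoryO.

End LieModules.

Section So7G2.

Variable R : realType.

Local Notation C := R[i]%C.

(* Matrix units and diagonal elements, indexed from 1 like z1, ..., z7. *)
Definition Emx (i j : nat) : 'M[C]_7 := delta_mx (inord i.-1) (inord j.-1).

Definition Hd (k : nat) : 'M[C]_7 := Emx k k - Emx (k + 3) (k + 3).

(* Gram matrix of 2 (z1 z4 + z2 z5 + z3 z6) + z7^2. *)
Definition J7 : 'M[C]_7 :=
  Emx 1 4 + Emx 4 1 + (Emx 2 5 + Emx 5 2) + (Emx 3 6 + Emx 6 3) + Emx 7 7.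

Definition so7_eq (A : 'M[C]_7) : 'M[C]_7 := A^T *m J7 + J7 *m A.

Let so7_eq_linear : linear so7_eq.
Proof.
move=> a A B; rewrite /so7_eq linearP mulmxDl (mulmxDr J7) -scalemxAl -scalemxAr.
by rewrite scalerDr addrACA.
Qed.

HB.instance Definition _ := GRing.isLinear.Build C 'M[C]_7 'M[C]_7 *:%R
  so7_eq so7_eq_linear.

Definition so7_space : {vspace 'M[C]_7} := lker (linfun so7_eq).

Lemma so7P A : reflect (A^T *m J7 + J7 *m A = 0) (A \in so7_space).
Proof. by rewrite memv_ker lfunE; apply: eqP. Qed.

Lemma so7_closed x y :
  x \in so7_space -> y \in so7_space -> lieb x y \in so7_space.
Proof.
move=> /so7P/eqP; rewrite addr_eq0 => /eqP xJ.
move=> /so7P/eqP; rewrite addr_eq0 => /eqP yJ; apply/so7P.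
rewrite /lieb linearB /= !trmx_mul mulmxBl -!mulmxA xJ yJ.
rewrite !mulmxN !mulmxA xJ yJ !mulNmx !opprK mulmxBr !mulmxA.
by rewrite addrC addrA subrK subrr.
Qed.

Definition so7 : linLie C 7 := LinLie so7_closed.

Definition h_so7 : {vspace 'M[C]_7} := <<[:: Hd 1; Hd 2; Hd 3]>>%VS.

Definition eps (k : nat) : 'rV[int]_3 := delta_mx 0 (inord k.-1).

Definition so7_pos : seq 'rV[int]_3 :=
  [:: eps 1 - eps 2; eps 1 - eps 3; eps 2 - eps 3;
      eps 1 + eps 2; eps 1 + eps 3; eps 2 + eps 3;
      eps 1; eps 2; eps 3].

Definition so7_roots : seq 'rV[int]_3 := so7_pos ++ [seq - r | r <- so7_pos].

Definition H_a1 : 'M[C]_7 := Hd 1 - Hd 2 + Hd 3 *+ 2.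
Definition H_a2 : 'M[C]_7 := Hd 2 - Hd 3.
Definition H_3a1_a2 : 'M[C]_7 := Hd 1 + Hd 3.
Definition H_3a1_2a2 : 'M[C]_7 := Hd 1 + Hd 2.

Definition h_g2 : {vspace 'M[C]_7} := <<[:: H_a1; H_a2]>>%VS.

Lemma Emx_mul (i j k l : nat) : (j.-1 < 7)%N -> (k.-1 < 7)%N ->
  Emx i j *m Emx k l = Emx i l *+ (j.-1 == k.-1).
Proof.
by move=> j7 k7; rewrite /Emx mul_delta_mx_cond -val_eqE /= !inordK.
Qed.

Lemma Hd_so7 k : (0 < k <= 3)%N -> Hd k \in so7.
Proof.
have trE i j : (Emx i j)^T = Emx j i by rewrite /Emx trmx_delta.
case: k => [|[|[|[|k]]]] // _; apply/so7P;
  rewrite /Hd /J7 linearB /= !trE !mulmxDl !mulNmx !mulmxDr !mulmxN !Emx_mul //=;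
  rewrite !(mulr0n, mulr1n, oppr0, addr0, add0r) ?addr0;
  by rewrite addrACA subrr addNr addr0.
Qed.

Lemma H_3a1_a2_in : H_3a1_a2 \in h_g2.
Proof.
have -> : H_3a1_a2 = H_a1 + H_a2.
  by rewrite /H_a1 /H_a2 addrACA subrK mulr2n addrK.
by apply: rpredD; apply: memv_span; rewrite !inE eqxx ?orbT.
Qed.

Lemma H_3a1_2a2_in : H_3a1_2a2 \in h_g2.
Proof.
have -> : H_3a1_2a2 = H_3a1_a2 + H_a2.
  by rewrite /H_3a1_a2 /H_a2 addrACA subrr addr0.
by apply: rpredD; [apply: H_3a1_a2_in | apply: memv_span; rewrite !inE eqxx ?orbT].
Qed.

Section Embedding.

Variable X : 'rV[int]_3 -> 'M[C]_7.

Local Notation e1 := (eps 1).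
Local Notation e2 := (eps 2).
Local Notation e3 := (eps 3).

(* In this order: the root vectors for a2, 3 a1 + a2, 3 a1 + 2 a2, a1,         *)
(* a1 + a2, 2 a1 + a2.                                                         *)
Definition g2_pos : seq 'M[C]_7 :=
  [:: X (e2 - e3); - X (e1 + e3); - X (e1 + e2);
      X e3 + X (e1 - e2); X e2 - X (e1 - e3); - X e1 - X (e2 + e3)].

Definition g2_neg : seq 'M[C]_7 :=
  [:: X (e3 - e2); X (- e1 - e3); X (- e1 - e2);
      X (- e3) + X (e2 - e1); X (- e2) - X (e3 - e1); - X (- e1) - X (- e2 - e3)].

Definition g2_space : {vspace 'M[C]_7} := <<[:: H_a1; H_a2] ++ g2_pos ++ g2_neg>>%VS.

Definition is_root_vector (r : 'rV[int]_3) (x : 'M[C]_7) : Prop :=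
  [/\ x \in so7, x != 0 & forall k, (0 < k <= 3)%N ->
      lieb (Hd k) x = (r 0 (inord k.-1))%:~R *: x].

(* Once the span is closed under the bracket it is a copy of the simple Lie    *)
(* algebra of type G2: the vectors for a1, a2, -a1, -a2 generate it and        *)
(* satisfy the Serre relations.                                                *)
Record g2_normalized : Prop := G2Normalized {
  g2n_root : forall r, r \in so7_roots -> is_root_vector r (X r);
  g2n_closed : forall x y,
    x \in g2_space -> y \in g2_space -> lieb x y \in g2_space }.

Hypothesis nX : g2_normalized.

Definition g2 : linLie C 7 := LinLie (g2n_closed nX).

Definition n_so7 : {vspace 'M[C]_7} := <<[seq X r | r <- so7_pos]>>%VS.

Definition n_g2 : {vspace 'M[C]_7} := <<g2_pos>>%VS.

Lemma X_so7 r : r \in so7_roots -> X r \in so7.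
Proof. by move/(g2n_root nX) => []. Qed.

Lemma X_pos_so7 r : r \in so7_pos -> X r \in so7.
Proof. by move=> r_pos; rewrite X_so7 // mem_cat r_pos. Qed.

Lemma X_neg_so7 r : r \in so7_pos -> X (- r) \in so7.
Proof. by move=> r_pos; rewrite X_so7 // mem_cat map_f ?orbT. Qed.

Lemma so7_borel_sub : (h_so7 + n_so7 <= so7)%VS.
Proof.
rewrite subv_add; apply/andP; split; apply/span_subvP => x.
  by rewrite !inE => /or3P[] /eqP ->; apply: Hd_so7.
by case/mapP => r r_pos ->; apply: X_pos_so7.
Qed.

Lemma g2_sub_so7 : (g2 <= so7)%VS.
Proof.
have posD i j : eps i + eps j \in so7_pos -> X (- eps i - eps j) \in so7.
  by move=> /X_neg_so7; rewrite opprD.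
have posB i j : eps i - eps j \in so7_pos -> X (eps j - eps i) \in so7.
  by move=> /X_neg_so7; rewrite opprB.
apply/span_subvP; apply/allP.
rewrite /= /H_a1 /H_a2; do ![apply/andP; split=> //].
all: do ?[by apply: Hd_so7 | apply: rpredB | apply: rpredD | apply: rpredMn
         | rewrite rpredN].
all: by [apply: X_pos_so7; rewrite !inE eqxx ?orbT
        | apply: X_neg_so7; rewrite !inE eqxx ?orbT
        | apply: posD; rewrite !inE eqxx ?orbT
        | apply: posB; rewrite !inE eqxx ?orbT].
Qed.

Lemma g2_borel_sub : (h_g2 + n_g2 <= g2)%VS.
Proof.
rewrite -span_cat; apply: sub_span => x; rewrite !mem_cat.
by case/orP => ->; rewrite ?orbT.
Qed.

Definition so7_data : borelData C 7 := BorelData so7_borel_sub.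

Definition g2_data : borelData C 7 := BorelData g2_borel_sub.

End Embedding.

(* The weights [delta] indexing the sum, with the two natural numbers          *)
(* [mu H_3a1_a2] and [mu H_3a1_2a2] that they determine.                       *)
Record branch_weight (lambda : hdual h_so7) := BranchWeight {
  bw_delta : hdual h_g2;
  bw_p : nat;
  bw_q : nat;
  bw_pE : wt_at (hdual_res h_g2 lambda - bw_delta) H_3a1_a2 = bw_p%:R;
  bw_qE : wt_at (hdual_res h_g2 lambda - bw_delta) H_3a1_2a2 = bw_q%:R }.

End So7G2.

(* Main.v *)
Require Import Defs.
From HB Require Import structures.
From mathcomp Require Import all_boot all_order all_algebra.
From mathcomp Require Import complex boolp classical_sets cardinality reals.
From mathcomp Require Import ring.
From mathcomp Require finmap monalg mpoly.

(** The Verma module of so(7) has a basis of ordered monomials in the nine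
    negative root vectors applied to the highest weight vector, and a Verma
    module of G2 has one in six negative root vectors. The nine negative roots
    restrict to the Cartan subalgebra of G2 as follows: the three long negative
    roots once each, the three short ones twice each. Hence, as sets of
    weights with multiplicity, the monomials of so(7) are pairs of a monomial
    of G2 and a triple (i, j, k) of exponents of the short roots, which shifts
    the highest weight by i, j and k times the negatives of a1, a1 + a2 and
    2 a1 + a2. The shifted weight delta and the exponent k determine the triple:
    with mu = lambda - delta, the values of mu on the coroots of 3 a1 + a2 and
    3 a1 + 2 a2 are p = i + k and q = j + k, and k ranges over 0, ..., min(p, q).
    So each delta occurs 1 + min(p, q) times, and both sides of the formula have
    bases of weight vectors with the same weights, indexed by the same set.

    It remains to see that such modules have the same composition
    multiplicities. Their weights are graded by the eigenvalues of a regular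
    element of the Cartan subalgebra, which are c, c - 1, c - 2, ..., with
    finitely many basis vectors in each degree. Following Kac, the module has,
    for each finite set of top weights, a finite chain of submodules whose
    factors are either simple of highest weight in that set, or have no weight
    in it ([chain_exists]). The multiplicities in such a chain are determined by
    the dimensions of the weight spaces, because the dimensions of the weight
    spaces of the simple modules form a unitriangular system
    ([unitriangular_perm]); any finite filtration refines to such a chain, which
    identifies them with the composition multiplicities
    ([equal_multiplicities], [eq_Groth_of_bases]).

    The monomial bases rest on the independence part of the theorem of
    Poincare, Birkhoff and Witt ([zword_free]). For a Lie algebra of matrices it
    can be read off from its action by left invariant vector fields on
    polynomial functions of a matrix near the identity: to leading order these
    fields are partial derivatives, and monomials in partial derivatives are
    told apart by their action on monomials. Dividing the enveloping algebra by
    the left ideal of the Verma module then only needs the straightening of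
    words ([straighten], [verma_basis]). Finally the negative, Cartan and
    positive parts are shown to be complementary by the eigenvalues of a
    suitable Cartan element ([triangular_of_grading]), with a count of
    dimensions for so(7) ([so7_span]). *)

Set Implicit Arguments.
Unset Strict Implicit.
Unset Printing Implicit Defensive.

Import GRing.Theory.

Local Open Scope ring_scope.

Lemma natr_inj (K : fieldType) (char0 : forall k : nat, k.+1%:R != 0 :> K) (a b : nat) :
  a%:R = b%:R :> K -> a = b.
Proof.
wlog ab : a b / (a <= b)%N => [wl|].
  by case/orP: (leq_total a b) => [/wl //|/wl H /esym/H].
rewrite -(subnKC ab) natrD => /eqP; rewrite -subr_eq0 opprD addrA subrr add0r oppr_eq0.
by case: (b - a)%N => [|d]; rewrite ?addn0 // (negPf (char0 d)).
Qed.

Lemma lin_at0 (K : fieldType) (V W : lmodType K) (f : V -> W) :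
  (forall a u v, f (a *: u + v) = a *: f u + f v) -> f 0 = 0.
Proof.
move=> f_lin; have := f_lin 1 0 0; rewrite !scale1r addr0 => /eqP.
by rewrite -subr_eq subrr => /eqP.
Qed.

(** * Modules over the enveloping algebra *)

Section Act.
Variables (K : fieldType) (n : nat) (g : linLie K n) (M : lieModule g).

Lemma lm_actD x (u v : M) : lm_act x (u + v) = lm_act x u + lm_act x v.
Proof. by have := lm_actDr x 1 u v; rewrite !scale1r. Qed.

Lemma lm_act0 x : lm_act x (0 : M) = 0.
Proof. by apply: (addrI (lm_act x (0 : M))); rewrite -lm_actD !addr0. Qed.

Lemma lm_actZ x a (v : M) : lm_act x (a *: v) = a *: lm_act x v.
Proof. by have := lm_actDr x a v 0; rewrite lm_act0 !addr0. Qed.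

Lemma lm_act_sum x I (r : seq I) (F : I -> M) :
  lm_act x (\sum_(i <- r) F i) = \sum_(i <- r) lm_act x (F i).
Proof. by apply: (big_morph (lm_act x)); [exact: lm_actD | exact: lm_act0]. Qed.

Lemma lm_act_addl x y (v : M) : lm_act (x + y) v = lm_act x v + lm_act y v.
Proof. by have := lm_actDl 1 x y v; rewrite !scale1r. Qed.

Lemma lm_act_0l (v : M) : lm_act 0 v = 0.
Proof.
by apply: (addrI (lm_act 0 v)); rewrite -lm_act_addl !addr0.
Qed.

Lemma lm_act_scalel a x (v : M) : lm_act (a *: x) v = a *: lm_act x v.
Proof. by have := lm_actDl a x 0 v; rewrite lm_act_0l !addr0. Qed.

End Act.

Section UniversalProperty.
Variables (K : fieldType) (n : nat) (g : linLie K n) (P : lieModule g).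
Implicit Types (p : P) (s t : U_free g).
Import finmap monalg.

Definition word_act (s : seq (subvs_of g)) p := foldr (@lm_act _ _ _ P) p s.

Definition free_act t p : P := \sum_(m <- msupp t) mcoeff m t *: word_act m p.

Lemma free_actEw (d : {fset {fmonom (subvs_of g)}}) t p :
  (msupp t `<=` d)%fset -> free_act t p = \sum_(m <- d) mcoeff m t *: word_act m p.
Proof.
move=> td; rewrite /free_act (big_fset_incl _ td) //= => m _ /mcoeff_outdom ->.
by rewrite scale0r.
Qed.

Lemma free_act_lin a s t p :
  free_act (a *: s + t) p = a *: free_act s p + free_act t p.
Proof.
have [sd td] := (fsubsetUl (msupp s) (msupp t), fsubsetUr (msupp s) (msupp t)).
have std : (msupp (a *: s + t) `<=` msupp s `|` msupp t)%fset.
  apply: (fsubset_trans (msuppD_le _ _)); rewrite fsubUset td andbT.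
  exact: fsubset_trans (msuppZ_le _ _) sd.
rewrite (free_actEw _ std) (free_actEw _ sd) (free_actEw _ td).
rewrite scaler_sumr -big_split /=; apply: eq_bigr => m _.
by rewrite mcoeffD mcoeffZ scalerDl scalerA.
Qed.

Lemma word_act_lin (s : seq (subvs_of g)) a p q :
  word_act s (a *: p + q) = a *: word_act s p + word_act s q.
Proof. by elim: s => //= x s ->; rewrite lm_actDr. Qed.

Lemma free_act_linr t a p q :
  free_act t (a *: p + q) = a *: free_act t p + free_act t q.
Proof.
rewrite /free_act scaler_sumr -big_split /=; apply: eq_bigr => m _.
by rewrite word_act_lin scalerDr !scalerA mulrC.
Qed.

Lemma free_act_U (m : {fmonom (subvs_of g)}) c p :
  free_act (mkmalgU m c) p = c *: word_act m p.
Proof.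
by rewrite (free_actEw _ msuppU_le) big_seq_fset1 mcoeffUU.
Qed.

Lemma free_act0 p : free_act 0 p = 0.
Proof. by rewrite /free_act msupp0 big_seq_fset0. Qed.

Lemma free_actD s t p : free_act (s + t) p = free_act s p + free_act t p.
Proof. by have := free_act_lin 1 s t p; rewrite !scale1r. Qed.

Lemma free_actr0 t : free_act t 0 = 0.
Proof.
exact: (lin_at0 (free_act_linr t)).
Qed.

Lemma free_actB s t p : free_act (s - t) p = free_act s p - free_act t p.
Proof. by have := free_act_lin (-1) t s p; rewrite !scaleN1r addrC => ->; rewrite addrC. Qed.

Lemma free_act_sum I (r : seq I) (F : I -> U_free g) p :
  free_act (\sum_(i <- r) F i) p = \sum_(i <- r) free_act (F i) p.
Proof.
by apply: (big_morph (fun t => free_act t p)) => [s t|];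
  [exact: free_actD | exact: free_act0].
Qed.

Lemma word_act_cat (s1 s2 : seq (subvs_of g)) p :
  word_act (s1 ++ s2) p = word_act s1 (word_act s2 p).
Proof. by rewrite /word_act foldr_cat. Qed.

Lemma word_act_sum (s : seq (subvs_of g)) I (r : seq I) (F : I -> P) :
  word_act s (\sum_(i <- r) F i) = \sum_(i <- r) word_act s (F i).
Proof. by elim: s => //= x s ->; rewrite lm_act_sum. Qed.

Lemma word_actZ (s : seq (subvs_of g)) a p : word_act s (a *: p) = a *: word_act s p.
Proof. by elim: s => //= x s ->; rewrite lm_actZ. Qed.

Lemma free_actM s t p : free_act (s * t) p = free_act s (free_act t p).
Proof.
rewrite (malgME s t) free_act_sum /(free_act s).
apply: eq_bigr => m _; rewrite free_act_sum /(free_act t) word_act_sum.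
rewrite scaler_sumr; apply: eq_bigr => m' _.
by rewrite free_act_U fmM word_act_cat word_actZ scalerA.
Qed.

Lemma free_act_gen x p : free_act (U_gen x) p = lm_act x p.
Proof. by rewrite free_act_U fmU scale1r. Qed.

Lemma free_act1 p : free_act 1 p = p.
Proof. by rewrite free_act_U fm1 scale1r. Qed.

Lemma free_act_linear_rel a r s t p :
  free_act (t - (a *: r + s)) p = free_act t p - (a *: free_act r p + free_act s p).
Proof. by rewrite free_actB free_act_lin. Qed.

Lemma free_act_bracket_rel r s t p :
  free_act (r * s - s * r - t) p =
    free_act r (free_act s p) - free_act s (free_act r p) - free_act t p.
Proof.
rewrite free_actB free_actB; congr (_ - _ - _); exact: free_actM.
Qed.

(** The tensors acting by zero form a two-sided ideal, which contains the
    defining relations of the enveloping algebra because the bracket of the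
    module is the commutator of actions. *)
Lemma free_act_ideal t p : t \in @U_ideal _ _ g -> free_act t p = 0.
Proof.
move=> /asboolP /(_ [set t | forall p, free_act t p = 0]%classic); apply.
- split=> /= [q|s u s0 u0 q|s u u0 q|s u s0 q].
  + exact: free_act0.
  + by rewrite free_actB s0 u0 subr0.
  + by rewrite free_actM u0 free_actr0.
  + by rewrite free_actM s0.
- move=> _ [a x y|x y] q.
    apply: (etrans (free_act_linear_rel _ _ _ _ _)).
    by rewrite 3!free_act_gen lm_actDl subrr.
  apply: (etrans (free_act_bracket_rel _ _ _ _)).
  by rewrite 5!free_act_gen lm_actB subrr.
Qed.

Definition Uact (u : Ug g) p : P := free_act (U_repr u) p.

Lemma Uact_pi t p : Uact (U_pi t) p = free_act t p.
Proof.
by apply/eqP; rewrite -subr_eq0 -free_actB free_act_ideal // U_repr_pi.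
Qed.

Lemma Uact_lin a u v p : Uact (a *: u + v) p = a *: Uact u p + Uact v p.
Proof.
by rewrite -[u]U_reprK -[v]U_reprK -U_piZ -U_piD !Uact_pi free_act_lin.
Qed.

Lemma Uact0 p : Uact 0 p = 0.
Proof.
have := Uact_lin 1 0 0 p; rewrite !scale1r addr0 => /eqP.
by rewrite -subr_eq subrr => /eqP.
Qed.

Lemma UactZ a u p : Uact (a *: u) p = a *: Uact u p.
Proof. by have := Uact_lin a u 0 p; rewrite Uact0 !addr0. Qed.

Lemma UactD u v p : Uact (u + v) p = Uact u p + Uact v p.
Proof. by have := Uact_lin 1 u v p; rewrite !scale1r. Qed.

Lemma Uact_sum I (r : seq I) (F : I -> Ug g) p :
  Uact (\sum_(i <- r) F i) p = \sum_(i <- r) Uact (F i) p.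
Proof.
by apply: (big_morph (fun u => Uact u p)) => [u v|]; [exact: UactD|exact: Uact0].
Qed.

Lemma UactM u v p : Uact (u * v) p = Uact u (Uact v p).
Proof. by rewrite -[u]U_reprK -[v]U_reprK -U_piM !Uact_pi free_actM. Qed.

Lemma Uact1 p : Uact 1 p = p.
Proof. by rewrite -[1]/(U_pi 1) Uact_pi free_act1. Qed.

Lemma Uact_iota x p : Uact (U_iota x) p = lm_act x p.
Proof. by rewrite Uact_pi free_act_gen. Qed.

End UniversalProperty.

(** * Polynomial functions and independence of monomials *)

Section Words.
Variables (K : fieldType) (n : nat) (g : linLie K n) (I : Type).
Variables (b : I -> 'M[K]_n) (c : I -> K).

(** The shift c will be a character of the Borel subalgebra: the shifted
    generators of that subalgebra then kill the highest weight vector. *)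
Definition zact (M : lieModule g) (i : I) (v : M) : M :=
  lm_act (vsproj g (b i)) v - c i *: v.

Definition zword (M : lieModule g) (s : seq I) (v : M) : M :=
  foldr (zact (M := M)) v s.

Lemma Uact_zword (M : lieModule g) (s : seq I) (u : Ug g) (v : M) :
  Uact (zword (M := U_regular g) s u) v = zword s (Uact u v).
Proof.
elim: s => //= i s <-; rewrite {1}/zact addrC -scaleNr Uact_lin UactM Uact_iota.
by rewrite addrC scaleNr.
Qed.

End Words.

Section PolyModule.
Import mpoly.
Variables (K : fieldType) (n : nat).
Local Notation m := (\dim {:'M[K]_n}).
Variable e : m.-tuple 'M[K]_n.
Hypothesis eB : basis_of fullv e.
Local Notation P := {mpoly K[m]}.

Definition vf_coef (x : 'M[K]_n) (k : 'I_m) : P :=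
  (coord e k x)%:MP + \sum_(j < m) coord e k (e`_j *m x) *: 'X_j.

(** The left invariant vector field of the matrix x: the derivative of p at
    the point 1 + y in the direction (1 + y) x. The variables are the
    coordinates of y in the basis e, so that the identity matrix is the
    origin. *)
Definition vf (x : 'M[K]_n) (p : P) : P := \sum_(k < m) vf_coef x k * p^`M(k).

Lemma vf_coef_lin a x y k : vf_coef (a *: x + y) k = a *: vf_coef x k + vf_coef y k.
Proof.
rewrite /vf_coef scalerDr scaler_sumr addrACA -big_split linearP mpolyCD mpolyCM.
rewrite mul_mpolyC; congr (_ + _); apply: eq_bigr => j _.
by rewrite mulmxDr -scalemxAr linearP scalerDl scalerA.
Qed.

Lemma vf_linl a x y p : vf (a *: x + y) p = a *: vf x p + vf y p.
Proof.
rewrite /vf scaler_sumr -big_split; apply: eq_bigr => k _ /=.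
by rewrite vf_coef_lin mulrDl scalerAl.
Qed.

Lemma vf_linr x a p q : vf x (a *: p + q) = a *: vf x p + vf x q.
Proof.
rewrite /vf scaler_sumr -big_split; apply: eq_bigr => k _ /=.
by rewrite mderivD mderivZ mulrDr scalerAr.
Qed.

Lemma coord_mulmx x y k :
  coord e k (x *m y) = \sum_(i < m) coord e i x * coord e k (e`_i *m y).
Proof.
rewrite {1}(coord_basis eB (memvf x)) mulmx_suml linear_sum.
by apply: eq_bigr => i _; rewrite -scalemxAl linearZ.
Qed.

Lemma mderiv_var (i j : 'I_m) : mderiv i ('X_j : P) = (i == j)%:R.
Proof.
rewrite mderivX mnm1E eq_sym; case: eqP => [->|_]; last by rewrite scale0r.
rewrite scale1r (_ : (_ - _)%MM = 0%MM) ?mpolyX0 //.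
by apply/mnmP => k; rewrite mnmBE subnn mnm0E.
Qed.

Lemma mderiv_vf_coef i y k :
  mderiv i (vf_coef y k) = (coord e k (e`_i *m y))%:MP.
Proof.
rewrite /vf_coef mderivD mderivC add0r linear_sum /= (bigD1 i) //=.
rewrite big1 => [|j ji]; rewrite mderivZ mderiv_var.
  by rewrite eqxx addr0 alg_mpolyC.
by rewrite eq_sym (negPf ji) scaler0.
Qed.

Lemma vf_vf_coef x y k : vf x (vf_coef y k) = vf_coef (x *m y) k.
Proof.
rewrite /vf; under eq_bigr do rewrite mderiv_vf_coef mulrC mul_mpolyC /vf_coef scalerDr.
rewrite big_split /= {1}/vf_coef coord_mulmx raddf_sum; congr (_ + _).
  by apply: eq_bigr => i _ /=; rewrite mpolyCM mulrC mul_mpolyC.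
under eq_bigr do rewrite scaler_sumr; rewrite exchange_big /=.
apply: eq_bigr => j _; rewrite mulmxA coord_mulmx scaler_suml.
by apply: eq_bigr => i _; rewrite scalerA mulrC.
Qed.

(** The second order part is symmetric in x and y, so it cancels in a
    commutator and only the field of the commutator of matrices remains. *)
Lemma vf_comp x y p :
  vf x (vf y p) =
    vf (x *m y) p + \sum_(i < m) \sum_(k < m) vf_coef x i * vf_coef y k * p^`M(k)^`M(i).
Proof.
rewrite {1}/vf; under eq_bigr => i _.
  rewrite linear_sum /= mulr_sumr.
  under eq_bigr do rewrite mderivM mulrDr.
  rewrite big_split; over.
rewrite big_split /=; congr (_ + _); last first.
  by apply: eq_bigr => i _; apply: eq_bigr => k _; rewrite mulrA.
rewrite exchange_big; apply: eq_bigr => k _ /=.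
rewrite -vf_vf_coef /vf mulr_suml.
by apply: eq_bigr => i _; rewrite mulrA.
Qed.

Lemma vf_bracket x y p : vf (lieb x y) p = vf x (vf y p) - vf y (vf x p).
Proof.
rewrite !vf_comp opprD addrACA.
rewrite [X in _ + (_ - X)]exchange_big /=.
rewrite -[X in _ + X]sumrB [X in _ + X]big1 ?addr0 => [|i _].
  have := vf_linl (-1) (y *m x) (x *m y) p.
  by rewrite !scaleN1r addrC => <-; rewrite /lieb addrC.
rewrite -sumrB big1 // => k _.
by rewrite mderiv_comm [vf_coef y _ * _]mulrC subrr.
Qed.

Section Module.
Variable g : linLie K n.

Let act (x : subvs_of g) (p : P) : P := vf (vsval x) p.

Let actDl a x y p : act (a *: x + y) p = a *: act x p + act y p.
Proof. by rewrite /act linearP vf_linl. Qed.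

Let actDr x a p q : act x (a *: p + q) = a *: act x p + act x q.
Proof. exact: vf_linr. Qed.

Let actB x y p : act (lie_br x y) p = act x (act y p) - act y (act x p).
Proof. by rewrite /act vsval_lie_br vf_bracket. Qed.

Definition poly_module : lieModule g := LieModule actDl actDr actB.

End Module.

Definition vanishes (d : nat) (p : P) := forall q : 'X_{1..m}, (mdeg q < d)%N -> p@_q = 0.

Lemma vanishesD d p q : vanishes d p -> vanishes d q -> vanishes d (p + q).
Proof. by move=> p0 q0 r rd; rewrite mcoeffD p0 ?q0 ?addr0. Qed.

Lemma vanishesZ d a p : vanishes d p -> vanishes d (a *: p).
Proof. by move=> p0 r rd; rewrite mcoeffZ p0 ?mulr0. Qed.

Lemma vanishes_sum d I (r : seq I) (F : I -> P) :
  (forall i, vanishes d (F i)) -> vanishes d (\sum_(i <- r) F i).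
Proof.
move=> F0; elim: r => [|i r IH]; first by rewrite big_nil => q _; rewrite mcoeff0.
by rewrite big_cons; apply: vanishesD.
Qed.

Lemma vanishesW d p : vanishes d.+1 p -> vanishes d p.
Proof. by move=> p0 q qd; apply: p0; apply: ltnW. Qed.

Lemma vanishes_deriv d k p : vanishes d.+1 p -> vanishes d (p^`M(k)).
Proof.
by move=> p0 q qd; rewrite mcoeff_deriv p0 ?mul0rn // mdegD mdeg1 addn1.
Qed.

Lemma vanishes_mulX d j p : vanishes d p -> vanishes d.+1 ('X_j * p).
Proof.
move=> p0 q qd; rewrite mcoeffM big1 // => -[k1 k2] /= /eqP qE.
rewrite mcoeffX; case: eqP => [k1E|_]; last by rewrite mul0r.
rewrite p0 ?mulr0 //; rewrite -ltnS; apply: leq_trans qd.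
by rewrite ltnS [in X in (_ <= X)%N]qE mdegD -k1E mdeg1 add1n.
Qed.

(** At the identity the field of a basis vector is the corresponding partial
    derivative; the remainder is a combination of derivatives whose
    coefficients vanish at the identity. *)
Lemma vanishes_vf d (i : 'I_m) p : vanishes d.+1 p -> vanishes d.+1 (vf e`_i p - mderiv i p).
Proof.
move=> p0.
suff -> : vf e`_i p - mderiv i p =
    \sum_(k < m) \sum_(j < m) coord e k (e`_j *m e`_i) *: ('X_j * p^`M(k)).
  do 2!apply: vanishes_sum => ?; apply: vanishesZ; apply: vanishes_mulX.
  exact: vanishes_deriv.
rewrite /vf; under eq_bigr do rewrite /vf_coef mulrDl.
rewrite big_split /= (_ : \sum_k _ = p^`M(i)).
  rewrite addrAC subrr add0r; apply: eq_bigr => k _; rewrite mulr_suml.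
  by apply: eq_bigr => j _; rewrite scalerAl.
rewrite (bigD1 i) //= big1 => [|k ki].
  by rewrite coord_free ?(basis_free eB) // eqxx mul_mpolyC scale1r addr0.
by rewrite coord_free ?(basis_free eB) // eq_sym (negPf ki) mul_mpolyC scale0r.
Qed.

Definition dword (s : seq 'I_m) (p : P) : P := foldr (fun i => mderiv i) p s.

Variable g : linLie K n.
Variable c : 'I_m -> K.

(** The shift by a scalar and the higher terms of a vector field preserve
    the order of vanishing at the identity, which a partial derivative may
    lower by one: to leading order a word acts as the iterated partial
    derivative. *)
Lemma vanishes_zword (s : seq 'I_m) (r : nat) (p : poly_module g) :
    {in s, forall i : 'I_m, e`_i \in lie_space g} -> vanishes (size s + r) p ->
  vanishes r (zword (fun i : 'I_m => e`_i) c s p : P) /\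
  vanishes r.+1 (zword (fun i : 'I_m => e`_i) c s p - dword s p : P).
Proof.
elim: s r => [|i s IH] r sg /= pr.
  by split=> // q _; rewrite subrr mcoeff0.
have sg' : {in s, forall j : 'I_m, e`_j \in lie_space g}.
  by move=> j js; apply: sg; rewrite inE js orbT.
have [|w0 w1] := IH r.+1 sg'; first by rewrite addnS -addSn.
set w := zword _ _ s p in w0 w1 *.
have E : zact (fun i : 'I_m => e`_i) c i w - mderiv i (dword s p) =
   (vf e`_i w - mderiv i w) - c i *: w + mderiv i (w - dword s p).
  rewrite /zact {1}/lm_act /= vsprojK ?sg ?mem_head // linearB /=.
  set dw := mderiv i w.
  by rewrite [RHS]addrA [_ - _ *: _ + dw]addrAC subrK.
have w' : vanishes r.+1 (zact (fun i : 'I_m => e`_i) c i w - mderiv i (dword s p)).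
  rewrite E; apply: vanishesD; last exact: vanishes_deriv.
  by apply: vanishesD; [exact: vanishes_vf|rewrite -scaleNr; exact: vanishesZ].
split=> //; rewrite -[zact _ _ _ _](subrK (mderiv i (dword s p))).
apply: vanishesD; first exact: vanishesW.
apply: vanishes_deriv; rewrite -[dword s p](subKr w).
apply: vanishesD => //; rewrite -scaleN1r; apply: vanishesZ; exact: vanishesW.
Qed.


(** Up to a positive integer factor, an iterated partial derivative translates
    the exponents by the multiplicities of its letters. *)
Lemma mcoeff_dword (s : seq 'I_m) (p : P) (q : 'X_{1..m}) :
  exists k : nat, (dword s p)@_q =
    p@_(q + [multinom count_mem i s | i < m])%MM *+ k.+1.
Proof.
elim: s p q => [|i s IH] p q.
  exists 0%N; rewrite /= mulr1n; congr (_@__); apply/mnmP => j.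
  by rewrite mnmDE mnmE addn0.
rewrite /= mcoeff_deriv; have [k ->] := IH p (q + U_(i))%MM.
exists (k.+1 * (q i).+1).-1; rewrite prednK ?muln_gt0 // mulrnA.
suff -> : (q + U_(i) + [multinom count_mem i0 s | i0 < m])%MM =
  (q + [multinom count_mem i0 (i :: s) | i0 < m])%MM by [].
by apply/mnmP => j; rewrite !mnmDE !mnmE /= -addnA.
Qed.

Hypothesis char0 : forall k : nat, k.+1%:R != 0 :> K.

(** Take a word of greatest length among those with non-zero coefficients, and
    let the sum act on the monomial whose exponents are the multiplicities of
    its letters. The value at the identity only sees the iterated partial
    derivatives, and of these only the one with the same multiplicities, whose
    value is a non-zero integer in characteristic zero. *)
Lemma zword_free (l : seq (seq 'I_m)) (a : seq 'I_m -> K) :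
    {in l, forall s, {in s, forall i : 'I_m, e`_i \in lie_space g}} ->
    uniq l -> {in l &, forall s t, perm_eq s t -> s = t} ->
    \sum_(s <- l) a s *: zword (M := U_regular g) (fun i : 'I_m => e`_i) c s 1 = 0 ->
  {in l, forall s, a s = 0}.
Proof.
move=> lg lU lperm a0 s0' s0'l; apply/eqP/negPn/negP => as0'.
have [s0 [s0l as0 s0max]] : exists s0, [/\ s0 \in l, a s0 != 0 &
    {in l, forall s, a s != 0 -> (size s <= size s0)%N}].
  have: exists k : nat, has (fun s => (a s != 0) && (size s == k)) l.
    by exists (size s0'); apply/hasP; exists s0' => //; rewrite as0' eqxx.
  move/ex_maxnP => /(_ (\max_(s <- l) size s)%N)[].
    move=> k /hasP[s sl /andP[_ /eqP <-]].
    exact: (leq_bigmax_seq (F := size)).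
  move=> k /hasP[s sl /andP[as0 /eqP sk]] kmax; exists s; split=> // t tl at0.
  by rewrite sk; apply: kmax; apply/hasP; exists t => //; rewrite at0 eqxx.
pose mn s := [multinom count_mem i s | i < m].
pose p0 : poly_module g := 'X_[mn s0].
have degmn s : mdeg (mn s) = size s.
  rewrite mdegE; under eq_bigr do rewrite mnmE.
  elim: s => [|j s IH] /=; first by rewrite big1.
  rewrite big_split /= IH (bigD1 j) //= eqxx big1 // => i ij.
  by rewrite eq_sym (negPf ij).
have van : vanishes (size s0) p0.
  by move=> q qs; rewrite mcoeffX; case: eqP => // qE; move: qs; rewrite -qE degmn ltnn.
have coef s : s \in l -> a s != 0 -> exists k : nat,
    (zword (fun i : 'I_m => e`_i) c s p0 : P)@_0%MM = (mn s0 == mn s)%:R *+ k.+1.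
  move=> sl asn0; have sz := s0max s sl asn0.
  have [_ /(_ 0%MM)] := vanishes_zword (r := size s0 - size s) (lg s sl)
    (eq_ind_r (fun d => vanishes d p0) van (subnKC sz)).
  rewrite mdeg0 mcoeffB => /(_ isT) /eqP; rewrite subr_eq0 => /eqP ->.
  have [k ->] := mcoeff_dword s p0 0%MM; exists k; rewrite mcoeffX.
  by rewrite (_ : (0 + _)%MM = mn s) //; apply/mnmP => i; rewrite mnmDE mnm0E.
have := congr1 (fun u => (Uact u p0 : P)@_0%MM) a0.
rewrite Uact_sum Uact0 mcoeff0 raddf_sum (bigD1_seq s0) //= big_seq_cond.
rewrite big1 => [|s /andP[sl ss0]].
  rewrite UactZ mcoeffZ Uact_zword Uact1.
  have [k ->] := coef s0 s0l as0; rewrite eqxx addr0 => /eqP.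
  by rewrite mulf_eq0 (negPf as0) (negPf (char0 k)).
rewrite UactZ mcoeffZ Uact_zword Uact1.
have [->|asn0] := eqVneq (a s) 0; first by rewrite mul0r.
have [k ->] := coef s sl asn0; case: eqP => [mnE|]; last by rewrite mul0rn mulr0.
case/eqP: ss0; apply: lperm => //; apply/allP => i _ /=.
by move/mnmP/(_ i): mnE; rewrite !mnmE => ->.
Qed.

End PolyModule.

(** * Linear spans and straightening of words *)

Section LinearSpan.
Variables (K : fieldType) (V : lmodType K).
Implicit Type S : V -> Prop.

Inductive lspan S : V -> Prop :=
| lspan0 : lspan S 0
| lspan_cons a x y : S x -> lspan S y -> lspan S (a *: x + y).

Lemma lspan_gen S x : S x -> lspan S x.
Proof. by move=> Sx; rewrite -[x]addr0 -[x in x + _]scale1r; do ?constructor. Qed.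

Lemma lspanD S x y : lspan S x -> lspan S y -> lspan S (x + y).
Proof.
elim=> [|a u v Su _ IH] Sy; first by rewrite add0r.
by rewrite -addrA; constructor => //; apply: IH.
Qed.

Lemma lspanZ S a x : lspan S x -> lspan S (a *: x).
Proof.
elim=> [|b u v Su _ IH]; first by rewrite scaler0; constructor.
by rewrite scalerDr scalerA; constructor.
Qed.

Lemma lspan_lin S a x y : lspan S x -> lspan S y -> lspan S (a *: x + y).
Proof. by move=> Sx Sy; apply: lspanD => //; apply: lspanZ. Qed.

Lemma lspan_sum S I (r : seq I) (F : I -> V) :
  (forall i, lspan S (F i)) -> lspan S (\sum_(i <- r) F i).
Proof.
move=> SF; elim: r => [|i r IH]; first by rewrite big_nil; constructor.
by rewrite big_cons; apply: lspanD.
Qed.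

Lemma lspan_sub S S' : (forall x, S x -> lspan S' x) -> forall x, lspan S x -> lspan S' x.
Proof.
move=> SS' x; elim=> [|a u v Su _ IH]; first by constructor.
by apply: lspan_lin => //; apply: SS'.
Qed.

(** Repeated generators are collected, since the independence statements are
    about sums over lists of distinct indices. *)
Lemma lspan_list (T : eqType) (F : T -> V) (Q : pred T) x :
  lspan (fun y => exists2 t, Q t & y = F t) x ->
  exists (l : seq T) (k : T -> K),
    [/\ uniq l, all Q l & x = \sum_(t <- l) k t *: F t].
Proof.
elim=> [|a _ y [t Qt ->] _ [l [k [lU lQ ->]]]].
  by exists [::], (fun=> 0); rewrite big_nil.
pose k' u := (if u \in l then k u else 0) + (if u == t then a else 0).
have k'E : \sum_(u <- l | u != t) k' u *: F u = \sum_(u <- l | u != t) k u *: F u.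
  rewrite big_seq_cond [RHS]big_seq_cond; apply: eq_bigr => u /andP[ul ut].
  by rewrite /k' ul (negPf ut) addr0.
case: (boolP (t \in l)) => tl.
  exists l, k'; split=> //; rewrite (bigD1_seq t) //= [RHS](bigD1_seq t) //=.
  by rewrite k'E /k' tl eqxx scalerDl addrA [a *: _ + _]addrC.
exists (t :: l), k'; split; rewrite /= ?tl ?Qt //.
rewrite big_cons {1 2}/k' (negPf tl) eqxx add0r; congr (_ + _).
rewrite big_seq [RHS]big_seq; apply: eq_bigr => u ul.
by rewrite /k' ul; case: eqP => [ut|]; rewrite ?addr0 //; rewrite -ut ul in tl.
Qed.

Definition lin_basis (T : eqType) (E : T -> V) : Prop :=
  (forall x, lspan (fun y => exists t, y = E t) x) /\
  (forall (l : seq T) (k : T -> K), uniq l ->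
     \sum_(t <- l) k t *: E t = 0 -> {in l, forall t, k t = 0}).

End LinearSpan.

Lemma lspan_image (K : fieldType) (V W : lmodType K) (f : V -> W) S S' :
  (forall a u v, f (a *: u + v) = a *: f u + f v) ->
  (forall x, S x -> lspan S' (f x)) -> forall x, lspan S x -> lspan S' (f x).
Proof.
move=> f_lin SS' x; elim=> [|a u v Su _ IH]; last first.
  by rewrite f_lin; apply: lspan_lin => //; apply: SS'.
suff -> : f 0 = 0 by constructor.
exact: (lin_at0 f_lin).
Qed.

(** The word with given multiplicities and letters in increasing order, which
    encodes a monomial with ordered factors. *)
Definition mword (N : nat) (a : {ffun 'I_N -> nat}) : seq 'I_N :=
  \big[cat/[::]]_(i < N) nseq (a i) i.

Lemma count_mword N (a : {ffun 'I_N -> nat}) i : count_mem i (mword a) = a i.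
Proof.
rewrite /mword (big_morph (count_mem i) (count_cat _) (erefl _)).
rewrite (bigD1 i) //= count_nseq /= eqxx mul1n.
by rewrite big1 ?addn0 // => j ji; rewrite count_nseq /= (negPf ji).
Qed.

Lemma perm_mword N (s : seq 'I_N) : perm_eq s (mword [ffun i => count_mem i s]).
Proof. by apply/allP => i _ /=; rewrite count_mword ffunE. Qed.

Lemma perm_mword_inj N (a b : {ffun 'I_N -> nat}) :
  perm_eq (mword a) (mword b) -> a = b.
Proof.
by move=> ab; apply/ffunP => i; rewrite -!count_mword; apply/permP: (pred1 i).
Qed.

Section Straightening.
Variables (K : fieldType) (n N : nat) (g : linLie K n).
Variables (b : 'I_N -> 'M[K]_n) (c : 'I_N -> K) (M : lieModule g).
Local Notation z := (zact (M := M) b c).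
Local Notation zw := (zword (M := M) b c).

Lemma zact_lin i a u v : z i (a *: u + v) = a *: z i u + z i v.
Proof.
by rewrite /zact lm_actDr scalerDr scalerBr opprD addrACA !scalerA mulrC.
Qed.

Lemma zword_lin s a u v : zw s (a *: u + v) = a *: zw s u + zw s v.
Proof. by elim: s => //= i s ->; rewrite zact_lin. Qed.

Lemma zword_cat s t v : zw (s ++ t) v = zw s (zw t v).
Proof. by rewrite /zword foldr_cat. Qed.

Lemma zword0 s : zw s 0 = 0.
Proof.
exact: (lin_at0 (zword_lin s)).
Qed.

Lemma zwordZ s a u : zw s (a *: u) = a *: zw s u.
Proof. by have := zword_lin s a u 0; rewrite zword0 !addr0. Qed.

Lemma zwordD s u v : zw s (u + v) = zw s u + zw s v.
Proof. by have := zword_lin s 1 u v; rewrite !scale1r. Qed.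

Lemma zwordB s u v : zw s (u - v) = zw s u - zw s v.
Proof. by rewrite zwordD -scaleN1r zwordZ scaleN1r. Qed.

Lemma zword_sum s I (r : seq I) (F : I -> M) :
  zw s (\sum_(i <- r) F i) = \sum_(i <- r) zw s (F i).
Proof. by apply: (big_morph (zw s)); [exact: zwordD | exact: zword0]. Qed.

Variables (J : pred 'I_N) (unital : bool).
Hypothesis comm : forall i j, J i -> J j -> exists (k : 'I_N -> K) (k0 : K),
  [/\ forall h, ~~ J h -> k h = 0, ~~ unital -> k0 = 0 &
      forall v, z i (z j v) - z j (z i v) = \sum_h k h *: z h v + k0 *: v].

Definition ok_word d (s : seq 'I_N) :=
  [&& all J s, (size s <= d)%N & unital || (s != [::])].

Definition short_span d v := lspan (fun y => exists2 s, ok_word d s & y = zw s v).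

Lemma short_spanW d d' v x : (d <= d')%N -> short_span d v x -> short_span d' v x.
Proof.
move=> dd'; apply: lspan_sub => _ [s /and3P[Js sd us] ->]; apply: lspan_gen.
by exists s => //; apply/and3P; split=> //; apply: leq_trans dd'.
Qed.

(** Exchanging two neighbouring letters costs the commutator, a combination of
    shorter words. The flag unital tells whether commutators may have a scalar
    term; without scalar terms, words that are not empty only produce words
    that are not empty. *)
Lemma zword_swap u i j s v : all J u -> J i -> J j -> all J s ->
  short_span (size u + size s).+1 v (zw (u ++ i :: j :: s) v - zw (u ++ j :: i :: s) v).
Proof.
move=> Ju Ji Jj Js; have [k [k0 [kJ k0u kE]]] := comm Ji Jj.
rewrite !zword_cat -zwordB /= kE zwordD; apply: lspanD.
  rewrite zword_sum; apply: lspan_sum => h.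
  have [Jh|/kJ->] := boolP (J h); last by rewrite scale0r zword0; constructor.
  rewrite zwordZ; apply: lspanZ; apply: lspan_gen; exists (u ++ h :: s).
    by rewrite /ok_word all_cat /= Ju Jh Js size_cat /= addnS leqnn -size_eq0 size_cat addnS orbT.
  by rewrite zword_cat.
have [u1|/k0u->] := boolP unital; last by rewrite scale0r zword0; constructor.
rewrite zwordZ; apply: lspanZ; apply: lspan_gen; exists (u ++ s).
  by rewrite /ok_word all_cat Ju Js size_cat leqnSn u1.
by rewrite zword_cat.
Qed.

Lemma zword_move u i s t v : all J u -> J i -> all J s -> all J t ->
  short_span (size u + size s + size t) v
    (zw (u ++ i :: s ++ t) v - zw (u ++ s ++ i :: t) v).
Proof.
elim: s u => [|j s IH] u Ju Ji Js Jt; first by rewrite subrr; constructor.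
case/andP: Js => Jj Js.
rewrite -[zw (u ++ i :: _) v](subrK (zw (u ++ j :: i :: s ++ t) v)) -addrA.
apply: lspanD.
  apply: short_spanW (zword_swap v Ju Ji Jj _); last by rewrite all_cat; apply/andP.
  by rewrite size_cat /= addnS addSn addnA.
have := IH (rcons u j); rewrite all_rcons Jj Ju => /(_ isT Ji Js Jt).
by rewrite !cat_rcons size_rcons /= !addSn addnS.
Qed.

Lemma zword_perm u s t v : all J u -> all J s -> perm_eq s t ->
  short_span (size u + size s).-1 v (zw (u ++ s) v - zw (u ++ t) v).
Proof.
elim: s t u => [|i s IH] t u Ju Js st.
  by move: st; rewrite perm_sym => /perm_nilP ->; rewrite subrr; constructor.
have it : i \in t by rewrite -(perm_mem st) mem_head.
case/splitPr: it st => t1 t2 st.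
have {}st : perm_eq s (t1 ++ t2).
  by move: st; rewrite perm_sym perm_catC /= perm_cons perm_catC perm_sym.
case/andP: Js => Ji Js.
have /andP[Jt1 Jt2] : all J t1 && all J t2 by rewrite -all_cat -(perm_all _ st).
rewrite -[zw (u ++ _ :: s) v](subrK (zw (u ++ i :: t1 ++ t2) v)) -addrA.
apply: lspanD; last first.
  apply: short_spanW (zword_move v Ju Ji Jt1 Jt2).
  by rewrite /= addnS /= (perm_size st) size_cat addnA.
have := IH (t1 ++ t2) (rcons u i); rewrite all_rcons Ji Ju => /(_ isT Js st).
by rewrite !cat_rcons size_rcons /= addnS.
Qed.

(** Sorting a word only adds shorter words, which are sorted in turn. *)
Lemma straighten s v : all J s -> unital || (s != [::]) ->
  lspan (fun y => exists2 a : {ffun 'I_N -> nat},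
     all J (mword a) && (unital || (mword a != [::])) & y = zw (mword a) v) (zw s v).
Proof.
have [d] := ubnP (size s); elim: d s => // d IH s sd Js us.
have st := perm_mword s; set a := [ffun i => _] in st.
rewrite -[zw s v](subrK (zw (mword a) v)); apply: lspanD; last first.
  apply: lspan_gen; exists a => //; rewrite -(perm_all _ st) Js.
  by rewrite -size_eq0 -(perm_size st) size_eq0.
have [/size0nil s0|s_gt0] := posnP (size s).
  move: st; rewrite s0 perm_sym => /perm_nilP ->; rewrite subrr; constructor.
have /(lspan_sub _) := zword_perm (u := [::]) v isT Js st; apply.
move=> _ [t /and3P[Jt ts ut] ->]; apply: IH => //; apply: leq_ltn_trans ts _.
by rewrite /= -ltnS prednK.
Qed.

End Straightening.

(** * Monomials in the enveloping algebra *)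

(** Used to pass between words in a family and words in a larger family
    containing it. *)
Lemma zword_reindex (K : fieldType) n (g : linLie K n) (M : lieModule g)
    (I I' : Type) (w : I -> I') (b : I -> 'M[K]_n) b' c c' (s : seq I) (v : M) :
  (forall i, b' (w i) = b i) -> (forall i, c' (w i) = c i) ->
  zword (M := M) b' c' (map w s) v = zword (M := M) b c s v.
Proof. by move=> bE cE; elim: s => //= i s ->; rewrite /zact bE cE. Qed.

Section Independence.
Variables (K : fieldType) (n N : nat) (g : linLie K n) (b : N.-tuple 'M[K]_n).
Hypothesis char0 : forall k : nat, k.+1%:R != 0 :> K.
Hypothesis b_free : free b.
Hypothesis b_sub : forall i : 'I_N, b`_i \in lie_space g.
Variable c : 'I_N -> K.

(** A free family is completed to a basis of the whole space of matrices,
    where polynomial functions separate the words. *)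
Lemma pbw_free (l : seq {ffun 'I_N -> nat}) (k : {ffun 'I_N -> nat} -> K) :
    uniq l ->
    \sum_(a <- l) k a *: zword (M := U_regular g) (fun i : 'I_N => b`_i) c (mword a) 1 = 0 ->
  {in l, forall a, k a = 0}.
Proof.
move=> lU sum0.
(* Words in b become words in the first vectors of a basis. *)
pose e0 := b ++ vbasis (<<b>>^C)%VS.
have e0B : basis_of fullv e0.
  rewrite -(addv_complf <<b>>%VS); apply: cat_basis.
  - by apply/directv_addP; rewrite capv_compl.
  - by rewrite /basis_of eqxx b_free.
  - exact: vbasisP.
have e0sz : size e0 == \dim {:'M[K]_n}.
  by have := size_basis (X := in_tuple e0) e0B => ->.
pose e := Tuple e0sz; have eB : basis_of fullv e by [].
have Nm : (N <= \dim {:'M[K]_n})%N.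
  by rewrite -(eqP e0sz) size_cat size_tuple leq_addr.
pose w : 'I_N -> 'I_(\dim {:'M[K]_n}) := widen_ord Nm.
have w_inj : injective w by move=> i j /(congr1 val) /= ij; apply: val_inj.
have ew i : e`_(w i) = b`_i by rewrite /= nth_cat size_tuple ltn_ord.
pose c' (j : 'I_(\dim {:'M[K]_n})) := if insub (val j) is Some i then c i else 0.
have cw i : c' (w i) = c i.
  by rewrite /c' /=; case: insubP => [i' _ /val_inj -> //|]; rewrite ltn_ord.
pose k' (s : seq 'I_(\dim {:'M[K]_n})) := k [ffun i => count_mem (w i) s].
have count_w i s : count_mem (w i) (map w s) = count_mem i s.
  by rewrite count_map; apply: eq_count => j /=; rewrite inj_eq.
have kw a : k' (map w (mword a)) = k a.
  by congr k; apply/ffunP => i; rewrite ffunE count_w count_mword.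
move=> a al; rewrite -kw.
apply: (@zword_free K n e eB g c' char0 [seq map w (mword x) | x <- l]).
- move=> _ /mapP[x _ ->] _ /mapP[i _ ->]; rewrite ew; exact: b_sub.
- rewrite map_inj_uniq // => x y /(inj_map w_inj) xy.
  by apply: perm_mword_inj; rewrite xy.
- move=> _ _ /mapP[x _ ->] /mapP[y _ ->] xy; congr map; congr mword.
  by apply/ffunP => i; rewrite -!count_mword -!count_w; apply/permP: (pred1 (w i)).
- rewrite big_map -[RHS]sum0; apply: eq_bigr => x _; rewrite kw; congr (_ *: _).
  by apply: zword_reindex => i; [exact: ew|exact: cw].
- exact: map_f.
Qed.

End Independence.

Section Generation.
Variables (K : fieldType) (n N : nat) (g : linLie K n) (b : N.-tuple 'M[K]_n).
Hypothesis b_span : <<b>>%VS = lie_space g.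
Variable c : 'I_N -> K.
Variable M : lieModule g.
Local Notation z := (zact (M := M) (fun i : 'I_N => b`_i) c).

Lemma act_expand x (v : M) : x \in lie_space g ->
  lm_act (vsproj g x) v =
    \sum_i coord b i x *: z i v + (\sum_i coord b i x * c i) *: v.
Proof.
move=> gx; rewrite {1}(coord_span (_ : x \in <<b>>%VS)) ?b_span //.
rewrite linear_sum scaler_suml -big_split /=.
rewrite (big_morph (fun y => lm_act y v) (fun x y => lm_act_addl x y v) (lm_act_0l v)).
apply: eq_bigr => i _; rewrite linearZ lm_act_scalel /zact scalerBr scalerA.
by rewrite subrK.
Qed.

(** Shifting by scalars does not change commutators. *)
Lemma zact_comm i j v :
  z i (z j v) - z j (z i v) = lm_act (vsproj g (lieb b`_i b`_j)) v.
Proof.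
have bg k : (k < N)%N -> b`_k \in lie_space g.
  by move=> kN; rewrite -b_span memv_span // mem_nth ?size_tuple.
have -> : vsproj g (lieb b`_i b`_j) = lie_br (vsproj g b`_i) (vsproj g b`_j).
  by rewrite /lie_br !vsprojK ?bg.
pose S (p q : 'I_N) := c q *: lm_act (vsproj g b`_p) v + c p *: lm_act (vsproj g b`_q) v -
  (c p * c q) *: v.
have z2 (k h : 'I_N) : z k (z h v) =
    lm_act (vsproj g b`_k) (lm_act (vsproj g b`_h) v) - S k h.
  rewrite {1}/zact {1}/zact lm_actD -[- (c h *: v)]scaleNr lm_actZ scaleNr /zact.
  rewrite /S scalerBr scalerA opprD opprB opprD !addrA opprK addrAC.
  by congr (_ - _); rewrite addrAC.
have cancel_same (x y t : M) : x - t - (y - t) = x - y by rewrite opprB addrA subrK.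
rewrite !z2 (_ : S j i = S i j) ?cancel_same ?lm_actB //.
by rewrite /S addrC [c j * _]mulrC [X in X - _]addrC addrC.
Qed.

End Generation.

Section GenerationU.
Variables (K : fieldType) (n N : nat) (g : linLie K n) (b : N.-tuple 'M[K]_n).
Hypothesis b_span : <<b>>%VS = lie_space g.
Variable c : 'I_N -> K.
Local Notation z := (zact (M := U_regular g) (fun i : 'I_N => b`_i) c).
Local Notation zw := (zword (M := U_regular g) (fun i : 'I_N => b`_i) c).

Import finmap monalg.

Lemma U_pi0 : U_pi (0 : U_free g) = 0.
Proof. by have := U_piB (0 : U_free g) 0; rewrite subr0 subrr. Qed.

Lemma U_pi_monom (s : seq (subvs_of g)) :
  U_pi (mkmalgU (FMonom s) 1 : U_free g) = word_act s (1 : U_regular g).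
Proof.
elim: s => [|x s IH]; first by congr U_pi; congr mkmalgU; rewrite -fmoneE.
transitivity (U_iota x * U_pi (mkmalgU (FMonom s) 1 : U_free g)); last first.
  by rewrite IH.
rewrite /U_iota -U_piM; congr U_pi.
apply/esym/(etrans (fgmulUU 1 1 (fmu x) (FMonom s))).
by rewrite mulr1; congr mkmalgU; apply/eqP; rewrite fmP fmM fmU.
Qed.

Lemma U_pi_free_act (t : U_free g) : U_pi t = free_act t (1 : U_regular g).
Proof.
rewrite {1}(monalgE t) (big_morph _ (@U_piD _ _ _) U_pi0).
apply: eq_bigr => m _; rewrite -U_pi_monom fmK -U_piZ; congr U_pi.
by apply/malgP => k; rewrite mcoeffZ !mcoeffU mulrnAr mulr1.
Qed.

(** Expanding each element of the Lie algebra in the basis turns a product of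
    elements into a combination of words. *)
Lemma U_generated (u : Ug g) : lspan (fun y => exists s, y = zw s 1) (u : U_regular g).
Proof.
have step x (v : U_regular g) : lspan (fun y => exists s, y = zw s 1) v ->
    lspan (fun y => exists s, y = zw s 1) (lm_act x v).
  move=> Sv; rewrite -[x]vsvalK (act_expand b_span c v (subvsP x)).
  apply: lspanD; last exact: lspanZ.
  apply: lspan_sum => i; apply: lspanZ.
  apply: (lspan_image (f := z i)) Sv => [a x' y'|_ [s ->]].
    exact: zact_lin.
  by apply: lspan_gen; exists (i :: s).
rewrite -[u]U_reprK U_pi_free_act; apply: lspan_sum => m; apply: lspanZ.
elim: (fmonom_val m) => [|x s IH]; last exact: step.
by apply: lspan_gen; exists [::].
Qed.

End GenerationU.

(** * Monomial bases of Verma modules *)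

Lemma mword_split p q (a : {ffun 'I_(p + q) -> nat}) :
  mword a = map (lshift q) (mword [ffun i => a (lshift q i)]) ++
            map (@rshift p q) (mword [ffun j => a (rshift p j)]).
Proof.
rewrite /mword big_split_ord /=; congr (_ ++ _).
  rewrite (big_morph (map (lshift q)) (map_cat _) (erefl _)).
  by apply: eq_bigr => i _; rewrite map_nseq ffunE.
rewrite (big_morph (map (@rshift p q)) (map_cat _) (erefl _)).
by apply: eq_bigr => i _; rewrite map_nseq ffunE.
Qed.

Definition ffun_cat p q (a1 : {ffun 'I_p -> nat}) (a2 : {ffun 'I_q -> nat}) :
    {ffun 'I_(p + q) -> nat} :=
  [ffun i => match split i with inl j => a1 j | inr j => a2 j end].

Lemma ffun_catl p q a1 a2 : [ffun i => @ffun_cat p q a1 a2 (lshift q i)] = a1.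
Proof. by apply/ffunP => i; rewrite !ffunE; case: split_ordP => j /eqP; rewrite ?eq_shift // => /eqP->. Qed.

Lemma ffun_catr p q a1 a2 : [ffun i => @ffun_cat p q a1 a2 (rshift p i)] = a2.
Proof. by apply/ffunP => i; rewrite !ffunE; case: split_ordP => j /eqP; rewrite ?eq_shift // => /eqP->. Qed.

Lemma mword_cat p q a1 a2 :
  mword (@ffun_cat p q a1 a2) = map (lshift q) (mword a1) ++ map (@rshift p q) (mword a2).
Proof. by rewrite mword_split ffun_catl ffun_catr. Qed.

Lemma mword0 N : mword [ffun _ : 'I_N => 0%N] = [::].
Proof. by rewrite /mword big1 // => i _; rewrite ffunE. Qed.

Lemma quot_act (K : fieldType) n (g : linLie K n) (M : lieModule g)
    (N : lieSubmodule M) x (v : M) :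
  lm_act (l := quotmod N) x (qm_pi N v) = qm_pi N (lm_act x v).
Proof. exact: qm_act_pi. Qed.

Lemma quot_zword (K : fieldType) n (g : linLie K n) (M : lieModule g)
    (N : lieSubmodule M) (I : Type) (b : I -> 'M[K]_n) c s (v : M) :
  zword (M := quotmod N) b c s (qm_pi N v) = qm_pi N (zword b c s v).
Proof.
elim: s => //= i s ->; rewrite /zact quot_act.
by rewrite -scaleNr -qm_piZ -qm_piD scaleNr.
Qed.

Lemma mem_gen_submod (K : fieldType) n (g : linLie K n) (M : lieModule g)
    (S : set M) v : S v -> sm_set (gen_submod S) v.
Proof. by move=> Sv; exact (fun (N : lieSubmodule M) (SN : (S `<=` N)%classic) => SN v Sv). Qed.

Lemma gen_submod_sub (K : fieldType) n (g : linLie K n) (M : lieModule g)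
    (S : set M) (N : lieSubmodule M) v :
  (S `<=` N)%classic -> sm_set (gen_submod S) v -> sm_set N v.
Proof. by move=> SN Sv; exact: (Sv N SN). Qed.

(** The span of neg plays the part of the opposite nilradical. *)
Record triangular (K : fieldType) n (D : borelData K n) (r s t : nat)
    (neg : r.-tuple 'M[K]_n) (car : s.-tuple 'M[K]_n) (pos : t.-tuple 'M[K]_n) : Prop :=
  Triangular {
    tri_free : free (cat_tuple neg (cat_tuple car pos));
    tri_span : <<cat_tuple neg (cat_tuple car pos)>>%VS = lie_space D;
    tri_car : <<car>>%VS = bd_cartan D;
    tri_pos : <<pos>>%VS = bd_nil D;
    tri_br : forall x y, x \in cat_tuple car pos -> y \in cat_tuple car pos ->
      lieb x y \in <<pos>>%VS }.

Section VermaBasis.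
Variables (K : fieldType) (n : nat) (D : borelData K n) (r s t : nat).
Hypothesis char0 : forall k : nat, k.+1%:R != 0 :> K.
Variables (neg : r.-tuple 'M[K]_n) (car : s.-tuple 'M[K]_n) (pos : t.-tuple 'M[K]_n).
Hypothesis tri : triangular D neg car pos.
Variable lambda : hdual (bd_cartan D).

Local Notation N := (r + (s + t))%N.
Local Notation b := (cat_tuple neg (cat_tuple car pos)).

Lemma wt_at_sum I (l : seq I) (F : I -> 'M[K]_n) :
  wt_at lambda (\sum_(i <- l) F i) = \sum_(i <- l) wt_at lambda (F i).
Proof. by rewrite /wt_at !linear_sum. Qed.

Lemma wt_atZ a x : wt_at lambda (a *: x) = a * wt_at lambda x.
Proof. by rewrite /wt_at !linearZ. Qed.

Lemma nth_neg (i : 'I_r) : b`_(lshift (s + t) i) = neg`_i.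
Proof. by rewrite /= nth_cat size_tuple ltn_ord. Qed.

Lemma nth_bor (i : 'I_(s + t)) : b`_(rshift r i) = (car ++ pos)`_i.
Proof. by rewrite /= nth_cat size_tuple ltnNge leq_addr /= addKn. Qed.

Lemma nth_car (i : 'I_s) : b`_(rshift r (lshift t i)) = car`_i.
Proof. by rewrite nth_bor nth_cat size_tuple /= ltn_ord. Qed.

Lemma nth_pos (i : 'I_t) : b`_(rshift r (rshift s i)) = pos`_i.
Proof. by rewrite nth_bor nth_cat size_tuple /= ltnNge leq_addr /= addKn. Qed.

Lemma coord_b i j : coord b j b`_(i : 'I_N) = (i == j)%:R.
Proof. by rewrite coord_free ?(tri_free tri). Qed.

(** The character of the Borel subalgebra on its basis vectors, extended by
    zero to the negative ones. *)
Definition bshift (i : 'I_N) : K :=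
  match split i with
  | inl _ => 0
  | inr j => match split j with inl k => wt_at lambda car`_k | inr _ => 0 end
  end.

Lemma bshift_neg i : bshift (lshift (s + t) i) = 0.
Proof. by rewrite /bshift; case: split_ordP => // j /eqP; rewrite eq_shift. Qed.

Lemma bshift_pos i : bshift (rshift r (rshift s i)) = 0.
Proof.
rewrite /bshift; case: split_ordP => j /eqP; rewrite eq_shift // => /eqP <-.
by case: split_ordP => // k /eqP; rewrite eq_shift.
Qed.

Lemma bshift_car i : bshift (rshift r (lshift t i)) = wt_at lambda car`_i.
Proof.
rewrite /bshift; case: split_ordP => j /eqP; rewrite eq_shift // => /eqP <-.
by case: split_ordP => k /eqP; rewrite eq_shift // => /eqP <-.
Qed.

Let chi x := \sum_i coord b i x * bshift i.

Let chi_lin a x y : chi (a *: x + y) = a * chi x + chi y.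
Proof.
rewrite /chi mulr_sumr -big_split; apply: eq_bigr => i _ /=.
by rewrite linearP mulrDl mulrA.
Qed.

Let chi_sum I (l : seq I) (F : I -> 'M[K]_n) : chi (\sum_(i <- l) F i) = \sum_(i <- l) chi (F i).
Proof.
rewrite /chi exchange_big; apply: eq_bigr => i _.
by rewrite linear_sum mulr_suml.
Qed.

Let chiZ a x : chi (a *: x) = a * chi x.
Proof. by rewrite /chi mulr_sumr; apply: eq_bigr => i _; rewrite linearZ mulrA. Qed.

Let chi_b i : chi b`_(i : 'I_N) = bshift i.
Proof.
rewrite /chi (bigD1 i) //= coord_b eqxx mul1r big1 ?addr0 // => j ji.
by rewrite coord_b eq_sym (negPf ji) mul0r.
Qed.

Let chi_h x : x \in bd_cartan D -> chi x = wt_at lambda x.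
Proof.
move=> hx; have /coord_span -> : x \in <<car>>%VS by rewrite (tri_car tri).
rewrite chi_sum wt_at_sum.
by apply: eq_bigr => i _; rewrite chiZ wt_atZ -nth_car chi_b bshift_car nth_car.
Qed.

Let chi_n x : x \in bd_nil D -> chi x = 0.
Proof.
rewrite -(tri_pos tri) => /coord_span ->; rewrite chi_sum big1 // => i _.
by rewrite chiZ -nth_pos chi_b bshift_pos mulr0.
Qed.

Let coord_bor x (i : 'I_r) : x \in (bd_cartan D + bd_nil D)%VS ->
  coord b (lshift (s + t) i) x = 0.
Proof.
rewrite -(tri_car tri) -(tri_pos tri) -span_cat.
move=> /(coord_span (X := cat_tuple car pos)) ->.
rewrite linear_sum big1 // => j _; rewrite linearZ /= -nth_bor coord_b.
by rewrite eq_shift mulr0.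
Qed.

Local Notation zU := (zact (M := U_regular D) (fun i : 'I_N => b`_i) bshift).
Local Notation zwU := (zword (M := U_regular D) (fun i : 'I_N => b`_i) bshift).

Let bor : pred 'I_N := fun i => (r <= i)%N.

Lemma borP i : bor i -> exists j, i = rshift r j.
Proof.
by rewrite /bor => ri; case: (split_ordP i) ri => j -> /=; [rewrite leqNgt ltn_ord|exists j].
Qed.

Local Notation z := (zact (fun i : 'I_N => b`_i) bshift).

Lemma comm_all (M : lieModule D) (i j : 'I_N) :
  exists (k : 'I_N -> K) (k0 : K),
  [/\ forall h, ~~ predT h -> k h = 0, ~~ true -> k0 = 0 &
      forall v : M, z i (z j v) - z j (z i v) = \sum_h k h *: z h v + k0 *: v].
Proof.
have bD (h : 'I_N) : b`_h \in lie_space D.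
  by rewrite -(tri_span tri) memv_span // mem_nth ?size_tuple.
exists (fun h => coord b h (lieb b`_i b`_j)), (chi (lieb b`_i b`_j)); split=> // v.
by rewrite zact_comm ?(tri_span tri) // (act_expand (tri_span tri) bshift) // lie_closed.
Qed.

(** The bracket of two elements of the Borel subalgebra lies in the
    nilradical, on which the character vanishes; hence no scalar term. *)
Lemma comm_bor (M : lieModule D) (i j : 'I_N) : bor i -> bor j ->
  exists (k : 'I_N -> K) (k0 : K),
  [/\ forall h, ~~ bor h -> k h = 0, ~~ false -> k0 = 0 &
      forall v : M, z i (z j v) - z j (z i v) = \sum_h k h *: z h v + k0 *: v].
Proof.
have bD (h : 'I_N) : b`_h \in lie_space D.
  by rewrite -(tri_span tri) memv_span // mem_nth ?size_tuple.
move=> /borP[i' ->] /borP[j' ->]; pose x := lieb b`_(rshift r i') b`_(rshift r j').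
have xn : x \in bd_nil D.
  by rewrite -(tri_pos tri) /x !nth_bor; apply: (tri_br tri); rewrite mem_nth ?size_tuple.
exists (fun h => coord b h x), 0; split=> // [h|v].
  rewrite /bor -ltnNge => hr; rewrite (_ : h = lshift _ (Ordinal hr)); last exact: val_inj.
  by apply: coord_bor; rewrite (subvP (addvSr _ _)).
rewrite zact_comm ?(tri_span tri) // (act_expand (tri_span tri) bshift); last exact: lie_closed.
by rewrite -/x -/(chi x) chi_n.
Qed.

(** Words ending in a letter of the shifted Borel subalgebra span the left
    ideal that defines the Verma module. *)
Let ideal (y : U_regular D) : Prop :=
  lspan (fun y => exists w i, bor i /\ y = zwU (rcons w i) 1) y.

Let ideal_act x v : ideal v -> ideal (lm_act x v).
Proof.
apply: (lspan_image (f := lm_act x)) => [|_ [w [i [bi ->]]]].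
  exact: lm_actDr.
rewrite -[x]vsvalK (act_expand (tri_span tri) bshift _ (subvsP x)).
apply: lspanD.
  apply: lspan_sum => j; apply: lspanZ; apply: lspan_gen.
  by exists (j :: w), i.
by apply: lspanZ; apply: lspan_gen; exists w, i.
Qed.

Let ideal_sub : lieSubmodule (U_regular D) :=
  LieSubmodule (lspan0 _) (@lspan_lin _ _ _) ideal_act.

Let ideal_rel : (verma_rel (D := D) lambda `<=` ideal_sub)%classic.
Proof.
move=> _ [x [e [hx ne ->]]].
have xe : x + e \in (bd_cartan D + bd_nil D)%VS by rewrite memv_add.
have -> : U_iota (vsproj D (x + e)) = lm_act (l := U_regular D) (vsproj D (x + e)) 1.
  exact/esym/mulr1.
rewrite (act_expand (tri_span tri) bshift); last exact: subvP (bd_sub D) _ xe.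
rewrite -/(chi _) (_ : chi (x + e) = wt_at lambda x); last first.
  by have := chi_lin 1 x e; rewrite scale1r mul1r (chi_h hx) (chi_n ne) addr0.
rewrite addrK; apply: lspan_sum => i.
case: (split_ordP i) => j ->.
  by rewrite coord_bor // scale0r; constructor.
apply: lspanZ; apply: lspan_gen; exists [::], (rshift r j); split=> //.
exact: leq_addr.
Qed.

Let bor_word (a : {ffun 'I_N -> nat}) := has bor (mword a).

(** The letters before the last one are sorted first, which collects the
    letters of the Borel subalgebra at the end; this end is then sorted
    without scalar terms, so it does not become empty. *)
Let ideal_straight y : ideal y ->
  lspan (fun y => exists2 a, bor_word a & y = zwU (mword a) 1) y.
Proof.
apply: lspan_sub => _ [w [i [bi ->]]].
rewrite -cats1 zword_cat.
have /(lspan_sub _) := straighten (J := predT) (unital := true)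
  (fun i j _ _ => comm_all (U_regular D) i j) (zwU [:: i] 1) (all_predT w) isT.
apply=> _ [a _ ->]; rewrite -zword_cat mword_split -catA zword_cat.
set w1 := map (lshift _) _; set w2 := map (@rshift r (s + t)) _ ++ _.
have w2b : all bor w2.
  rewrite all_cat all_seq1 bi andbT; apply/allP => _ /mapP[j _ ->]; exact: leq_addr.
have w2n : false || (w2 != [::]) by rewrite /w2; case: (map _ _).
have := straighten (J := bor) (unital := false)
  (comm_bor (U_regular D)) (1 : U_regular D) w2b w2n.
apply: (lspan_image (f := zwU w1)) => [|_ [a' /andP[ba' na'] ->]].
  exact: zword_lin.
apply: lspan_gen.
pose a1 := [ffun i => a (lshift (s + t) i)]; pose a2 := [ffun j => a' (rshift r j)].
have a'E : mword a' = map (@rshift r (s + t)) (mword a2).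
  rewrite mword_split [X in X ++ _](_ : _ = [::]) //.
  case E : (mword _) => [|j l] //; have /allP/(_ (lshift (s + t) j)) := ba'.
  by rewrite mword_split E mem_head /bor /= leqNgt ltn_ord => /(_ isT).
exists (ffun_cat a1 a2); last by rewrite mword_cat zword_cat -a'E.
rewrite /bor_word mword_cat has_cat -a'E.
by case: (mword a') ba' na' => //= j l /andP[-> _] _; rewrite orbT.
Qed.

Definition verma_vec : verma lambda := qm_pi _ (1 : U_regular D).

Lemma verma_vec_act x e : x \in bd_cartan D -> e \in bd_nil D ->
  lm_act (vsproj D (x + e)) verma_vec = wt_at lambda x *: verma_vec.
Proof.
move=> hx ne; rewrite /verma_vec quot_act -qm_piZ; apply/qm_piP.
apply/asboolP/mem_gen_submod; exists x, e; split=> //.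
by congr (_ - _); exact: mulr1.
Qed.

Lemma zact_verma_vec (j : 'I_(s + t)) :
  zact (M := verma lambda) (fun i : 'I_N => b`_i) bshift (rshift r j) verma_vec = 0.
Proof.
rewrite /zact; case: (split_ordP j) => i ->.
  have ch : car`_i \in bd_cartan D by rewrite -(tri_car tri) memv_span // mem_nth ?size_tuple.
  have := verma_vec_act ch (mem0v _); rewrite addr0 bshift_car nth_car => ->.
  by rewrite subrr.
have pn : pos`_i \in bd_nil D by rewrite -(tri_pos tri) memv_span // mem_nth ?size_tuple.
have := verma_vec_act (mem0v _) pn; rewrite add0r bshift_pos nth_pos => ->.
by rewrite /wt_at !linear0 !scale0r subrr.
Qed.

Definition verma_mon (a : {ffun 'I_r -> nat}) : verma lambda :=
  zword (fun i : 'I_r => neg`_i) (fun=> 0) (mword a) verma_vec.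

Let verma_monE a : verma_mon a =
  qm_pi _ (zwU (map (lshift (s + t)) (mword a)) 1).
Proof.
rewrite -quot_zword; apply/esym/zword_reindex => i; [exact: nth_neg|exact: bshift_neg].
Qed.

(** Spanning: the vector of highest weight is killed by the shifted letters of
    the Borel subalgebra, so only sorted words in the negative letters
    survive. Independence: a combination of these words that lies in the left
    ideal is also a combination of sorted words with a letter of the Borel
    subalgebra, and sorted words are independent. *)
Theorem verma_basis : lin_basis verma_mon.
Proof.
split=> [v|l k lU sum0].
  rewrite -[v]qm_reprK.
  have := U_generated (tri_span tri) bshift (qm_repr v).
  apply: (lspan_image (f := qm_pi _)) => [a u w|_ [w ->]].
    by rewrite qm_piD qm_piZ.
  have := straighten (J := predT) (unital := true)
    (fun i j _ _ => comm_all (U_regular D) i j) (1 : U_regular D) (all_predT w) isT.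
  apply: (lspan_image (f := qm_pi _)) => [a u v'|_ [a _ ->]].
    by rewrite qm_piD qm_piZ.
  rewrite mword_split; set a1 := [ffun i => a (lshift _ i)].
  set a2 := [ffun j => a (rshift r j)].
  case/lastP: (mword a2) => [|w2 j].
    rewrite (_ : map (@rshift r (s + t)) [::] = [::]) // cats0.
    by apply: lspan_gen; exists a1; rewrite verma_monE.
  rewrite map_rcons -cats1 catA -quot_zword zword_cat.
  rewrite [zword _ _ [:: _] _]zact_verma_vec zword0; constructor.
pose ext (a1 : {ffun 'I_r -> nat}) := ffun_cat a1 [ffun _ : 'I_(s + t) => 0%N].
have extE a1 : mword (ext a1) = map (lshift (s + t)) (mword a1).
  by rewrite mword_cat mword0 cats0.
pose y : U_regular D := \sum_(a <- l) k a *: zwU (mword (ext a)) 1.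
have : ideal y.
  have /qm_piP : qm_pi (gen_submod (verma_rel (D := D) lambda)) y = qm_pi _ 0.
    have qm_pi0 : qm_pi (gen_submod (verma_rel (D := D) lambda)) 0 = 0.
      by have := qm_piB (gen_submod (verma_rel (D := D) lambda)) 0 0; rewrite subrr => ->; rewrite subrr.
    rewrite qm_pi0 -sum0 /y (big_morph _ (@qm_piD _ _ _ _ _) qm_pi0).
    by apply: eq_bigr => a _; rewrite qm_piZ extE verma_monE.
  by rewrite subr0 => /asboolP/(gen_submod_sub ideal_rel).
move=> /ideal_straight /lspan_list[l2 [k2 [l2U l2b yE]]].
(* The two expressions of y, as one relation between sorted words. *)
pose kk x := if x \in l2 then - k2 x else k [ffun i => x (lshift (s + t) i)].
have ext_l2 a1 : ext a1 \notin l2.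
  apply: contraL l2b => a1l2; apply/allPn; exists (ext a1) => //.
  rewrite /bor_word extE has_map; apply/hasPn => i _ /=.
  by rewrite /bor -ltnNge /= ltn_ord.
have kkE a1 : kk (ext a1) = k a1 by rewrite /kk (negPf (ext_l2 a1)) ffun_catl.
have bD (h : 'I_N) : b`_h \in lie_space D.
  by rewrite -(tri_span tri) memv_span // mem_nth ?size_tuple.
move=> a al; rewrite -kkE.
apply: (pbw_free char0 (tri_free tri) bD (c := bshift) (l := map ext l ++ l2)); last first.
- by rewrite mem_cat map_f.
- rewrite big_cat big_map /=; apply/eqP; rewrite addr_eq0; apply/eqP.
  transitivity y; first by apply: eq_bigr => x _; rewrite kkE.
  rewrite yE -sumrN big_seq [RHS]big_seq; apply: eq_bigr => x xl2.
  by rewrite /kk xl2 scaleNr opprK.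
have ext_inj : injective ext.
  move=> a1 a2; move/(congr1 (fun f : {ffun 'I_N -> nat} =>
    [ffun i : 'I_r => f (lshift (s + t) i)])).
  by rewrite !ffun_catl.
rewrite cat_uniq l2U andbT map_inj_uniq // lU.
by apply/hasPn => x xl2; apply/negP => /mapP[a1 _ xE]; have := ext_l2 a1; rewrite -xE xl2.
Qed.

End VermaBasis.

(** * Weight vectors *)

Section Weights.
Variables (K : fieldType) (n : nat) (D : borelData K n).
Local Notation h := (bd_cartan D).
Implicit Type M : lieModule D.

Lemma sm_D M (N : lieSubmodule M) u v : sm_set N u -> sm_set N v -> sm_set N (u + v).
Proof. by move=> Nu Nv; rewrite -[u]scale1r; apply: sm_lin. Qed.

Lemma sm_Z M (N : lieSubmodule M) a u : sm_set N u -> sm_set N (a *: u).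
Proof. by move=> Nu; rewrite -[_ *: _]addr0; apply: sm_lin => //; apply: sm_0. Qed.

Lemma sm_B M (N : lieSubmodule M) u v : sm_set N u -> sm_set N v -> sm_set N (u - v).
Proof. by move=> Nu Nv; rewrite -scaleN1r addrC; apply: sm_lin. Qed.

Lemma sm_addl M (N : lieSubmodule M) u v : sm_set N u -> sm_set N (u + v) -> sm_set N v.
Proof. by move=> Nu Nuv; rewrite -[v](addKr u) addrC; apply: sm_B. Qed.

Lemma sm_sum M (N : lieSubmodule M) (I : Type) (l : seq I) (F : I -> M) :
  (forall i, sm_set N (F i)) -> sm_set N (\sum_(i <- l) F i).
Proof.
move=> NF; elim: l => [|i l IH]; first by rewrite big_nil; apply: sm_0.
by rewrite big_cons; apply: sm_D.
Qed.

Lemma sm_at M (N : lieSubmodule M) x v : sm_set N v -> sm_set N (act_at x v).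
Proof. exact: sm_act. Qed.

Lemma sm_eq M (N N' : lieSubmodule M) : (forall v, sm_set N v <-> sm_set N' v) -> N = N'.
Proof.
case: N => s a b c; case: N' => s' a' b' c' /= ss'.
have {ss'} E : s = s' by apply/funext => v; apply/propext.
by subst s'; congr LieSubmodule; apply: Prop_irrelevance.
Qed.

Lemma h_sub x : x \in h -> x \in lie_space D.
Proof. by move=> hx; apply: (subvP (bd_sub D)); apply: (subvP (addvSl _ _)). Qed.

Lemma n_sub x : x \in bd_nil D -> x \in lie_space D.
Proof. by move=> hx; apply: (subvP (bd_sub D)); apply: (subvP (addvSr _ _)). Qed.

Lemma act_at_lin M x a (u v : M) : act_at x (a *: u + v) = a *: act_at x u + act_at x v.
Proof. exact: lm_actDr. Qed.

Lemma act_atD M x (u v : M) : act_at x (u + v) = act_at x u + act_at x v.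
Proof. exact: lm_actD. Qed.

Lemma act_atZ M x a (u : M) : act_at x (a *: u) = a *: act_at x u.
Proof. exact: lm_actZ. Qed.

Lemma act_at_sum M x I (r : seq I) (F : I -> M) :
  act_at x (\sum_(i <- r) F i) = \sum_(i <- r) act_at x (F i).
Proof. exact: lm_act_sum. Qed.

Lemma act_at_suml M I (r : seq I) (F : I -> 'M[K]_n) (v : M) :
  act_at (\sum_(i <- r) F i) v = \sum_(i <- r) act_at (F i) v.
Proof.
rewrite /act_at linear_sum.
exact: (big_morph (fun y => lm_act y v) (fun x y => lm_act_addl x y v) (lm_act_0l v)).
Qed.

Lemma act_atZl M a x (v : M) : act_at (a *: x) v = a *: act_at x v.
Proof. by rewrite /act_at linearZ lm_act_scalel. Qed.

Lemma act_at_br M x y (v : M) : x \in lie_space D -> y \in lie_space D ->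
  act_at x (act_at y v) = act_at y (act_at x v) + act_at (lieb x y) v.
Proof.
move=> xD yD; have -> : act_at (lieb x y) v = lm_act (lie_br (vsproj D x) (vsproj D y)) v.
  by rewrite /act_at; congr lm_act; apply: val_inj; rewrite /= vsval_lie_br !vsprojK ?lie_closed.
by rewrite lm_actB addrC subrK.
Qed.

Lemma lm_act_at M x (v : M) : lm_act x v = act_at (vsval x) v.
Proof. by rewrite /act_at vsvalK. Qed.

Lemma wt_atD (mu nu : hdual h) x : wt_at (mu + nu) x = wt_at mu x + wt_at nu x.
Proof. by rewrite /wt_at add_lfunE. Qed.

Lemma wt_at_inj (mu nu : hdual h) :
  (forall x, x \in h -> wt_at mu x = wt_at nu x) -> mu = nu.
Proof.
move=> munu; apply/lfunP => x; have := munu _ (subvsP x).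
by rewrite /wt_at vsvalK.
Qed.

Lemma wt_sep (mu nu : hdual h) : mu <> nu ->
  exists2 x, x \in h & wt_at mu x != wt_at nu x.
Proof.
move=> munu; apply: contrapT => nex; apply: munu; apply: wt_at_inj => x hx.
by apply: contrapT => /eqP ne; apply: nex; exists x.
Qed.

Lemma wv_lin M (mu : hdual h) a (u v : M) :
  weight_vector mu u -> weight_vector mu v -> weight_vector mu (a *: u + v).
Proof.
by move=> wu wv x hx; rewrite act_at_lin wu // wv // scalerDr !scalerA mulrC.
Qed.

Lemma wv_0 M (mu : hdual h) : weight_vector mu (0 : M).
Proof. by move=> x hx; rewrite /act_at lm_act0 scaler0. Qed.

Lemma wv_Z M (mu : hdual h) a (u : M) : weight_vector mu u -> weight_vector mu (a *: u).
Proof. by move=> wu; rewrite -[_ *: _]addr0; apply: wv_lin => //; apply: wv_0. Qed.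

Lemma wv_D M (mu : hdual h) (u v : M) :
  weight_vector mu u -> weight_vector mu v -> weight_vector mu (u + v).
Proof. by move=> wu wv; rewrite -[u]scale1r; apply: wv_lin. Qed.

Lemma wv_B M (mu : hdual h) (u v : M) :
  weight_vector mu u -> weight_vector mu v -> weight_vector mu (u - v).
Proof. by move=> wu wv; rewrite -scaleN1r addrC; apply: wv_lin. Qed.

Lemma wv_root M (mu rt : hdual h) y (v : M) : y \in lie_space D ->
  (forall x, x \in h -> lieb x y = wt_at rt x *: y) ->
  weight_vector mu v -> weight_vector (mu + rt) (act_at y v).
Proof.
move=> yD yrt wv x hx; rewrite (act_at_br _ (h_sub hx) yD) wv // yrt //.
by rewrite act_atZ act_atZl wt_atD scalerDl.
Qed.

Definition off_weight M (kappa : hdual h) (a : M) : Prop :=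
  exists l : seq M, a = \sum_(w <- l) w /\
    forall w, w \in l -> exists2 mu : hdual h, mu <> kappa & weight_vector mu w.

Lemma off_weight0 M kappa : off_weight kappa (0 : M).
Proof. by exists [::]; rewrite big_nil. Qed.

Lemma off_weight1 M (kappa mu : hdual h) (w : M) : mu <> kappa -> weight_vector mu w -> off_weight kappa w.
Proof.
move=> ne ww; exists [:: w]; rewrite big_seq1; split=> // w'.
by rewrite inE => /eqP ->; exists mu.
Qed.

Lemma off_weightD M kappa (a b : M) :
  off_weight kappa a -> off_weight kappa b -> off_weight kappa (a + b).
Proof.
move=> [l [-> lw]] [l' [-> lw']]; exists (l ++ l'); rewrite big_cat; split=> // w.
by rewrite mem_cat => /orP[/lw|/lw'].
Qed.

Lemma off_weightZ M kappa c (a : M) : off_weight kappa a -> off_weight kappa (c *: a).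
Proof.
move=> [l [-> lw]]; exists (map (fun w => c *: w) l); rewrite big_map scaler_sumr.
split=> // _ /mapP[w /lw[mu ne ww] ->]; exists mu => //; exact: wv_Z.
Qed.

(** Induction on the number of other weight vectors: applying x - mu(x), where
    x separates mu from kappa, kills the component of weight mu and rescales
    the others. *)
Lemma wt_extract M (B : lieSubmodule M) (kappa : hdual h) (v a : M) :
  weight_vector kappa v -> off_weight kappa a -> sm_set B (v + a) -> sm_set B v.
Proof.
move=> + [l [-> lw]]; move: (leqnn (size l)); move: {2}(size l) => m.
elim: m l v lw => [|m IH] [|w l] v lw //= lm wv; rewrite ?big_nil ?addr0 //.
have [mu ne ww] := lw w (mem_head _ _).
have [x hx sep] := wt_sep ne.
move=> Bv; have := sm_B (sm_at x Bv) (sm_Z (wt_at mu x) Bv).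
rewrite !act_atD wv // big_cons act_atD ww // act_at_sum.
rewrite !scalerDr; set u := \sum_(i <- l) act_at x i; set s := \sum_(i <- l) i.
have -> : wt_at kappa x *: v + (wt_at mu x *: w + u) -
   (wt_at mu x *: v + (wt_at mu x *: w + wt_at mu x *: s)) =
   (wt_at kappa x - wt_at mu x) *: v + (u - wt_at mu x *: s).
  by rewrite opprD addrACA -scalerBl; congr (_ + _); rewrite opprD addrACA subrr add0r.
have -> : u - wt_at mu x *: s = \sum_(w <- map (fun w => act_at x w - wt_at mu x *: w) l) w.
  by rewrite big_map sumrB scaler_sumr.
move=> Bx; have kmu : wt_at kappa x - wt_at mu x != 0 by rewrite subr_eq0 eq_sym.
rewrite -[v](scalerK kmu); apply: sm_Z; apply: IH Bx; [|by rewrite size_map|exact: wv_Z].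
move=> _ /mapP[w' w'l ->]; have [|nu nuk ww'] := lw w'; first by rewrite inE w'l orbT.
exists nu => //; rewrite ww' // -scalerBl; exact: wv_Z.
Qed.

Lemma wt_component M (kappa : hdual h) : weight_module M -> forall v : M,
  exists v0 a, [/\ v = v0 + a, weight_vector kappa v0 & off_weight kappa a].
Proof.
move=> wM v; have [s [-> sw]] := wM v; elim: s sw {v} => [|w s IH] sw.
  exists 0, 0; rewrite big_nil addr0; split=> //; [exact: wv_0|exact: off_weight0].
have [v0 [a [E w0 oa]]] : exists v0 a, [/\ \sum_(w <- s) w = v0 + a, weight_vector kappa v0 & off_weight kappa a].
  by apply: IH => w' w's; apply: sw; rewrite inE w's orbT.
have [mu ww] := sw w (mem_head _ _); rewrite big_cons E.
have [mk|mk] := pselect (mu = kappa).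
  exists (w + v0), a; rewrite addrA; split=> //; apply: wv_D => //.
  by rewrite -mk.
exists v0, (w + a); rewrite addrCA; split=> //.
by apply: off_weightD => //; apply: off_weight1 ww.
Qed.

Definition zero_sub_set M : set M := [set v | v = 0]%classic.

Lemma zero_sub_lin M a (u v : M) : zero_sub_set u -> zero_sub_set v -> zero_sub_set (a *: u + v).
Proof. by rewrite /zero_sub_set /= => -> ->; rewrite scaler0 addr0. Qed.

Lemma zero_sub_act M x (v : M) : zero_sub_set v -> zero_sub_set (lm_act x v).
Proof. by rewrite /zero_sub_set /= => ->; rewrite lm_act0. Qed.

Definition zero_sub M : lieSubmodule M :=
  LieSubmodule (erefl (0 : M)) (@zero_sub_lin M) (@zero_sub_act M).

Definition full_sub M : lieSubmodule M :=
  @LieSubmodule _ _ _ M setT I (fun _ _ _ _ _ => I) (fun _ _ _ => I).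

End Weights.

(** * Dimensions of subspaces of modules *)

Section Dimension.
Variable K : fieldType.

Definition subspace_pred (V : lmodType K) (P : V -> Prop) :=
  P 0 /\ forall a u v, P u -> P v -> P (a *: u + v).

(** Weight spaces are given as predicates on modules of infinite dimension;
    they have dimension d when they are the image of an injective linear map
    from row vectors. *)
Definition has_dim (V : lmodType K) (P : V -> Prop) (d : nat) : Prop :=
  exists f : 'rV[K]_d -> V,
    [/\ forall a u v, f (a *: u + v) = a *: f u + f v, injective f &
        forall v, P v <-> exists u, v = f u].

(** Stated with functions satisfying linearity, because the maps come from a
    choice of preimages. *)
Lemma row_inj_le d d' (f : 'rV[K]_d -> 'rV[K]_d') :
  (forall a u v, f (a *: u + v) = a *: f u + f v) -> injective f ->
  (d <= d')%N /\ (d = d' -> forall y, exists x, y = f x).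
Proof.
move=> f_lin f_inj.
pose fl : {linear 'rV[K]_d -> 'rV[K]_d'} :=
  HB.pack f (GRing.isLinear.Build K _ _ _ f f_lin).
have ker0 : lker (linfun fl) = 0%VS.
  apply/eqP/lker0P => x y; rewrite !lfunE; exact: f_inj.
have := limg_dim_eq (f := linfun fl) (U := fullv); rewrite ker0 capv0 => /(_ erefl) dimE.
have := dimvS (subvf (limg (linfun fl))); rewrite dimE !dimvf /= /dim /= !mul1n => le.
split=> // dd' y.
have /eqP lE : limg (linfun fl) == fullv.
  by rewrite eqEdim subvf dimE !dimvf /dim /= dd'.
have := memvf y; rewrite -lE => /memv_imgP[x _ ->]; exists x.
by rewrite lfunE.
Qed.

Lemma has_dim_le (V : lmodType K) (P Q : V -> Prop) d e :
  has_dim P d -> has_dim Q e -> (forall v, P v -> Q v) ->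
  (d <= e)%N /\ (d = e -> forall v, Q v -> P v).
Proof.
move=> [f [f_lin f_inj fP]] [g [g_lin g_inj gQ]] PQ.
have /choice[k kE] (u : 'rV[K]_d) : exists w, f u = g w.
  by apply/gQ/PQ/fP; exists u.
have k_lin a u v : k (a *: u + v) = a *: k u + k v.
  by apply: g_inj; rewrite g_lin -!kE f_lin.
have k_inj : injective k by move=> u v kuv; apply: f_inj; rewrite !kE kuv.
have [le ontoP] := row_inj_le k_lin k_inj.
split=> // de v /gQ[w ->]; have [u ->] := ontoP de w.
by rewrite -kE; apply/fP; exists u.
Qed.

Lemma has_dim_uniq (V : lmodType K) (P : V -> Prop) d e :
  has_dim P d -> has_dim P e -> d = e.
Proof.
move=> Pd Pe; apply/eqP; rewrite eqn_leq.
by rewrite (has_dim_le Pd Pe _).1 // (has_dim_le Pe Pd _).1.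
Qed.

Lemma has_dim_ext (V : lmodType K) (P Q : V -> Prop) d :
  (forall v, P v <-> Q v) -> has_dim P d -> has_dim Q d.
Proof.
by move=> PQ [f [fl fi fP]]; exists f; split=> // v; rewrite -PQ.
Qed.

Lemma has_dim_inj (V W : lmodType K) (phi : V -> W) (P : V -> Prop) (Q : W -> Prop) d :
  (forall a u v, phi (a *: u + v) = a *: phi u + phi v) -> injective phi ->
  (forall w, Q w <-> exists2 v, P v & w = phi v) -> has_dim P d <-> has_dim Q d.
Proof.
move=> p_lin p_inj QP; split=> [] [f [f_lin f_inj fP]].
  exists (phi \o f); split=> [a u v|u v /p_inj/f_inj|w] //=.
    by rewrite f_lin p_lin.
  rewrite QP; split=> [[v /fP[u ->] ->]|[u ->]]; first by exists u.
  by exists (f u) => //; apply/fP; exists u.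
have /choice[k kE] (u : 'rV[K]_d) : exists v, P v /\ f u = phi v.
  have /QP[v Pv ->] : Q (f u) by apply/fP; exists u.
  by exists v.
exists k; split=> [a u v|u v kuv|v].
- by apply: p_inj; rewrite p_lin -!(kE _).2 f_lin.
- by apply: f_inj; rewrite !(kE _).2 kuv.
split=> [Pv|[u ->]]; last exact: (kE u).1.
have /fP[u E] : Q (phi v) by apply/QP; exists v.
by exists u; apply: p_inj; rewrite E (kE u).2.
Qed.

(** A subspace of greatest dimension inside the predicate is all of it, as any
    further vector could be adjoined. *)
Lemma vspace_of_pred d (P : 'rV[K]_d -> Prop) : subspace_pred P ->
  exists U : {vspace 'rV[K]_d}, forall u, P u <-> u \in U.
Proof.
move=> [P0 Plin].
pose good k := `[< exists U : {vspace 'rV[K]_d}, \dim U = k /\ forall u, u \in U -> P u >].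
have ex : exists k, good k.
  exists 0%N; apply/asboolP; exists 0%VS; rewrite dimv0; split=> // u.
  by rewrite memv0 => /eqP ->.
have ub k : good k -> (k <= \dim {: 'rV[K]_d})%N.
  by move=> /asboolP[U [<- _]]; apply: dimvS; apply: subvf.
case: (ex_maxnP ex ub) => k /asboolP[U [Uk UP]] kmax.
exists U => u; split=> [Pu|]; last exact: UP.
apply: contrapT => /negP uU.
have : (\dim (U + <[u]>)%VS <= k)%N.
  apply: kmax; apply/asboolP; exists (U + <[u]>)%VS; split=> // w.
  move=> /memv_addP[w1 w1U [_ /vlineP[a ->] ->]]; rewrite addrC.
  by apply: Plin => //; apply: UP.
rewrite dimv_disjoint_sum; last first.
  apply/eqP; rewrite -subv0; apply/subvP => w; rewrite memv_cap memv0 => /andP[wU].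
  move=> /vlineP[a wE]; rewrite wE scaler_eq0.
  have [//|a0] := eqVneq a 0; case/negP: uU.
  by rewrite -[u](scalerK a0) -wE rpredZ.
rewrite dim_vline Uk; case: eqP => [u0|_]; last by rewrite addn1 ltnn.
by move: uU; rewrite u0 mem0v.
Qed.

Lemma has_dim_vspace d (U : {vspace 'rV[K]_d}) : has_dim (fun u => u \in U) (\dim U).
Proof.
pose b := vbasis U; exists (fun x : 'rV[K]_(\dim U) => \sum_i x 0 i *: b`_i).
split=> [a x y|x y xy|v].
- rewrite scaler_sumr -big_split; apply: eq_bigr => i _ /=.
  by rewrite !mxE scalerDl scalerA.
- apply/rowP => i.
  have /freeP := basis_free (vbasisP U) => /(_ (fun i => x 0 i - y 0 i)) fr.
  apply/eqP; rewrite -subr_eq0; apply/eqP; apply: fr.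
  by under eq_bigr do rewrite scalerBl; rewrite sumrB xy subrr.
- split=> [vU|[x ->]].
    exists (\row_i coord b i v); rewrite {1}(coord_vbasis vU).
    by apply: eq_bigr => i _; rewrite mxE.
  apply: rpred_sum => i _; apply: rpredZ; apply: vbasis_mem.
  by rewrite mem_nth ?size_tuple.
Qed.

Lemma has_dim_sub (V : lmodType K) (P Q : V -> Prop) d :
  has_dim P d -> (forall v, Q v -> P v) -> subspace_pred Q -> exists e, has_dim Q e.
Proof.
move=> [f [f_lin f_inj fP]] QP [Q0 Ql].
have f0 : f 0 = 0.
  exact: (lin_at0 f_lin).
have [|U UE] := @vspace_of_pred d (fun u => Q (f u)).
  by split=> [|a u v Qu Qv]; rewrite ?f0 ?f_lin //; apply: Ql.
exists (\dim U); refine ((has_dim_inj (P := fun u => u \in U) _ f_lin f_inj _).1 (has_dim_vspace U)) => w.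
split=> [Qw|[u uU ->]]; last exact/UE.
by have /fP[u wE] := QP w Qw; exists u => //; apply/UE; rewrite -wE.
Qed.

(** The rank theorem: the image is parametrized by a complement of the
    kernel. *)
Lemma has_dim_image (V W : lmodType K) (g : V -> W) (P : V -> Prop) d :
  (forall a u v, g (a *: u + v) = a *: g u + g v) -> has_dim P d ->
  exists d0 d1, [/\ d = (d0 + d1)%N, has_dim (fun v => P v /\ g v = 0) d0 &
     has_dim (fun w => exists2 v, P v & w = g v) d1].
Proof.
move=> g_lin [f [f_lin f_inj fP]].
pose k u := g (f u).
have k_lin a u v : k (a *: u + v) = a *: k u + k v by rewrite /k f_lin g_lin.
have k0 : k 0 = 0.
  exact: (lin_at0 k_lin).
have [|U UE] := @vspace_of_pred d (fun u => k u = 0).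
  by split=> [|a u v ku kv]; rewrite ?k0 // k_lin ku kv scaler0 addr0.
exists (\dim U), (\dim U^C)%VS; split.
- have := dimv_disjoint_sum (capv_compl U); rewrite addv_complf => <-.
  by rewrite dimvf /dim /= mul1n.
- refine ((has_dim_inj (P := fun u => u \in U) _ f_lin f_inj _).1 (has_dim_vspace U)) => v.
  split=> [[/fP[u ->] gfu]|[u uU ->]]; first by exists u => //; apply/UE.
  by split; [apply/fP; exists u|exact/UE].
have [c [c_lin c_inj cP]] := has_dim_vspace (U^C)%VS.
exists (k \o c); split=> [a u v|u v kuv|w] /=.
- by rewrite c_lin k_lin.
- apply: c_inj; apply/eqP; rewrite -subr_eq0.
  have : c u - c v \in (U :&: U^C)%VS.
    have cU x : c x \in (U^C)%VS by apply/cP; exists x.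
    rewrite memv_cap (rpredB (cU u) (cU v)) andbT; apply/UE; rewrite addrC -scaleN1r k_lin scaleN1r.
    by rewrite [k (c u)]kuv addNr.
  by rewrite capv_compl memv0.
- split=> [[v /fP[u ->] ->]|[u ->]]; last by exists (f (c u)) => //; apply/fP; exists (c u).
  have : u \in (U + U^C)%VS by rewrite addv_complf memvf.
  move=> /memv_addP[u1 u1U [u2 /cP[x ->] ->]]; exists x.
  by rewrite -/(k _) -[u1]scale1r k_lin scale1r (_ : k u1 = 0) ?add0r //; apply/UE.
Qed.

Lemma has_dim_gt0 (V : lmodType K) (P : V -> Prop) d v :
  has_dim P d -> P v -> v <> 0 -> (0 < d)%N.
Proof.
case: d => // -[f [f_lin _ fP]] /fP[u ->] []; rewrite (thinmx0 u).
exact: (lin_at0 f_lin).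
Qed.

Lemma has_dim0 (V : lmodType K) (P : V -> Prop) d :
  has_dim P d -> (forall v, P v -> v = 0) -> d = 0%N.
Proof.
case: d => // d [f [f_lin f_inj fP]] P0.
have : f (delta_mx 0 0) = f 0.
  have z x : f x = 0 by apply: P0; apply/fP; exists x.
  by rewrite !z.
move/f_inj/matrixP/(_ 0 0); rewrite !mxE !eqxx => /eqP.
by rewrite oner_eq0.
Qed.

End Dimension.

(** * Simple highest weight modules *)

Section ProductModule.
Variables (K : fieldType) (n : nat) (g : linLie K n) (M N : lieModule g).

Let act (x : subvs_of g) (v : M * N) : M * N := (lm_act x v.1, lm_act x v.2).

Let actDl a x y v : act (a *: x + y) v = a *: act x v + act y v.
Proof. by rewrite /act !lm_actDl. Qed.

Let actDr x a u v : act x (a *: u + v) = a *: act x u + act x v.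
Proof. by rewrite /act /= !lm_actDr. Qed.

Let actB x y v : act (lie_br x y) v = act x (act y v) - act y (act x v).
Proof. by rewrite /act /= !lm_actB. Qed.

(** Isomorphisms between simple modules are obtained from their graphs, which
    live in this module. *)
Definition prod_module : lieModule g := LieModule actDl actDr actB.

End ProductModule.

(** The value at H0 tells how far a weight lies below the highest one: neg
    increases this distance and pos decreases it, by positive integers. *)
Record graded (K : fieldType) n (D : borelData K n) (r t : nat)
    (neg : r.-tuple 'M[K]_n) (pos : t.-tuple 'M[K]_n) (H0 : 'M[K]_n)
    (nrt : 'I_r -> hdual (bd_cartan D)) (prt : 'I_t -> hdual (bd_cartan D)) : Prop :=
  Graded {
    gr_span : (lie_space D <= <<neg>> + (bd_cartan D + bd_nil D))%VS;
    gr_neg : forall i : 'I_r, neg`_i \in lie_space D;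
    gr_pos : <<pos>>%VS = bd_nil D;
    gr_H0 : H0 \in bd_cartan D;
    gr_nrt : forall (i : 'I_r) x, x \in bd_cartan D -> lieb x neg`_i = wt_at (nrt i) x *: neg`_i;
    gr_prt : forall (i : 'I_t) x, x \in bd_cartan D -> lieb x pos`_i = wt_at (prt i) x *: pos`_i;
    gr_nht : forall i, exists k : nat, wt_at (nrt i) H0 = - k.+1%:R;
    gr_pht : forall i, exists k : nat, wt_at (prt i) H0 = k.+1%:R }.

Section HighestWeight.
Variables (K : fieldType) (n : nat) (D : borelData K n) (r t : nat).
Hypothesis char0 : forall k : nat, k.+1%:R != 0 :> K.
Variables (neg : r.-tuple 'M[K]_n) (pos : t.-tuple 'M[K]_n) (H0 : 'M[K]_n).
Variables (nrt : 'I_r -> hdual (bd_cartan D)) (prt : 'I_t -> hdual (bd_cartan D)).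
Hypothesis gr : graded neg pos H0 nrt prt.
Local Notation h := (bd_cartan D).
Implicit Type M : lieModule D.

Definition lower (mu nu : hdual h) := exists k : nat, wt_at nu H0 = wt_at mu H0 - k.+1%:R.

Lemma lower_neq mu nu : lower mu nu -> nu <> mu.
Proof.
move=> [k E] nm; move: E; rewrite nm => /eqP; rewrite -subr_eq0 opprB addrC subrK.
by rewrite (negPf (char0 k)).
Qed.

Lemma lower_trans mu nu xi : lower mu nu -> lower nu xi -> lower mu xi.
Proof.
move=> [k E] [k' E']; exists (k + k').+1.
by rewrite E' E -addrA -opprD -natrD addSn addnS.
Qed.

Definition low_vec M mu (w : M) := exists2 nu, lower mu nu & weight_vector nu w.

Lemma low_off M mu (a : M) : lspan (low_vec mu) a -> off_weight mu a.
Proof.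
elim=> [|c x y [nu lnu wx] _ IH]; first exact: off_weight0.
apply: off_weightD => //; apply: off_weightZ.
by apply: off_weight1 wx; apply: lower_neq.
Qed.

Lemma neg_weight M mu (i : 'I_r) (v : M) :
  weight_vector mu v -> weight_vector (mu + nrt i) (act_at neg`_i v).
Proof. by apply: wv_root; [apply: gr_neg gr i | apply: gr_nrt gr i]. Qed.

Lemma lower_neg mu i : lower mu (mu + nrt i).
Proof. by have [k E] := gr_nht gr i; exists k; rewrite wt_atD E. Qed.

Section Generated.
Variables (M : lieModule D) (P : lieSubmodule M) (mu : hdual h) (v : M).
Hypothesis wv : weight_vector mu v.
Hypothesis nv : forall e, e \in bd_nil D -> sm_set P (act_at e v).

(** The submodule generated by P and v. As v is singular modulo P, the
    operators of the negative root vectors suffice. *)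
Inductive lowered : M -> Prop :=
| lowered_base a : sm_set P a -> lowered a
| lowered_vec : lowered v
| lowered_lin c a b : lowered a -> lowered b -> lowered (c *: a + b)
| lowered_neg (i : 'I_r) a : lowered a -> lowered (act_at neg`_i a).

Lemma lowered0 : lowered 0.
Proof. by apply: lowered_base; apply: sm_0. Qed.

Lemma lowered_sum I (l : seq I) (c : I -> K) (F : I -> M) :
  (forall i, lowered (F i)) -> lowered (\sum_(i <- l) c i *: F i).
Proof.
move=> WF; elim: l => [|i l IH]; first by rewrite big_nil; apply: lowered0.
by rewrite big_cons; apply: lowered_lin.
Qed.

Lemma loweredD a b : lowered a -> lowered b -> lowered (a + b).
Proof. by move=> Wa Wb; rewrite -[a]scale1r; apply: lowered_lin. Qed.

(** The bracket of y with a negative root vector is again in the Lie algebra,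
    so y can be moved past the lowering operators until it meets v. *)
Lemma lowered_act a : lowered a -> forall y, y \in lie_space D -> lowered (act_at y a).
Proof.
elim=> [b Pb|  |c b1 b2 _ IH1 _ IH2|i b Wb IH] y yD.
- by apply: lowered_base; apply: sm_at.
- have /memv_addP[y1 y1n [_ /memv_addP[x hx [e ne ->]] ->]] := subvP (gr_span gr) _ yD.
  have -> : act_at (y1 + (x + e)) v = act_at y1 v + (act_at x v + act_at e v).
    by rewrite /act_at !linearD !lm_act_addl.
  apply: loweredD.
    rewrite (coord_span y1n) act_at_suml.
    under eq_bigr do rewrite act_atZl.
    by apply: lowered_sum => i; do 2!constructor.
  rewrite wv //; apply: lowered_lin; first exact: lowered_vec.
  by apply: lowered_base; apply: nv.
- by rewrite act_at_lin; apply: lowered_lin; auto.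
rewrite (act_at_br _ yD (gr_neg gr i)); apply: loweredD.
  by apply: lowered_neg; apply: IH.
by apply: IH; apply: lie_closed => //; apply: gr_neg gr i.
Qed.

Lemma lowered_lm_act x a : lowered a -> lowered (lm_act x a).
Proof. by move=> Wa; rewrite lm_act_at; apply: lowered_act => //; apply: subvsP. Qed.

Definition lowered_sub : lieSubmodule M :=
  LieSubmodule lowered0 lowered_lin lowered_lm_act.

(** Lowering operators strictly lower weights, so modulo P the weight of v is
    only reached by the multiples of v. *)
Lemma lowered_shape a : lowered a ->
  exists p c b, [/\ a = p + c *: v + b, sm_set P p & lspan (low_vec mu) b].
Proof.
elim=> {a}[a Pa||c a1 a2 _ [p1 [c1 [b1 [-> Pp1 l1]]]] _ [p2 [c2 [b2 [-> Pp2 l2]]]]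
          |i a _ [p [c [b [-> Pp lb]]]]].
- by exists a, 0, 0; rewrite scale0r !addr0; split=> //; constructor.
- exists 0, 1, 0; rewrite scale1r add0r addr0; split=> //; [exact: sm_0|constructor].
- exists (c *: p1 + p2), (c * c1 + c2), (c *: b1 + b2); split.
  + rewrite !scalerDr scalerDl -scalerA [LHS]addrACA; congr (_ + _).
    by rewrite addrACA.
  + exact: sm_lin.
  + exact: lspan_lin.
exists (act_at neg`_i p), 0, (c *: act_at neg`_i v + act_at neg`_i b); split.
- by rewrite scale0r addr0 !act_atD act_atZ addrA.
- exact: sm_at.
apply: lspan_cons; first by exists (mu + nrt i); [apply: lower_neg|apply: neg_weight].
apply: (lspan_image (f := act_at neg`_i)) lb => [c' a' b'|w [nu lnu ww]].
  exact: act_at_lin.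
apply: lspan_gen; exists (nu + nrt i); last exact: neg_weight.
by apply: lower_trans lnu _; apply: lower_neg.
Qed.

Lemma lowered_top z : lowered z -> weight_vector mu z -> exists c, sm_set P (z - c *: v).
Proof.
move=> /lowered_shape[p [c [b [zE Pp lb]]]] wz; exists c.
apply: (wt_extract (kappa := mu) (a := - b)).
- by apply: wv_B => //; apply: wv_Z.
- by rewrite -scaleN1r; apply: off_weightZ; apply: low_off.
- by rewrite zE addrAC addrK addrK.
Qed.

Lemma lowered_weight nu z : lowered z -> weight_vector nu z ->
  nu <> mu -> ~ lower mu nu -> sm_set P z.
Proof.
move=> /lowered_shape[p [c [b [zE Pp lb]]]] wz numu nlow.
apply: (wt_extract (kappa := nu) (a := - (c *: v + b))) => //; last first.
  by rewrite zE -[p + _ + b]addrA addrK.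
rewrite -scaleN1r; apply: off_weightZ; apply: off_weightD.
  by apply: (off_weight1 (mu := mu)) => [/esym //|]; apply: wv_Z.
elim: lb {zE} => [|c' x y [xi lxi wx] _ IH]; first exact: off_weight0.
apply: off_weightD => //; apply: off_weightZ; apply: off_weight1 wx => xinu.
by apply: nlow; rewrite -xinu.
Qed.

End Generated.

Definition simple_hw (L : lieModule D) (nu : hdual h) (v : L) : Prop :=
  [/\ simple_module L, v != 0, weight_vector nu v &
      forall e, e \in bd_nil D -> act_at e v = 0].

Lemma simple_full (L : lieModule D) (N : lieSubmodule L) v :
  simple_module L -> sm_set N v -> v != 0 -> forall u, sm_set N u.
Proof.
move=> [_ /(_ N) []] E Nv v0 u; last by rewrite E.
by move: Nv; rewrite E /= => v0'; rewrite v0' eqxx in v0.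
Qed.

Lemma simple_lowered (L : lieModule D) nu (v : L) : simple_hw nu v ->
  forall u, lowered (zero_sub L) v u.
Proof.
move=> [sL v0 wv nv] u.
have nv' e : e \in bd_nil D -> sm_set (zero_sub L) (act_at e v) by move/nv.
exact: (simple_full (N := lowered_sub wv nv') sL (lowered_vec _ _) v0).
Qed.

Lemma simple_hw_weight (L : lieModule D) nu mu (v z : L) : simple_hw nu v ->
  weight_vector mu z -> mu <> nu -> ~ lower nu mu -> z = 0.
Proof.
move=> sv wz ne nl; have [_ _ wv nv] := sv.
exact: (lowered_weight wv (simple_lowered sv z) wz ne nl).
Qed.

(** The submodule W of the product generated by the pair of highest weight
    vectors is the graph of a homomorphism. It projects onto L, which is
    simple. If it met the second factor, it would contain that whole factor,
    hence a vector (0, v') of weight nu; but the vectors of W of this weight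
    are multiples of (v, v'). *)
Lemma simple_hw_hom (L L' : lieModule D) nu (v : L) (v' : L') :
  simple_hw nu v -> simple_hw nu v' ->
  exists f : L -> L', [/\ forall a x y, f (a *: x + y) = a *: f x + f y,
     forall x u, f (lm_act x u) = lm_act x (f u) & f v = v'].
Proof.
move=> [sL v0 wv nv] [sL' v0' wv' nv'].
pose M := prod_module L L'; pose w : M := (v, v').
have ww : weight_vector nu w.
  move=> x hx; rewrite /act_at /= -/(act_at x v) -/(act_at x v') wv // wv' //.
have nw e : e \in bd_nil D -> sm_set (zero_sub M) (act_at e w).
  by move=> ne; rewrite /= /zero_sub_set /= /act_at /= -/(act_at e v) -/(act_at e v') nv // nv'.
pose W := lowered_sub ww nw.
have Ww : sm_set W w by apply: lowered_vec.
have W_total : forall u, exists u', sm_set W (u, u').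
  pose p1 := [set u : L | exists u', sm_set W (u, u')]%classic.
  have p10 : p1 0 by exists 0; apply: (sm_0 W).
  have p1l a x y : p1 x -> p1 y -> p1 (a *: x + y).
    by move=> [x' Wx] [y' Wy]; exists (a *: x' + y'); apply: (sm_lin a Wx Wy).
  have p1a x u : p1 u -> p1 (lm_act x u).
    by move=> [u' Wu]; exists (lm_act x u'); apply: (sm_act x Wu).
  have p1v : p1 v by exists v'.
  move=> u; exact: (simple_full (N := LieSubmodule p10 p1l p1a) sL p1v v0 u).
have W_fun u1 u2 u : sm_set W (u, u1) -> sm_set W (u, u2) -> u1 = u2.
  move=> W1 W2; apply: contrapT => /eqP ne.
  pose k := [set u : L' | sm_set W (0, u)]%classic.
  have k0 : k 0 by apply: (sm_0 W).
  have kl a x y : k x -> k y -> k (a *: x + y).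
    by move=> Wx Wy; have := sm_lin a Wx Wy; rewrite /k /= (_ : _ + _ = (0, a *: x + y)) //; congr (_, _); rewrite /= scaler0 addr0.
  have ka x y : k y -> k (lm_act x y).
    by move=> /(sm_act x) /=; rewrite lm_act0.
  have Wd : k (u1 - u2).
    by have := sm_B W1 W2; rewrite /k /= (_ : _ - _ = (0, u1 - u2)) //; congr (_, _); rewrite /= subrr.
  have Wv' : sm_set W (0, v').
    have d0 : u1 - u2 != 0 by rewrite subr_eq0.
    exact: (simple_full (N := LieSubmodule k0 kl ka) sL' Wd d0 v').
  have w0 : weight_vector nu ((0, v') : M).
    by move=> x hx; rewrite /act_at /= lm_act0 -/(act_at x v') wv' // -[in LHS](scaler0 _ (wt_at nu x)).
  have [c] := lowered_top ww Wv' w0.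
  rewrite /= /zero_sub_set /= => /eqP; rewrite subr_eq0 => /eqP [/esym/eqP].
  rewrite scaler_eq0 (negPf v0) orbF => /eqP -> /eqP.
  by rewrite scale0r (negPf v0').
have /choice[f fW] := W_total.
exists f; split=> [a x y|x u|].
- apply: W_fun (fW _) _; exact: (sm_lin a (fW x) (fW y)).
- apply: W_fun (fW _) _; exact: (sm_act x (fW u)).
- exact: W_fun (fW _) Ww.
Qed.

(** The homomorphisms in both directions are inverse to each other, since the
    set of vectors fixed by a composite is a submodule containing the highest
    weight vector. *)
Lemma simple_hw_iso (L L' : lieModule D) nu (v : L) (v' : L') :
  simple_hw nu v -> simple_hw nu v' -> lm_iso L L'.
Proof.
move=> sv sv'; have [f [f_lin fa fv]] := simple_hw_hom sv sv'.
have [f' [f'_lin f'a f'v]] := simple_hw_hom sv' sv.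
have cancelP (A B : lieModule D) (va : A) (g : A -> B) (g' : B -> A) : simple_module A -> va != 0 ->
    (forall a x y, g (a *: x + y) = a *: g x + g y) ->
    (forall a x y, g' (a *: x + y) = a *: g' x + g' y) ->
    (forall x u, g (lm_act x u) = lm_act x (g u)) ->
    (forall x u, g' (lm_act x u) = lm_act x (g' u)) ->
    g' (g va) = va -> cancel g g'.
  move=> sA va0 gl g'l ga g'a gva.
  pose s := [set u : A | g' (g u) = u]%classic.
  have g0 : g 0 = 0.
    exact: (lin_at0 gl).
  have g'0 : g' 0 = 0.
    exact: (lin_at0 g'l).
  have s0 : s 0 by rewrite /s /= g0 g'0.
  have sl a x y : s x -> s y -> s (a *: x + y) by rewrite /s /= gl g'l => -> ->.
  have sa x u : s u -> s (lm_act x u) by rewrite /s /= ga g'a => ->.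
  exact: (simple_full (N := LieSubmodule s0 sl sa) sA gva va0).
pose fl : {linear L -> L'} := HB.pack f (GRing.isLinear.Build K _ _ _ f f_lin).
exists fl; split; last exact: fa.
have [[sL v0 _ _] [sL' v0' _ _]] := (sv, sv').
exists f'; [apply: (cancelP L L' v)|apply: (cancelP L' L v')] => //.
  exact: etrans (congr1 f' fv) f'v.
exact: etrans (congr1 f f'v) fv.
Qed.

End HighestWeight.

(** * Subquotients of weight modules *)

Section SubQuotients.
Variables (K : fieldType) (n : nat) (D : borelData K n).
Local Notation h := (bd_cartan D).
Implicit Type M : lieModule D.

Lemma sm_valE M (Q : lieSubmodule M) (u : submod Q) : sm_set Q (sm_val u).
Proof. exact/asboolP/(sm_valP u). Qed.

Definition sm_elt M (Q : lieSubmodule M) (u : M) (Qu : sm_set Q u) : submod Q :=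
  SmElt (introT (asboolP _) Qu : u \in sm_pred Q).

Lemma sm_val_inj M (Q : lieSubmodule M) : injective (fun u : submod Q => sm_val u : M).
Proof. by move=> u v uv; apply: val_inj. Qed.

Lemma sm_wv M (Q : lieSubmodule M) mu (u : submod Q) :
  weight_vector mu u <-> weight_vector mu (sm_val u).
Proof.
split=> wu x hx; first by have := congr1 (fun y : submod Q => sm_val y) (wu x hx).
by apply: sm_val_inj; apply: wu.
Qed.

Lemma qm_act_at M (N : lieSubmodule M) x (v : M) :
  act_at (M := quotmod N) x (qm_pi N v) = qm_pi N (act_at x v).
Proof. exact: quot_act. Qed.

Lemma qm_wv M (N : lieSubmodule M) mu (u : M) :
  weight_vector mu u -> weight_vector (M := quotmod N) mu (qm_pi N u).
Proof. by move=> wu x hx; rewrite qm_act_at wu // qm_piZ. Qed.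

Lemma qm_pi_eq0 M (N : lieSubmodule M) (u : M) :
  qm_pi N u = 0 <-> sm_set N u.
Proof.
have qm0 : qm_pi N 0 = 0 by have := qm_piB N 0 0; rewrite subrr => ->; rewrite subrr.
split=> [|Nu]; first by rewrite -qm0 => /qm_piP; rewrite subr0 => /asboolP.
by rewrite -qm0; apply/qm_piP; rewrite subr0; apply/asboolP.
Qed.

Lemma qm_pi_lin M (N : lieSubmodule M) a (u v : M) :
  qm_pi N (a *: u + v) = a *: qm_pi N u + qm_pi N v.
Proof. by rewrite qm_piD qm_piZ. Qed.

Lemma qm_off M (N : lieSubmodule M) mu (u : M) :
  off_weight mu u -> off_weight (M := quotmod N) mu (qm_pi N u).
Proof.
move=> [l [-> lw]]; elim: l lw => [|w l IH] lw.
  by rewrite big_nil (_ : qm_pi N 0 = 0); [exact: off_weight0|apply/qm_pi_eq0; exact: sm_0].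
rewrite big_cons qm_piD; apply: off_weightD.
  have [nu ne ww] := lw w (mem_head _ _); apply: off_weight1 ne _; exact: qm_wv.
by apply: IH => w' w'l; apply: lw; rewrite inE w'l orbT.
Qed.

(** The components of an element of a submodule lie in the submodule by
    [wt_extract]; they are split off one weight at a time. *)
Lemma sub_weight_decomp M (Q : lieSubmodule M) (l : seq M) :
  (forall w, w \in l -> exists mu : hdual h, weight_vector mu w) ->
  sm_set Q (\sum_(w <- l) w) ->
  exists l' : seq (submod Q), \sum_(w <- l) w = sm_val (\sum_(w <- l') w) /\
    forall w, w \in l' -> exists mu : hdual h, weight_vector mu w.
Proof.
move: (leqnn (size l)); move: {2}(size l) => m.
elim: m l => [|m IH] [|w l] //= sz lw Ql.
- by exists [::]; rewrite !big_nil.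
- by exists [::]; rewrite !big_nil.
have [mu ww] := lw w (mem_head _ _).
pose p (x : M) := `[< weight_vector mu x >].
have E : \sum_(x <- w :: l) x = (w + \sum_(x <- l | p x) x) + \sum_(x <- filter (predC p) l) x.
  by rewrite big_cons (bigID p) /= big_filter addrA.
have w0 : weight_vector mu (w + \sum_(x <- l | p x) x).
  apply: wv_D => //; elim: (l) => [|x s IHs]; first by rewrite big_nil; apply: wv_0.
  by rewrite big_cons; case: ifP => // /asboolP wx; apply: wv_D.
have off : off_weight mu (\sum_(x <- filter (predC p) l) x).
  exists (filter (predC p) l); split=> // x; rewrite mem_filter /= => /andP[npx xl].
  have [|nu wx] := lw x; first by rewrite inE xl orbT.
  by exists nu => // nm; case/asboolP: npx; rewrite -nm.
have Q0 : sm_set Q (w + \sum_(x <- l | p x) x).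
  by apply: (wt_extract w0 off); rewrite -E.
have [|x||l' [l'E l'w]] := IH (filter (predC p) l).
- by rewrite size_filter; apply: leq_trans (count_size _ _) sz.
- by rewrite mem_filter => /andP[_ xl]; apply: lw; rewrite inE xl orbT.
- by apply: sm_addl Q0 _; rewrite -E.
exists (sm_elt Q0 :: l'); split.
  rewrite E l'E big_cons; have := sm_val_lin 1 (sm_elt Q0) (\sum_(j <- l') j).
  by rewrite !scale1r.
move=> x; rewrite inE => /predU1P[->|/l'w //].
by exists mu; apply/sm_wv.
Qed.

Lemma weight_submod M (Q : lieSubmodule M) : weight_module M -> weight_module (submod Q).
Proof.
move=> wM v; have [s [vE sw]] := wM (sm_val v).
have [|l' [E l'w]] := sub_weight_decomp (Q := Q) sw; first by rewrite -vE; apply: sm_valE.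
by exists l'; split=> //; apply: sm_val_inj; rewrite -E vE.
Qed.

Definition wt_in M (Q : lieSubmodule M) (mu : hdual h) : M -> Prop :=
  fun v => sm_set Q v /\ weight_vector mu v.

Lemma wt_in_subspace M (Q : lieSubmodule M) mu : subspace_pred (wt_in Q mu).
Proof.
split=> [|a u v [Qu wu] [Qv wv]]; first by split; [apply: sm_0|apply: wv_0].
by split; [apply: sm_lin|apply: wv_lin].
Qed.

(** The component of weight mu of any representative represents the same
    class. *)
Lemma factor_wv_lift M (P Q : lieSubmodule M) mu (w : quotmod (sm_inside Q P)) :
  weight_module M -> weight_vector mu w ->
  exists2 u : submod Q, weight_vector mu u & w = qm_pi (sm_inside Q P) u.
Proof.
move=> wM ww.
have [u0 [a [uE wu0 oa]]] := wt_component mu (weight_submod (Q := Q) wM) (qm_repr w).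
exists u0 => //; apply/eqP; rewrite -subr_eq0; apply/eqP.
apply: (wt_extract (M := quotmod (sm_inside Q P)) (B := zero_sub _) (kappa := mu)
  (a := - qm_pi (sm_inside Q P) a)).
- by apply: wv_B => //; apply: qm_wv.
- by rewrite -scaleN1r; apply: off_weightZ; apply: qm_off.
by rewrite /= /zero_sub_set /= -{1}[w]qm_reprK uE qm_piD -addrA -opprD subrr.
Qed.

(** The projection from Q to Q / P maps weight spaces onto weight spaces, with
    kernel the weight space of P. *)
Lemma factor_dim M (P Q : lieSubmodule M) mu e : weight_module M ->
  (P `<=` Q)%classic -> has_dim (wt_in Q mu) e ->
  exists d0 d1, [/\ e = (d0 + d1)%N, has_dim (wt_in P mu) d0 &
    has_dim (fun v : quotmod (sm_inside Q P) => weight_vector mu v) d1].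
Proof.
move=> wM PQ Qe.
have val_lin a (u v : submod Q) : sm_val (a *: u + v) = a *: sm_val u + sm_val v.
  exact: sm_val_lin.
have Qe' : has_dim (fun u : submod Q => weight_vector mu u) e.
  apply: (has_dim_inj _ val_lin (@sm_val_inj M Q) _).2 Qe => w.
  split=> [[Qw ww]|[u wu ->]]; first by exists (sm_elt Qw) => //; apply/sm_wv.
  by split; [apply: sm_valE|apply/sm_wv].
have [d0 [d1 [eE k0 k1]]] := has_dim_image (@qm_pi_lin _ (sm_inside Q P)) Qe'.
exists d0, d1; split=> //.
  apply: (has_dim_inj _ val_lin (@sm_val_inj M Q) _).1 k0 => w.
  split=> [[Pw ww]|[u [wu /qm_pi_eq0 Pu] ->]]; last by split=> //; apply/sm_wv.
  exists (sm_elt (PQ _ Pw)) => //; split; first exact/sm_wv.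
  exact/qm_pi_eq0.
apply: has_dim_ext k1 => w; split=> [[u wu ->]|ww]; first exact: qm_wv.
by have [u wu ->] := factor_wv_lift wM ww; exists u.
Qed.

Section SumSubmodule.
Variables (M : lieModule D) (B1 B2 : lieSubmodule M).

Let s : set M := [set v | exists v1 v2, [/\ sm_set B1 v1, sm_set B2 v2 & v = v1 + v2]]%classic.
Let s0 : s 0. Proof. by exists 0, 0; rewrite addr0; split=> //; apply: sm_0. Qed.
Let sl a u v : s u -> s v -> s (a *: u + v).
Proof.
move=> [u1 [u2 [U1 U2 ->]]] [v1 [v2 [V1 V2 ->]]].
exists (a *: u1 + v1), (a *: u2 + v2); split; [exact: sm_lin|exact: sm_lin|].
by rewrite scalerDr addrACA.
Qed.
Let sa x v : s v -> s (lm_act x v).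
Proof.
move=> [v1 [v2 [V1 V2 ->]]]; exists (lm_act x v1), (lm_act x v2).
by split; [exact: sm_act|exact: sm_act|rewrite lm_actD].
Qed.

Definition sum_sub : lieSubmodule M := LieSubmodule s0 sl sa.

Lemma sum_sub_weight mu z : weight_module M -> sm_set sum_sub z -> weight_vector mu z ->
  exists z1 z2, [/\ wt_in B1 mu z1, wt_in B2 mu z2 & z = z1 + z2].
Proof.
move=> wM [v1 [v2 [V1 V2 zE]]] wz.
have [z1 [a1 [v1E wz1 o1]]] := wt_component mu wM v1.
have [z2 [a2 [v2E wz2 o2]]] := wt_component mu wM v2.
exists z1, z2; split.
- by split=> //; apply: (wt_extract wz1 o1); rewrite -v1E.
- by split=> //; apply: (wt_extract wz2 o2); rewrite -v2E.
apply/eqP; rewrite -subr_eq0; apply/eqP.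
apply: (wt_extract (B := zero_sub _) (kappa := mu) (a := - (a1 + a2))).
- by apply: wv_B => //; apply: wv_D.
- by rewrite -scaleN1r; apply: off_weightZ; apply: off_weightD.
rewrite /= /zero_sub_set /= zE v1E v2E addrACA.
by set p := z1 + z2; set q := a1 + a2; rewrite -addrA -opprD subrr.
Qed.

End SumSubmodule.

Section SimpleStep.
Hypothesis char0 : forall k : nat, k.+1%:R != 0 :> K.
Variables (r t : nat) (neg : r.-tuple 'M[K]_n) (pos : t.-tuple 'M[K]_n) (H0 : 'M[K]_n).
Variables (nrt : 'I_r -> hdual (bd_cartan D)) (prt : 'I_t -> hdual (bd_cartan D)).
Hypothesis gr : graded neg pos H0 nrt prt.
Variables (M : lieModule D) (P : lieSubmodule M) (mu : hdual h) (v : M).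
Hypothesis wM : weight_module M.
Hypothesis wv : weight_vector mu v.
Hypothesis nv : forall e, e \in bd_nil D -> sm_set P (act_at e v).
Hypothesis Pv : ~ sm_set P v.

Let U := lowered_sub gr wv nv.

Let m : set M := [set u | exists B : lieSubmodule M,
  [/\ (P `<=` B)%classic, (B `<=` U)%classic, sm_set B u &
      forall z, sm_set B z -> weight_vector mu z -> sm_set P z]]%classic.

Let PU : (P `<=` U)%classic. Proof. by move=> u Pu; apply: lowered_base. Qed.

Let m0 : m 0.
Proof. by exists P; split=> //; apply: sm_0. Qed.

Let ml a u w : m u -> m w -> m (a *: u + w).
Proof.
move=> [B1 [P1 U1 u1 h1]] [B2 [P2 U2 w2 h2]]; exists (sum_sub B1 B2); split.
- by move=> x Px; exists x, 0; rewrite addr0; split=> //; [apply: P1|apply: sm_0].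
- by move=> _ [x [y [X Y ->]]]; apply: sm_D; [apply: U1|apply: U2].
- by exists (a *: u), w; split=> //; apply: sm_Z.
move=> z Bz wz; have [z1 [z2 [[B1z wz1] [B2z wz2] ->]]] := sum_sub_weight wM Bz wz.
by apply: sm_D; [apply: h1|apply: h2].
Qed.

Let ma x u : m u -> m (lm_act x u).
Proof. by move=> [B [PB BU Bu hB]]; exists B; split=> //; apply: sm_act. Qed.

Let U' : lieSubmodule M := LieSubmodule m0 ml ma.

Let PU' : (P `<=` U')%classic.
Proof. by move=> u Pu; exists P; split. Qed.

Let U'U : (U' `<=` U)%classic.
Proof. by move=> u [B [_ BU Bu _]]; apply: BU. Qed.

Let U'v : ~ sm_set U' v.
Proof. by move=> [B [_ _ Bv hB]]; apply: Pv; apply: hB. Qed.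

(** The submodule U is generated by P and v, and U' is the sum of all
    submodules between P and U that have no vector of weight mu outside P; it
    does not contain v. A submodule of U containing U' either has such a
    vector, which modulo P is a multiple of v and so generates U, or is
    contained in U' by definition. *)
Lemma simple_step : exists (U U' : lieSubmodule M),
  [/\ (P `<=` U')%classic, (U' `<=` U)%classic, sm_set U v, ~ sm_set U' v &
    (forall Q : lieSubmodule M, (P `<=` Q)%classic -> sm_set Q v -> (U `<=` Q)%classic) /\
    exists w : quotmod (sm_inside U U'), simple_hw mu w].
Proof.
have Uv : sm_set U v by apply: lowered_vec.
exists U, U'; split=> //; split=> [Q PQ Qv u|].
  elim=> {u}[a /PQ //|//|c a b _ Qa _ Qb|i a _ Qa]; first exact: sm_lin.
  exact: sm_at.
pose F := quotmod (sm_inside U U').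
pose w : F := qm_pi (sm_inside U U') (sm_elt Uv).
have w0 : w != 0 by apply/eqP => /qm_pi_eq0.
exists w; split=> //; last first.
- move=> e ne; rewrite /w qm_act_at; apply/qm_pi_eq0; apply: PU'.
  exact: nv.
- by apply: qm_wv; apply/sm_wv.
split=> [|N]; first by exists w.
(* The inverse image of N in M. *)
pose B := [set u : M | exists2 Uu : sm_set U u, True & sm_set N (qm_pi (sm_inside U U') (sm_elt Uu))]%classic.
pose bp (u : submod U) : Prop := sm_set N (qm_pi (sm_inside U U') u).
have bpP u (Uu : sm_set U u) : B u -> bp (sm_elt Uu).
  by move=> [Uu' _]; rewrite (_ : sm_elt Uu' = sm_elt Uu) //; apply: val_inj.
have B0 : B 0.
  exists (sm_0 U) => //; rewrite (_ : sm_elt _ = 0); last exact: val_inj.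
  by rewrite (qm_pi_eq0 _ _).2; apply: sm_0.
have Bl a x y : B x -> B y -> B (a *: x + y).
  move=> [Ux _ Nx] [Uy _ Ny]; exists (sm_lin a Ux Uy) => //.
  rewrite (_ : sm_elt _ = a *: sm_elt Ux + sm_elt Uy); last by apply: val_inj; apply/esym; exact: sm_val_lin.
  by rewrite qm_pi_lin; apply: sm_lin.
have Ba x u : B u -> B (lm_act x u).
  move=> [Uu _ Nu]; exists (sm_act x Uu) => //.
  rewrite (_ : sm_elt _ = lm_act x (sm_elt Uu)); last exact: val_inj.
  by rewrite -quot_act; apply: sm_act.
pose Bs : lieSubmodule M := LieSubmodule B0 Bl Ba.
have U'B u : sm_set U' u -> B u.
  move=> U'u; exists (U'U U'u) => //.
  by rewrite (qm_pi_eq0 _ _).2 //; apply: sm_0.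
have [[z [Bz wz nPz]]|noz] := pselect (exists z, [/\ B z, weight_vector mu z & ~ sm_set P z]).
  right; have [Uz _ _] := Bz.
  have [c Pzc] := lowered_top char0 gr wv Uz wz.
  have c0 : c != 0 by apply/eqP => c0; apply: nPz; move: Pzc; rewrite c0 scale0r subr0.
  have Bv : sm_set Bs v.
    rewrite -[v](scalerK c0); apply: sm_Z; rewrite -[_ *: v](subKr z); apply: sm_B => //.
    by apply: U'B; apply: PU'.
  have BU u : sm_set U u -> sm_set Bs u.
    elim=> {u}[a Pa|//|a x y _ Bx _ By|i x _ Bx]; [exact/U'B/PU'|exact: sm_lin|exact: sm_at].
  apply/seteqP; split=> // q _; rewrite -[q](@qm_reprK _ _ _ _ (sm_inside U U')).
  have := bpP _ (sm_valE (qm_repr q)) (BU _ (sm_valE (qm_repr q))).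
  by rewrite /bp (_ : sm_elt _ = qm_repr q) //; apply: val_inj.
left; apply/seteqP; split=> q /=; last by move=> ->; apply: sm_0.
move=> Nq; rewrite -[q](@qm_reprK _ _ _ _ (sm_inside U U')); apply/qm_pi_eq0.
exists Bs; split=> //.
- by move=> u Pu; apply: U'B; apply: PU'.
- by move=> u [].
- exists (sm_valE (qm_repr q)) => //; rewrite (_ : sm_elt _ = qm_repr q); last exact: val_inj.
  by rewrite qm_reprK.
move=> z Bz wz; apply: contrapT => nPz; apply: noz; by exists z.
Qed.

End SimpleStep.
End SubQuotients.

(** * Multiplicities are determined by weight space dimensions *)

(** Characters of simple modules are unitriangular for the order of highest
    weights, so a multiset of simple modules is determined by the sum of their
    characters: a highest weight of least depth occurring in either list
    occurs in both, and can be removed from both. *)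
Lemma unitriangular_perm (T : eqType) (dep : T -> nat) (ell : T -> T -> nat)
    (l1 l2 : seq T) :
  {in l1 ++ l2, forall k, 0 < ell k k}%N ->
  {in l1 ++ l2 &, forall k m, 0 < ell k m -> m = k \/ dep k < dep m}%N ->
  {in l1 ++ l2, forall m, \sum_(k <- l1) ell k m = \sum_(k <- l2) ell k m}%N ->
  perm_eq l1 l2.
Proof.
move: (leqnn (size l1 + size l2)); move: {2}(_ + _)%N => N.
elim: N l1 l2 => [|N IH] l1 l2 sz diag tri eqs.
  by move: sz; rewrite leqn0 addn_eq0 => /andP[/nilP -> /nilP ->].
have [l0|[k0 k0l]] : l1 ++ l2 = [::] \/ exists k, k \in l1 ++ l2.
- by case: (l1 ++ l2) => [|k s]; [left|right; exists k; rewrite mem_head].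
- by case: l1 l0 {sz diag tri eqs} => //= ->.
have [k kl kmin] : exists2 k, k \in l1 ++ l2 & {in l1 ++ l2, forall m, dep k <= dep m}%N.
  have ex : exists d, has (fun k => dep k == d) (l1 ++ l2).
    by exists (dep k0); apply/hasP; exists k0.
  case: (ex_minnP ex) => d /hasP[k kl /eqP kd] dmin; exists k => // m ml.
  by rewrite kd; apply: dmin; apply/hasP; exists m.
have sub l : {subset l <= l1 ++ l2} -> (0 < \sum_(m <- l) ell m k)%N -> k \in l.
  move=> ll; rewrite lt0n sum_nat_seq_neq0 => /hasP[m ml /=].
  rewrite -lt0n => /(tri _ _ (ll _ ml) kl)[-> //|].
  by rewrite ltnNge kmin // ll.
have big l : k \in l -> (0 < \sum_(m <- l) ell m k)%N.
  move=> lk; rewrite lt0n sum_nat_seq_neq0; apply/hasP; exists k => //=.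
  by rewrite -lt0n diag.
have s1 : {subset l1 <= l1 ++ l2} by move=> m ml; rewrite mem_cat ml.
have s2 : {subset l2 <= l1 ++ l2} by move=> m ml; rewrite mem_cat ml orbT.
have [k1 k2] : k \in l1 /\ k \in l2.
  move: kl; rewrite mem_cat => /orP[k1|k2].
    by split=> //; apply: sub s2 _; rewrite -eqs ?mem_cat ?k1 //; apply: big.
  by split=> //; apply: sub s1 _; rewrite eqs ?mem_cat ?k2 ?orbT //; apply: big.
have p1 := perm_to_rem k1; have p2 := perm_to_rem k2.
rewrite (perm_trans p1) // perm_sym (perm_trans p2) // perm_cons perm_sym.
have rs : {subset rem k l1 ++ rem k l2 <= l1 ++ l2}.
  by move=> m; rewrite !mem_cat => /orP[/mem_rem->|/mem_rem->]; rewrite ?orbT.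
apply: IH.
- move: sz; rewrite (perm_size p1) (perm_size p2) /= addSn addnS ltnS.
  exact: leq_trans (leqnSn _).
- by move=> m /rs; apply: diag.
- by move=> m m' /rs ml /rs m'l; apply: tri.
- move=> m /rs ml; have := eqs m ml.
  by rewrite (perm_big _ p1) (perm_big _ p2) /= !big_cons => /addnI.
Qed.

Lemma sum_lt_seq (T : eqType) (s : seq T) (f g : T -> nat) k : k \in s ->
  {in s, forall m, f m <= g m}%N -> (f k < g k)%N ->
  (\sum_(m <- s) f m < \sum_(m <- s) g m)%N.
Proof.
move=> ks fg lt; rewrite !(perm_big _ (perm_to_rem ks)) /= !big_cons -addSn.
apply: leq_add => //; rewrite big_seq [leqRHS]big_seq; apply: leq_sum => m mr.
by apply: fg; apply: mem_rem mr.
Qed.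

Lemma count_pmap_nth (T : eqType) (l : seq (option T)) x :
  count_mem x (pmap id l) = (\sum_(i < size l) (nth None l i == Some x))%N.
Proof.
elim: l => [|o l IH]; first by rewrite big_ord0.
by rewrite big_ord_recl -IH; case: o.
Qed.

Section Multiplicity.
Variables (K : fieldType) (n : nat) (D : borelData K n).
Local Notation h := (bd_cartan D).
Hypothesis char0 : forall k : nat, k.+1%:R != 0 :> K.
Variables (r t : nat) (neg : r.-tuple 'M[K]_n) (pos : t.-tuple 'M[K]_n) (H0 : 'M[K]_n).
Variables (nrt : 'I_r -> hdual (bd_cartan D)) (prt : 'I_t -> hdual (bd_cartan D)).
Hypothesis gr : graded neg pos H0 nrt prt.
Implicit Type M L : lieModule D.

Lemma iso_dim L L' mu d : lm_iso L L' ->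
  has_dim (fun v : L => weight_vector mu v) d -> has_dim (fun v : L' => weight_vector mu v) d.
Proof.
move=> [f [f_bij f_act]]; apply: (has_dim_inj _ (phi := f) _ _ _).1.
- by move=> a u v; rewrite linearP.
- exact: bij_inj.
case: f_bij => f' fK f'K w; split=> [ww|[v wv ->] x hx]; last first.
  by rewrite /act_at -f_act [lm_act _ v](wv x hx) linearZ.
exists (f' w); last by rewrite f'K.
move=> x hx; apply: (can_inj fK).
by rewrite linearZ [act_at x _]/(lm_act _ _) f_act f'K; apply: ww.
Qed.

(** The dimension of the weight space of weight mu in the simple module of
    highest weight kappa, taken in any such module: they are all
    isomorphic. *)
Definition simple_dim (kappa mu : hdual h) : nat :=
  xget 0%N [set d | exists L (v : L), simple_hw kappa v /\
                      has_dim (fun u : L => weight_vector mu u) d]%classic.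

Lemma simple_dimE L (v : L) kappa mu d : simple_hw kappa v ->
  has_dim (fun u : L => weight_vector mu u) d -> simple_dim kappa mu = d.
Proof.
move=> sv Ld; rewrite /simple_dim; case: xgetP => [d' _ [L' [v' [sv' L'd']]]|/(_ d) []].
  exact: has_dim_uniq (iso_dim (simple_hw_iso char0 gr sv' sv) L'd') Ld.
by exists L, v.
Qed.

Variables (S : seq (hdual h)) (c : K) (dep : hdual h -> nat).
Hypothesis S_dep : {in S, forall mu, wt_at mu H0 = c - (dep mu)%:R}.

Lemma lower_dep mu nu : mu \in S -> nu \in S -> lower H0 mu nu -> (dep mu < dep nu)%N.
Proof.
move=> muS nuS [k]; rewrite !S_dep // -addrA -opprD -natrD => /addrI/oppr_inj/(natr_inj char0) ->.
by rewrite addnS ltnS leq_addr.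
Qed.

(** Weights in the finite list S have finite multiplicity, and S is stable
    under raising as far as the weights of M are concerned: a vector of
    least depth among weights of S outside a submodule is then singular
    modulo it. *)
Record locally_small M : Prop := LocallySmall {
  ls_weight : weight_module M;
  ls_dim : {in S, forall mu, exists d, has_dim (fun v : M => weight_vector mu v) d};
  ls_up : forall mu (i : 'I_t) (v : M), mu \in S -> weight_vector (mu + prt i) v ->
    v <> 0 -> mu + prt i \in S }.

(** Chains play the part of composition series, which the modules need not
    have: a label Some kappa stands for a simple factor, and None for a factor
    that the weights in S do not see. *)
Definition step M (P Q : lieSubmodule M) (o : option (hdual h)) : Prop :=
  (P `<=` Q)%classic /\
  match o with
  | Some kappa => kappa \in S /\ exists v : quotmod (sm_inside Q P), simple_hw kappa v
  | None => forall mu v, mu \in S -> weight_vector mu v -> sm_set Q v -> sm_set P v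
  end.

Inductive chain M : lieSubmodule M -> lieSubmodule M -> seq (option (hdual h)) -> Prop :=
| chain_nil P : chain P P [::]
| chain_cons P Q Q' o l : step P Q o -> chain Q Q' l -> chain P Q' (o :: l).

Lemma chain_cat M (P Q Q' : lieSubmodule M) l l' :
  chain P Q l -> chain Q Q' l' -> chain P Q' (l ++ l').
Proof. by elim=> //= P1 Q1 Q2 o l1 st _ IH ch; apply: chain_cons st (IH ch). Qed.

Lemma chain_step M (P Q : lieSubmodule M) o : step P Q o -> chain P Q [:: o].
Proof. by move=> st; apply: chain_cons st (chain_nil _). Qed.

Lemma chain_fun M (P Q : lieSubmodule M) l : chain P Q l ->
  exists F : nat -> lieSubmodule M, [/\ F 0%N = P, F (size l) = Q &
    forall i, (i < size l)%N -> step (F i) (F i.+1) (nth None l i)].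
Proof.
elim=> [P1|P1 Q1 Q2 o l1 st _ [F [F0 Fs Fst]]]; first by exists (fun=> P1).
exists (fun i => if i is j.+1 then F j else P1); split=> // -[_|i] /=; first by rewrite F0.
exact: Fst.
Qed.

Section Module.
Variable M : lieModule D.
Hypothesis sM : locally_small M.
Implicit Types P Q : lieSubmodule M.

Definition wd Q mu : nat := xget 0%N [set d | has_dim (wt_in Q mu) d]%classic.

Lemma wdP Q mu : mu \in S -> has_dim (wt_in Q mu) (wd Q mu).
Proof.
move=> muS; have [d Md] := ls_dim sM muS.
have [e Qe] : exists e, has_dim (wt_in Q mu) e.
  by apply: has_dim_sub Md _ (wt_in_subspace _ _) => v [].
by rewrite /wd; case: xgetP => [d' _ //|/(_ e)].
Qed.

Lemma wd_le P Q mu : (P `<=` Q)%classic -> mu \in S -> (wd P mu <= wd Q mu)%N.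
Proof.
by move=> PQ muS; apply: (has_dim_le (wdP P muS) (wdP Q muS) _).1 => v [/PQ].
Qed.

Lemma wd_lt P Q mu v : (P `<=` Q)%classic -> mu \in S -> weight_vector mu v ->
  sm_set Q v -> ~ sm_set P v -> (wd P mu < wd Q mu)%N.
Proof.
move=> PQ muS wv Qv nPv; rewrite ltn_neqAle wd_le // andbT; apply/eqP => E.
have [u [/PQ //]|_ /(_ E v) ] := has_dim_le (wdP P muS) (wdP Q muS) _.
by case=> // Pv; apply: nPv.
Qed.

(** A simple factor of highest weight kappa adds its own weight dimensions;
    these vanish except in weights below kappa. *)
Lemma step_dim P Q kappa mu : step P Q (Some kappa) -> mu \in S ->
  [/\ wd Q mu = (wd P mu + simple_dim kappa mu)%N, (0 < simple_dim kappa kappa)%N &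
      (0 < simple_dim kappa mu)%N -> mu = kappa \/ (dep kappa < dep mu)%N].
Proof.
move=> [PQ [kS [v sv]]] muS.
have fdim nu : nu \in S -> wd Q nu = (wd P nu + simple_dim kappa nu)%N /\
    has_dim (fun u : quotmod (sm_inside Q P) => weight_vector nu u) (simple_dim kappa nu).
  move=> nuS; have [d0 [d1 [E Pd Fd]]] := factor_dim (ls_weight sM) PQ (wdP Q nuS).
  by rewrite (simple_dimE sv Fd) E (has_dim_uniq Pd (wdP P nuS)).
split; first exact: (fdim _ muS).1.
  have [_ v0 wv _] := sv; apply: has_dim_gt0 (fdim _ kS).2 wv _.
  by move=> v0'; rewrite v0' eqxx in v0.
move=> pos_mu; have [|ne] := pselect (mu = kappa); [by left|right].
apply: contrapT => nlt; move: pos_mu; rewrite (has_dim0 (fdim _ muS).2) // => u wu.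
apply: (simple_hw_weight gr sv wu ne) => low; apply: nlt.
exact: lower_dep.
Qed.

Lemma step_None_dim P Q mu : step P Q None -> mu \in S -> wd Q mu = wd P mu.
Proof.
move=> [PQ st] muS; apply: has_dim_uniq (wdP Q muS) _.
apply: has_dim_ext (wdP P muS) => v; split=> [[/PQ Qv wv]|[Qv wv]]; split=> //.
exact: st muS wv Qv.
Qed.

Definition good_weight kappa := [/\ kappa \in S, (0 < simple_dim kappa kappa)%N &
  {in S, forall mu, (0 < simple_dim kappa mu)%N -> mu = kappa \/ (dep kappa < dep mu)%N}].

Lemma chain_dim P Q l : chain P Q l -> 
  {in S, forall mu, wd Q mu = (wd P mu + \sum_(k <- pmap id l) simple_dim k mu)%N} /\
  {in pmap id l, forall k, good_weight k}.
Proof.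
elim=> [P1|P1 Q1 Q2 [k|] l1 st _ [IHd IHg]] /=.
- by split=> // mu _; rewrite big_nil addn0.
- split=> [mu muS|k'].
    by rewrite big_cons IHd //; have [-> _ _] := step_dim st muS; rewrite addnA.
  rewrite inE => /predU1P[->|/IHg //]; have [_ [kS _]] := st.
  by split=> // [|mu muS]; [have [] := step_dim st kS|have [] := step_dim st muS].
- by split=> // mu muS; rewrite IHd // (step_None_dim st).
Qed.

(** Induction on the total dimension of the weight spaces of Q / P with
    weights in S. If it is not zero, a weight vector of least depth in Q
    outside P is singular modulo P, and gives a simple factor U / U' between P
    and Q by [simple_step]; the intervals from P to U' and from U to Q are
    smaller. *)
Lemma chain_exists P Q : (P `<=` Q)%classic -> exists l, chain P Q l.
Proof.
move: (leqnn (\sum_(mu <- S) (wd Q mu - wd P mu))%N); move: {2}(\sum_(mu <- S) _)%N => m.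
elim/ltn_ind: m P Q => m IH P Q mle PQ.
have [[mu0 [v0 [mu0S wv0 Qv0 nPv0]]]|no] := pselect (exists mu v,
    [/\ mu \in S, weight_vector mu v, sm_set Q v & ~ sm_set P v]); last first.
  exists [:: None]; apply: chain_step; split=> // mu v muS wv Qv.
  by apply: contrapT => nPv; apply: no; exists mu, v.
pose bad d := `[< exists mu v, [/\ mu \in S, weight_vector mu v, sm_set Q v & ~ sm_set P v] /\ dep mu = d >].
have ex : exists d, bad d by exists (dep mu0); apply/asboolP; exists mu0, v0.
case: (ex_minnP ex) => d /asboolP[mu [v [[muS wv Qv nPv] dE]]] dmin.
have nv e : e \in bd_nil D -> sm_set P (act_at e v).
  rewrite -(gr_pos gr) => /coord_span ->; rewrite act_at_suml.
  apply: sm_sum => i; rewrite act_atZl; apply: sm_Z; apply: contrapT => nPi.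
  have posD : pos`_i \in lie_space D.
    by apply: n_sub; rewrite -(gr_pos gr) memv_span // mem_nth ?size_tuple.
  have wi : weight_vector (mu + prt i) (act_at pos`_i v).
    by apply: wv_root => //; apply: gr_prt gr i.
  have iS : mu + prt i \in S.
    by apply: ls_up wi _ => // E; apply: nPi; rewrite E; apply: sm_0.
  have := dmin (dep (mu + prt i)); rewrite leqNgt -dE => /(_ _)/negP; apply.
    by apply/asboolP; exists (mu + prt i), (act_at pos`_i v); split=> //; split=> //; apply: sm_at.
  apply: lower_dep => //; have [k E] := gr_pht gr i; exists k.
  by rewrite wt_atD E addrK.
have [U [U' [PU' U'U Uv nU'v [Umin [w sw]]]]] := simple_step char0 gr (ls_weight sM) wv nv nPv.
have UQ := Umin Q PQ Qv.
have PU : (P `<=` U)%classic by move=> u /PU'/U'U.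
have U'Q : (U' `<=` Q)%classic by move=> u /U'U/UQ.
have shrink P1 Q1 : (P `<=` P1)%classic -> (P1 `<=` Q1)%classic -> (Q1 `<=` Q)%classic ->
    (wd Q1 mu - wd P1 mu < wd Q mu - wd P mu)%N ->
    exists l, chain P1 Q1 l.
  move=> PP1 P1Q1 Q1Q lt; apply: (IH (\sum_(mu <- S) (wd Q1 mu - wd P1 mu))%N) => //.
  apply: leq_trans mle; apply: sum_lt_seq muS _ lt => nu nuS.
  by apply: leq_sub; apply: wd_le.
have wd_mu := wd_lt U'U muS wv Uv nU'v.
have wdPU' := wd_le PU' muS; have wdUQ := wd_le UQ muS.
have [l1 ch1] : exists l, chain P U' l.
  apply: shrink => //; apply: ltn_sub2r; last exact: leq_trans wd_mu wdUQ.
  exact: leq_ltn_trans wdPU' (leq_trans wd_mu wdUQ).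
have [l2 ch2] : exists l, chain U Q l.
  apply: shrink => //; apply: ltn_sub2l; last exact: leq_ltn_trans wdPU' wd_mu.
  exact: leq_ltn_trans wdPU' (leq_trans wd_mu wdUQ).
exists (l1 ++ Some mu :: l2); apply: chain_cat ch1 _; apply: chain_cons ch2.
by split=> //; split=> //; exists w.
Qed.

Lemma wd_zero mu : mu \in S -> wd (zero_sub M) mu = 0%N.
Proof. by move=> muS; apply: has_dim0 (wdP _ muS) _ => v []. Qed.

Lemma factor_weight_in P Q mu (w : quotmod (sm_inside Q P)) :
  (forall v : M, weight_vector mu v -> v <> 0 -> mu \in S) ->
  weight_vector mu w -> w <> 0 -> mu \in S.
Proof.
move=> inS ww w0; have [u wu wE] := factor_wv_lift (ls_weight sM) ww.
apply: (inS (sm_val u)); first exact/sm_wv.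
by move=> u0; apply: w0; rewrite wE; apply/qm_pi_eq0; rewrite /= u0; apply: sm_0.
Qed.

(** The simple module is determined by its weight dimensions, and a chain
    inside a factor isomorphic to it has the same ones; so it contains its
    highest weight as a label. *)
Lemma iso_factor_count P Q l L (v : L) nu :
  (forall v : M, weight_vector nu v -> v <> 0 -> nu \in S) ->
  simple_hw nu v -> lm_iso (quotmod (sm_inside Q P)) L -> (P `<=` Q)%classic ->
  chain P Q l -> (0 < count_mem nu (pmap id l))%N.
Proof.
move=> inS sv iso PQ ch.
have [[f [f_bij f_act]] [_ v0 wv _]] := (iso, sv).
have nuS : nu \in S.
  case: (f_bij) => f' fK f'K; apply: (factor_weight_in (w := f' v) inS).
    move=> x hx; apply: (can_inj fK).
    by rewrite linearZ [act_at x _]/(lm_act _ _) f_act f'K; apply: wv.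
  by move=> f'0; have := f'K v; rewrite f'0 linear0 => v0'; rewrite -v0' eqxx in v0.
have dimE mu : mu \in S -> wd Q mu = (wd P mu + simple_dim nu mu)%N /\
    has_dim (fun u : L => weight_vector mu u) (simple_dim nu mu).
  move=> muS; have [d0 [d1 [E Pd Fd]]] := factor_dim (ls_weight sM) PQ (wdP Q muS).
  have Ld := iso_dim iso Fd.
  by rewrite (simple_dimE sv Ld) E (has_dim_uniq Pd (wdP P muS)).
have [chd chg] := chain_dim ch.
have nug : good_weight nu.
  split=> // [|mu muS pos_mu].
    by apply: has_dim_gt0 (dimE _ nuS).2 wv _ => v0'; rewrite v0' eqxx in v0.
  have [|ne] := pselect (mu = nu); [by left|right].
  apply: contrapT => nlt; move: pos_mu; rewrite (has_dim0 (dimE _ muS).2) // => u wu.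
  apply: (simple_hw_weight gr sv wu ne) => low; apply: nlt.
  exact: lower_dep.
have good k : k \in [:: nu] ++ pmap id l -> good_weight k.
  by rewrite inE => /predU1P[->|/chg].
have : perm_eq [:: nu] (pmap id l).
  apply: (@unitriangular_perm _ dep simple_dim) => [k /good[]|k m /good[_ _ gk] /good[mS _ _]|m /good[mS _ _]] //.
    exact: gk.
  by rewrite big_seq1; apply: (@addnI (wd P m)); rewrite -(dimE m mS).1 chd.
by move=> /permP <-; rewrite /= eqxx.
Qed.

Lemma chain_filtration k F : filtration (M := M) k F ->
  F 0%N = zero_sub M /\ F k = full_sub M.
Proof.
by move=> [F0 Fk _]; split; apply: sm_eq => v; rewrite ?F0 ?Fk.
Qed.

Lemma nb_factors_sum k (F : nat -> lieSubmodule M) L :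
  nb_factors L k F = (\sum_(i < k) `[< lm_iso (factor F i) L >])%N.
Proof.
by rewrite /nb_factors -sum1_card big_mkcond; apply: eq_bigr => i _; rewrite inE; case: (asbool _).
Qed.

(** Each step of a filtration is refined to a chain, which has a label nu for
    each factor isomorphic to L. *)
Lemma filtration_chain L (v : L) nu k F :
  (forall v : M, weight_vector nu v -> v <> 0 -> nu \in S) ->
  simple_hw nu v -> filtration (M := M) k F ->
  exists l, chain (zero_sub M) (full_sub M) l /\
    (nb_factors L k F <= count_mem nu (pmap id l))%N.
Proof.
move=> inS sv flt; have [F0 Fk] := chain_filtration flt; have [_ _ Fi] := flt.
rewrite nb_factors_sum -F0 -Fk; elim: k Fi {flt Fk} => [|k IH] Fi.
  by exists [::]; rewrite big_ord0; split=> //; apply: chain_nil.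
have [i ik|l [ch le]] := IH; first by apply: Fi; apply: ltnW.
have FF := Fi k (ltnSn k); have [l' ch'] := chain_exists FF.
exists (l ++ l'); split; first exact: chain_cat ch ch'.
rewrite big_ord_recr pmap_cat count_cat; apply: leq_add => //=.
by case: asboolP => // iso; apply: iso_factor_count inS sv iso FF ch'.
Qed.

Lemma chain_count L (v : L) nu l : simple_hw nu v ->
  chain (zero_sub M) (full_sub M) l ->
  exists k F, filtration (M := M) k F /\ (count_mem nu (pmap id l) <= nb_factors L k F)%N.
Proof.
move=> sv ch; have [F [F0 Fs Fst]] := chain_fun ch.
exists (size l), F; split.
  split; [by rewrite F0|by rewrite Fs|by move=> i /Fst[]].
rewrite nb_factors_sum.
rewrite count_pmap_nth.
apply: leq_sum => i _; case: eqP => // iE; rewrite lt0b; apply/asboolP.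
have [_ /=] := Fst i (ltn_ord i); rewrite iE => -[_ [w sw]].
exact: (simple_hw_iso char0 gr sw sv).
Qed.

End Module.

(** A chain from 0 to the whole module is itself a filtration, so the number
    of its labels nu is at most the composition multiplicity; every filtration
    refines to a chain, and the labels of all chains are the same by their
    weight dimensions, so there is equality. *)
Theorem equal_multiplicities M N L (v : L) nu :
  locally_small M -> locally_small N ->
  {in S, forall mu d, has_dim (fun v : M => weight_vector mu v) d ->
     has_dim (fun v : N => weight_vector mu v) d} ->
  simple_hw nu v ->
  (forall u : M, weight_vector nu u -> u <> 0 -> nu \in S) ->
  (forall u : N, weight_vector nu u -> u <> 0 -> nu \in S) ->
  exists m, comp_mult M L m /\ comp_mult N L m.
Proof.
move=> sM sN MN sv inM inN.
have full (A : lieModule D) : (zero_sub A `<=` full_sub A)%classic by [].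
have [lM chM] := chain_exists sM (full M).
have [lN chN] := chain_exists sN (full N).
have wdMN mu : mu \in S -> wd (full_sub M) mu = wd (full_sub N) mu.
  move=> muS; have [d Md] := ls_dim sM muS.
  have fd (A : lieModule D) (sA : locally_small A) : has_dim (fun v : A => weight_vector mu v) d ->
      wd (full_sub A) mu = d.
    move=> Ad; apply: has_dim_uniq (wdP sA _ muS) _.
    by apply: has_dim_ext Ad => u; split=> [|[]].
  by rewrite !fd //; apply: MN.
have uniq_count (A B : lieModule D) (sA : locally_small A) (sB : locally_small B) lA lB :
    {in S, forall mu, wd (full_sub A) mu = wd (full_sub B) mu} ->
    chain (zero_sub A) (full_sub A) lA -> chain (zero_sub B) (full_sub B) lB ->
    count_mem nu (pmap id lA) = count_mem nu (pmap id lB).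
  move=> AB chA chB; apply/permP.
  have [dA gA] := chain_dim sA chA; have [dB gB] := chain_dim sB chB.
  have good k : k \in pmap id lA ++ pmap id lB -> good_weight k.
    by rewrite mem_cat => /orP[/gA|/gB].
  apply: (@unitriangular_perm _ dep simple_dim) => [k /good[]|k m /good[_ _ gk] /good[mS _ _]|m /good[mS _ _]] //.
    exact: gk.
  by have := AB m mS; rewrite dA // dB // !wd_zero.
have mult (A : lieModule D) (sA : locally_small A) lA :
    (forall u : A, weight_vector nu u -> u <> 0 -> nu \in S) ->
    chain (zero_sub A) (full_sub A) lA -> comp_mult A L (count_mem nu (pmap id lA)).
  move=> inA chA.
  have upper k F : filtration (M := A) k F -> (nb_factors L k F <= count_mem nu (pmap id lA))%N.
    move=> flt; have [l [ch le]] := filtration_chain sA inA sv flt.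
    by rewrite (uniq_count A A sA sA lA l).
  split=> //; have [k [F [flt le]]] := chain_count sv chA.
  by exists k, F; split=> //; apply/eqP; rewrite eqn_leq le upper.
exists (count_mem nu (pmap id lM)); split; first exact: mult.
by rewrite (uniq_count M N sM sN lM lN); [apply: mult|exact: wdMN| |].
Qed.

End Multiplicity.

(** * Modules with a basis of weight vectors *)

Lemma lspan_sum_cond (K : fieldType) (V : lmodType K) (S : V -> Prop) I (r : seq I)
    (P : pred I) (F : I -> V) :
  (forall i, P i -> lspan S (F i)) -> lspan S (\sum_(i <- r | P i) F i).
Proof.
move=> SF; elim: r => [|i r IH]; first by rewrite big_nil; constructor.
by rewrite big_cons; case: ifP => // Pi; apply: lspanD => //; apply: SF.
Qed.

Lemma lin_spanP (K : fieldType) (V : lmodType K) (s : seq V) v :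
  lin_span s v <-> lspan (fun y => y \in s) v.
Proof.
split=> [[c ->]|].
  by apply: lspan_sum => i; apply: lspanZ; apply: lspan_gen; rewrite mem_nth.
elim=> [|a x y xs _ [c ->]].
  by exists (fun=> 0); rewrite big1 // => i _; rewrite scale0r.
have il : (index x s < size s)%N by rewrite index_mem.
exists (fun j => a *+ (j == Ordinal il) + c j).
under [RHS]eq_bigr do rewrite scalerDl.
rewrite [RHS]big_split /=; congr (_ + _).
rewrite (bigD1 (Ordinal il)) //= eqxx nth_index // big1 ?addr0 // => j jt.
by rewrite (negPf jt) scale0r.
Qed.

Section LiftSubmodule.
Variables (K : fieldType) (n : nat) (D : borelData K n) (M : lieModule D).
Variables (Q : lieSubmodule M) (N : lieSubmodule (submod Q)).

Let s : set M := [set x | exists2 u : submod Q, sm_set N u & x = sm_val u]%classic.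
Let s0 : s 0. Proof. by exists 0; [apply: sm_0|]. Qed.
Let sl a x y : s x -> s y -> s (a *: x + y).
Proof.
by move=> [u Nu ->] [v Nv ->]; exists (a *: u + v); [apply: sm_lin|rewrite sm_val_lin].
Qed.
Let sa x y : s y -> s (lm_act x y).
Proof. by move=> [u Nu ->]; exists (lm_act x u); [apply: sm_act|]. Qed.

Definition lift_sub : lieSubmodule M := LieSubmodule s0 sl sa.

Lemma lift_subP u : sm_set N u <-> sm_set lift_sub (sm_val u).
Proof. by split=> [Nu|[v Nv /sm_val_inj ->] //]; exists u. Qed.

End LiftSubmodule.

Lemma gen_submod_all (K : fieldType) n (g : linLie K n) (M : lieModule g)
    (S : set M) v :
  (forall N : lieSubmodule M, (S `<=` N)%classic -> sm_set N v) -> sm_set (gen_submod S) v.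
Proof. by move=> H; exact: H. Qed.

Section BasisSpan.
Variables (K : fieldType) (V : lmodType K) (T : eqType) (E : T -> V).
Hypothesis bE : lin_basis E.

Lemma has_dim_basis (l : seq T) : uniq l ->
  has_dim (lspan (fun y => exists2 t, t \in l & y = E t)) (size l).
Proof.
move=> lU; case: l lU => [|t0 l'] lU.
  exists (fun=> 0); split=> [a u v|u v _|v].
  - by rewrite scaler0 addr0.
  - by rewrite [u]thinmx0 [v]thinmx0.
  split=> [|[_ ->]]; last by constructor.
  by case=> [|a x y [t]]; [exists 0|rewrite in_nil].
set l := t0 :: l' in lU *.
exists (fun u : 'rV[K]_(size l) => \sum_i u 0 i *: E (nth t0 l i)); split=> [a u v|u v uv|v].
- rewrite scaler_sumr -big_split; apply: eq_bigr => i _ /=.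
  by rewrite !mxE scalerDl scalerA.
- apply/rowP => i; apply/eqP; rewrite -subr_eq0; apply/eqP.
  pose k t := u 0 (inord (index t l)) - v 0 (inord (index t l)).
  have kE (j : 'I_(size l)) : k (nth t0 l j) = u 0 j - v 0 j.
    by rewrite /k index_uniq // inord_val.
  have := bE.2 l k lU; rewrite (big_nth t0) big_mkord => H.
  rewrite -kE; apply: H; last by rewrite mem_nth.
  under eq_bigr => j _ do rewrite kE scalerBl.
  by rewrite sumrB uv subrr.
split=> [lv|[u ->]]; last first.
  apply: lspan_sum => i; apply: lspanZ; apply: lspan_gen.
  by exists (nth t0 l i); rewrite ?mem_nth.
elim: lv => [|a x y [t tl ->] _ [u ->]].
  by exists 0; rewrite big1 // => i _; rewrite mxE scale0r.
have il : (index t l < size l)%N by rewrite index_mem.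
exists (\row_j (a *+ (j == Ordinal il) + u 0 j)).
under [RHS]eq_bigr do rewrite mxE scalerDl.
rewrite [RHS]big_split /=; congr (_ + _).
rewrite (bigD1 (Ordinal il)) //= eqxx nth_index // big1 ?addr0 // => j jt.
by rewrite (negPf jt) scale0r.
Qed.

End BasisSpan.

Section WeightBasis.
Variables (K : fieldType) (n : nat) (D : borelData K n).
Local Notation h := (bd_cartan D).
Hypothesis char0 : forall k : nat, k.+1%:R != 0 :> K.
Variables (r t : nat) (neg : r.-tuple 'M[K]_n) (pos : t.-tuple 'M[K]_n) (H0 : 'M[K]_n).
Variables (nrt : 'I_r -> hdual (bd_cartan D)) (prt : 'I_t -> hdual (bd_cartan D)).
Hypothesis gr : graded neg pos H0 nrt prt.
Variables (T : eqType) (w : T -> hdual h) (d : T -> nat) (c : K).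
Hypothesis w_d : forall x, wt_at (w x) H0 = c - (d x)%:R.
Hypothesis d_fin : forall k, exists s : seq T, forall x, (d x <= k)%N -> x \in s.

Lemma raise_depth x x' i : w x' = w x + prt i -> (d x' <= d x)%N.
Proof.
move=> x'E; have [m mE] := gr_pht gr i.
have := w_d x'; rewrite x'E wt_atD w_d mE -addrA => /addrI dE.
suff -> : d x = (d x' + m.+1)%N by apply: leq_addr.
by apply: (natr_inj char0); rewrite natrD -[(d x')%:R]opprK -dE opprD opprK subrK.
Qed.

(** The same weights w will be used for bases of two modules. *)
Record weight_basis (M : lieModule D) (E : T -> M) : Prop := WeightBasis {
  wb_basis : lin_basis E;
  wb_weight : forall x, weight_vector (w x) (E x) }.

Section Module.
Variables (M : lieModule D) (E : T -> M).
Hypothesis bE : weight_basis E.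

Lemma wb_weight_module : weight_module M.
Proof.
move=> v; elim: ((wb_basis bE).1 v) => [|a x y [u ->] _ [s [-> sw]]].
  by exists [::]; rewrite big_nil.
exists (a *: E u :: s); rewrite big_cons; split=> // z; rewrite inE => /predU1P[->|/sw //].
by exists (w u); apply: wv_Z; apply: wb_weight.
Qed.

(** The basis vectors of other weights in the expansion of a weight vector sum
    to zero by [wt_extract]. *)
Lemma wb_weight_space mu v : weight_vector mu v <->
  lspan (fun y => exists2 x, w x = mu & y = E x) v.
Proof.
split=> [wv|]; last first.
  elim=> [|a x y [u <- ->] _ IH]; first exact: wv_0.
  by apply: wv_lin => //; apply: wb_weight.
have Lv : lspan (fun y => exists2 u, predT u & y = E u) v.
  by apply: (lspan_sub _ ((wb_basis bE).1 v)) => _ [u ->]; apply: lspan_gen; exists u.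
have [l [k [lU _ vE]]] := lspan_list Lv.
pose v1 := \sum_(x <- l | w x == mu) k x *: E x.
have lv1 : lspan (fun y => exists2 x, w x = mu & y = E x) v1.
  by apply: lspan_sum_cond => x /eqP xmu; apply: lspanZ; apply: lspan_gen; exists x.
suff -> : v = v1 by [].
apply/eqP; rewrite -subr_eq0; apply/eqP.
apply: (wt_extract (B := zero_sub _) (kappa := mu) (a := - \sum_(x <- l | w x != mu) k x *: E x)).
- apply: wv_B => //; elim: lv1 => [|a x y [u <- ->] _ IH]; first exact: wv_0.
  by apply: wv_lin => //; apply: wb_weight.
- rewrite -sumrN; elim: (l) => [|x s IH]; first by rewrite big_nil; apply: off_weight0.
  rewrite big_cons; case: ifP => // /eqP xmu; apply: off_weightD => //.
  rewrite -scaleNr; apply: off_weightZ; apply: off_weight1 xmu _; exact: wb_weight.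
by rewrite /= /zero_sub_set /= vE (bigID (fun x => w x == mu)) /= -/v1 -[v1 + _ - v1 - _]addrA -opprD subrr.
Qed.

Lemma wb_weight_in mu (v : M) : weight_vector mu v -> v <> 0 -> exists x, w x = mu.
Proof. by move=> /wb_weight_space Lv; case: Lv => [//|a x y [u <- _] _ _]; exists u. Qed.

Lemma wb_weight_dim mu : exists l : seq T, [/\ uniq l, forall x, (x \in l) = (w x == mu) &
  has_dim (fun v : M => weight_vector mu v) (size l)].
Proof.
have [[x0 x0mu]|no] := pselect (exists x, w x = mu); last first.
  exists [::]; split=> // [x|]; first by apply/esym/eqP => xmu; apply: no; exists x.
  apply: has_dim_ext (has_dim_basis (wb_basis bE) (l := [::]) isT) => v; rewrite wb_weight_space.
  by split; apply: lspan_sub => y [x xx ->]; apply: lspan_gen; exists x => //; case: no; exists x.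
have [s sP] := d_fin (d x0).
pose l := undup (filter (fun x => w x == mu) s).
have lE x : (x \in l) = (w x == mu).
  rewrite mem_undup mem_filter; case: eqP => //= xmu; apply: sP.
  by have := w_d x; rewrite xmu -x0mu w_d => /addrI/oppr_inj/(natr_inj char0) ->.
exists l; split; rewrite ?undup_uniq //.
apply: has_dim_ext (has_dim_basis (wb_basis bE) (undup_uniq _)) => v; rewrite wb_weight_space.
by split; apply: lspan_sub => y [x xx ->]; apply: lspan_gen; exists x => //; [apply/eqP; rewrite -lE|rewrite lE; apply/eqP].
Qed.

(** The part of depth at most k is of finite dimension and stable under the
    nilradical, although it is not a submodule. *)
Definition trunc k : M -> Prop := lspan (fun y => exists2 x, (d x <= k)%N & y = E x).

Lemma trunc_dim k : exists m, has_dim (trunc k) m.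
Proof.
have [s sP] := d_fin k; pose l := undup (filter (fun x => d x <= k)%N s).
exists (size l); apply: has_dim_ext (has_dim_basis (wb_basis bE) (undup_uniq _)) => v.
have lE x : (x \in l) = (d x <= k)%N.
  by rewrite mem_undup mem_filter; case: leqP => //= xk; apply: sP.
by split; apply: lspan_sub => y [x xx ->]; apply: lspan_gen; exists x => //; rewrite -?lE // lE.
Qed.

Lemma trunc_nil k e v : e \in bd_nil D -> trunc k v -> trunc k (act_at e v).
Proof.
move=> ne; apply: (lspan_image (f := act_at e)) => [a u1 u2|_ [x xk ->]]; first exact: act_at_lin.
move: ne; rewrite -(gr_pos gr) => /coord_span ->; rewrite act_at_suml.
apply: lspan_sum => i; rewrite act_atZl; apply: lspanZ.
have posD : pos`_i \in lie_space D.
  by apply: n_sub; rewrite -(gr_pos gr) memv_span // mem_nth ?size_tuple.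
have /wb_weight_space : weight_vector (w x + prt i) (act_at pos`_i (E x)).
  by apply: wv_root => //; [apply: gr_prt gr i|apply: wb_weight].
apply: lspan_sub => _ [x' x'E ->]; apply: lspan_gen; exists x' => //.
exact: leq_trans (raise_depth x'E) xk.
Qed.

Lemma wb_cover v : exists k, trunc k v.
Proof.
elim: ((wb_basis bE).1 v) => [|a _ y [x ->] _ [k yk]]; first by exists 0%N; constructor.
exists (maxn k (d x)); apply: lspan_cons; first by exists x; rewrite ?leq_maxr.
by apply: (lspan_sub _ yk) => _ [x' x'k ->]; apply: lspan_gen; exists x' => //; apply: leq_trans x'k (leq_maxl _ _).
Qed.

(** Every vector generates a module of the category: it is finitely
    generated by definition, submodules of weight modules are weight
    modules, and the nilradical acts on its part of bounded depth, which has
    finite dimension. *)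
Lemma wb_union_of_O : union_of_O M.
Proof.
move=> v; pose N := gen_submod [set v]%classic; exists N.
have Nv : sm_set N v by apply: mem_gen_submod.
split=> //; split.
- exists [:: sm_elt Nv]; apply/seteqP; split=> // u _.
  apply: (gen_submod_all (S := [set` [:: sm_elt Nv]]%classic)) => N' N'v.
  apply/lift_subP/(gen_submod_sub _ (sm_valE u)) => _ /= ->.
  by apply/(lift_subP N' (sm_elt Nv))/N'v; rewrite /= mem_head.
- exact: weight_submod wb_weight_module.
move=> u; have [k uk] := wb_cover (sm_val u).
have [m tm] := trunc_dim k.
have [m' Nm] : exists m', has_dim (fun y : M => sm_set N y /\ trunc k y) m'.
  apply: has_dim_sub tm _ _ => [y [] //|].
  split=> [|a y z [Ny ty] [Nz tz]]; first by split; [apply: sm_0|constructor].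
  by split; [apply: sm_lin|apply: lspan_lin].
have [f [f_lin f_inj fP]] : has_dim (fun y : submod N => trunc k (sm_val y)) m'.
  apply: (has_dim_inj _ _ (@sm_val_inj _ _ _ _ N) _).2 Nm => [a y z|y]; first exact: sm_val_lin.
  split=> [[Ny ty]|[z tz ->]]; first by exists (sm_elt Ny).
  by split=> //; apply: sm_valE.
pose s := [seq f (delta_mx 0 i) | i <- enum 'I_m'].
have sE y : lin_span s y <-> trunc k (sm_val y).
  rewrite lin_spanP; split=> [|/fP[x ->]].
    elim=> [|a _ z /mapP[i _ ->] _ tz]; first by constructor.
    by apply: lspan_lin => //; apply/fP; exists (delta_mx 0 i).
  have f_sum I (l : seq I) (F : I -> 'rV[K]_m') (a : I -> K) :
      f (\sum_(i <- l) a i *: F i) = \sum_(i <- l) a i *: f (F i).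
    elim: l => [|i l IHl]; last by rewrite !big_cons f_lin IHl.
    rewrite !big_nil; exact: (lin_at0 f_lin).
  rewrite (row_sum_delta x) f_sum; apply: lspan_sum => i; apply: lspanZ.
  by apply: lspan_gen; apply: map_f; rewrite mem_enum.
exists s; split; first exact/sE.
by move=> e y ne /sE ty; apply/sE; apply: trunc_nil.
Qed.

End Module.

Lemma truncated_weights k : exists S : seq (hdual h),
  forall mu, mu \in S <-> exists2 x, (d x <= k)%N & w x = mu.
Proof.
have [s sP] := d_fin k; exists [seq w x | x <- s & (d x <= k)%N] => mu.
split=> [/mapP[x]|[x xk <-]].
  by rewrite mem_filter => /andP[xk _] ->; exists x.
by apply/mapP; exists x; rewrite // mem_filter xk sP.
Qed.

(** On weights of the basis this agrees with d; it is needed as a function of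
    the weight itself. *)
Definition depth (mu : hdual h) : nat := xget 0%N [set j | wt_at mu H0 = c - j%:R]%classic.

Lemma depthE x : wt_at (w x) H0 = c - (depth (w x))%:R.
Proof. by rewrite /depth; case: xgetP => [j -> //|/(_ (d x)) []]. Qed.

Lemma depth_w x : depth (w x) = d x.
Proof. by have := depthE x; rewrite w_d => /addrI/oppr_inj/(natr_inj char0). Qed.

Lemma wb_locally_small (M : lieModule D) (E : T -> M) k (S : seq (hdual h)) :
  weight_basis E -> (forall mu, mu \in S <-> exists2 x, (d x <= k)%N & w x = mu) ->
  locally_small prt S M.
Proof.
move=> bE SP; split; first exact: wb_weight_module bE.
  by move=> mu _; have [l [_ _ Ml]] := wb_weight_dim bE mu; exists (size l).
move=> mu i v /SP[x xk <-] wv v0; have [x' x'E] := wb_weight_in bE wv v0.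
apply/SP; exists x' => //; exact: leq_trans (raise_depth x'E) xk.
Qed.

(** The multiplicity of a simple module of highest weight nu is computed with
    the weights of depth at most the depth of nu. They are finite in number
    and stable under raising, and the common indexing of the bases gives both
    modules the same weight dimensions. *)
Theorem eq_Groth_of_bases (M N : lieModule D) (E : T -> M) (F : T -> N) :
  weight_basis E -> weight_basis F -> eq_Groth M N.
Proof.
move=> bE bF; split; [exact: wb_union_of_O bE|exact: wb_union_of_O bF|].
move=> L [sL [nu [v [v0 wv nv]]]].
have [k kP] : exists k, forall x, w x = nu -> (d x <= k)%N.
  have [[x xnu]|no] := pselect (exists x, w x = nu).
    by exists (d x) => x' x'nu; rewrite -!depth_w xnu x'nu.
  by exists 0%N => x xnu; case: no; exists x.
have [S SP] := truncated_weights k.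
have S_dep : {in S, forall mu, wt_at mu H0 = c - (depth mu)%:R}.
  by move=> mu /SP[x _ <-]; apply: depthE.
have sv : simple_hw nu v by split.
apply: (equal_multiplicities char0 gr S_dep _ _ _ sv).
- exact: wb_locally_small bE SP.
- exact: wb_locally_small bF SP.
- move=> mu _ j Mj; have [l [lU lP Ml]] := wb_weight_dim bE mu.
  have [l' [l'U l'P Nl]] := wb_weight_dim bF mu.
  rewrite (has_dim_uniq Mj Ml) (_ : size l = size l') //.
  by apply/perm_size/uniq_perm => // x; rewrite lP l'P.
- by move=> u wu u0; have [x xnu] := wb_weight_in bE wu u0; apply/SP; exists x => //; apply: kP.
- by move=> u wu u0; have [x xnu] := wb_weight_in bF wu u0; apply/SP; exists x => //; apply: kP.
Qed.

End WeightBasis.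

(** * Triangular decompositions from gradings *)

Section Lieb.
Variables (K : fieldType) (n : nat).
Implicit Types x y z : 'M[K]_n.

Lemma lieb_linr a x y z : lieb x (a *: y + z) = a *: lieb x y + lieb x z.
Proof.
by rewrite /lieb mulmxDr mulmxDl -scalemxAl -scalemxAr opprD addrACA scalerBr.
Qed.

Lemma lieb_anti x y : lieb x y = - lieb y x.
Proof. by rewrite /lieb opprB. Qed.

Lemma lieb_linl a x y z : lieb (a *: y + z) x = a *: lieb y x + lieb z x.
Proof. by rewrite lieb_anti lieb_linr opprD -scalerN -!lieb_anti. Qed.

Lemma lieb0r x : lieb x 0 = 0.
Proof. by rewrite /lieb mulmx0 mul0mx subrr. Qed.

Lemma liebDr x y z : lieb x (y + z) = lieb x y + lieb x z.
Proof. by rewrite -[y]scale1r lieb_linr !scale1r. Qed.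

Lemma liebDl x y z : lieb (y + z) x = lieb y x + lieb z x.
Proof. by rewrite -[y]scale1r lieb_linl !scale1r. Qed.

Lemma liebZr a x y : lieb x (a *: y) = a *: lieb x y.
Proof. by rewrite -[a *: y]addr0 lieb_linr lieb0r addr0. Qed.

Lemma liebZl a x y : lieb (a *: x) y = a *: lieb x y.
Proof. by rewrite lieb_anti liebZr -scalerN -lieb_anti. Qed.

Lemma liebNr x y : lieb x (- y) = - lieb x y.
Proof. by rewrite -scaleN1r liebZr scaleN1r. Qed.

Lemma lieb_sumr x I (l : seq I) (F : I -> 'M[K]_n) :
  lieb x (\sum_(i <- l) F i) = \sum_(i <- l) lieb x (F i).
Proof. by apply: (big_morph (lieb x)); [exact: liebDr | exact: lieb0r]. Qed.

Lemma lieb_jacobi x y z : lieb x (lieb y z) = lieb (lieb x y) z + lieb y (lieb x z).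
Proof.
have rearrange (V : zmodType) (a b c d e f : V) :
    a - b - (c - d) = a - e - (f - d) + (e - c - (b - f)).
  by rewrite !opprB [RHS]addrACA !addrA !subrK -!addrA; congr (_ + _); rewrite addrC -addrA addrCA.
rewrite /lieb !(mulmxBl, mulmxBr) !mulmxA; exact: rearrange.
Qed.

(** Applying ad x - k removes one of the eigenvectors and rescales the
    others. *)
Lemma eigen_sum0 (x : 'M[K]_n) (s : seq (K * 'M[K]_n)) :
  (forall p, p \in s -> lieb x p.2 = p.1 *: p.2) -> uniq (map fst s) ->
  \sum_(p <- s) p.2 = 0 -> forall p, p \in s -> p.2 = 0.
Proof.
move: (leqnn (size s)); move: {2}(size s) => m.
elim: m s => [|m IH] [|[k v] s] //= sz eig /andP[ks us].
rewrite big_cons /= => sum0.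
have eigs p : p \in s -> lieb x p.2 = p.1 *: p.2 by move=> ps; apply: eig; rewrite inE ps orbT.
have s0 : forall p, p \in s -> p.2 = 0.
  pose s' := [seq (p.1, (p.1 - k) *: p.2) | p <- s].
  have H : forall p, p \in s' -> p.2 = 0.
    apply: IH; rewrite ?size_map //.
    - by move=> _ /mapP[p ps ->] /=; rewrite liebZr eigs // !scalerA mulrC.
    - by rewrite -map_comp (eq_map (g := fst)).
    rewrite big_map /=; under eq_bigr do rewrite scalerBl.
    rewrite sumrB -scaler_sumr.
    have -> : \sum_(i <- s) i.1 *: i.2 = \sum_(i <- s) lieb x i.2.
      by rewrite big_seq [RHS]big_seq; apply: eq_bigr => p ps; rewrite eigs.
    have vE : \sum_(p <- s) p.2 = - v by apply/eqP; rewrite -addr_eq0 addrC sum0.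
    rewrite -lieb_sumr vE liebNr (eig (k, v)) ?mem_head //= scalerN opprK.
    by rewrite addNr.
  move=> p ps; have /= /eqP := H _ (map_f (fun p => (p.1, (p.1 - k) *: p.2)) ps).
  rewrite scaler_eq0 => /orP[|/eqP //]; rewrite subr_eq0 => /eqP pk.
  by move: ks; rewrite -pk map_f.
move=> p; rewrite inE => /predU1P[-> /=|/s0 //].
by move: sum0; rewrite big_seq big1 ?addr0.
Qed.

End Lieb.

Section Grading.
Variables (K : fieldType) (n : nat) (D : borelData K n) (r s t : nat).
Hypothesis char0 : forall k : nat, k.+1%:R != 0 :> K.
Variables (neg : r.-tuple 'M[K]_n) (car : s.-tuple 'M[K]_n) (pos : t.-tuple 'M[K]_n).
Variables (H : 'M[K]_n) (kn : 'I_r -> nat) (kp : 'I_t -> nat).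
Hypothesis neg0 : forall i : 'I_r, neg`_i != 0.
Hypothesis pos0 : forall i : 'I_t, pos`_i != 0.
Hypothesis kn_inj : injective kn.
Hypothesis kp_inj : injective kp.
Hypothesis negH : forall i : 'I_r, lieb H neg`_i = - (kn i).+1%:R *: neg`_i.
Hypothesis posH : forall i : 'I_t, lieb H pos`_i = (kp i).+1%:R *: pos`_i.
Hypothesis carH : forall i : 'I_s, lieb H car`_i = 0.
Hypothesis car_free : free car.

Lemma natK_neq_opp (a b : nat) : a.+1%:R <> - b%:R :> K.
Proof.
move=> /eqP; rewrite -addr_eq0 -natrD addSn; exact/negP/char0.
Qed.

(** Vectors of different eigenvalues for H are independent, and all the Cartan
    vectors share the eigenvalue 0. *)
Lemma graded_free : free (cat_tuple neg (cat_tuple car pos)).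
Proof.
apply/freeP => k sum0.
pose hsum := \sum_i k (rshift r (lshift t i)) *: car`_i.
pose eigs := (0 : K, hsum) ::
  [seq (- (kn i).+1%:R, k (lshift (s + t) i) *: neg`_i) | i <- enum 'I_r] ++
  [seq ((kp i).+1%:R, k (rshift r (rshift s i)) *: pos`_i) | i <- enum 'I_t].
have z : forall p, p \in eigs -> p.2 = 0.
  apply: (eigen_sum0 (x := H)).
  - move=> p; rewrite inE mem_cat => /or3P[/eqP->|/mapP[i _ ->]|/mapP[i _ ->]] /=.
    + rewrite scale0r lieb_sumr big1 // => i _; rewrite liebZr carH scaler0 //.
    + by rewrite liebZr negH !scalerA mulrC.
    + by rewrite liebZr posH !scalerA mulrC.
  - rewrite map_cons cons_uniq map_cat -!map_comp mem_cat negb_or cat_uniq; apply/andP; split.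
      apply/andP; split; apply/mapP => -[i _ /= /eqP].
        by rewrite eq_sym oppr_eq0 (negPf (char0 _)).
      by rewrite eq_sym (negPf (char0 _)).
    apply/and3P; split.
    + rewrite map_inj_uniq -?enumT ?enum_uniq // => i j /= /oppr_inj/(natr_inj char0)[] /kn_inj //.
    + apply/hasPn => _ /mapP[i _ ->]; apply/mapP => -[j _ /= E].
      exact: natK_neq_opp E.
    + rewrite map_inj_uniq -?enumT ?enum_uniq // => i j /= /(natr_inj char0)[] /kp_inj //.
  rewrite big_cons big_cat !big_map -!enumT !big_enum /= -[RHS]sum0 big_split_ord /=.
  rewrite [X in _ = _ + X]big_split_ord /= addrCA; congr (_ + (_ + _)).
  - by apply: eq_bigr => i _; rewrite -(nth_neg neg car pos).
  - by apply: eq_bigr => i _; rewrite -(nth_car neg car pos).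
  - by apply: eq_bigr => i _; rewrite -(nth_pos neg car pos).
have scal0 (a : K) (v : 'M[K]_n) : v != 0 -> a *: v = 0 -> a = 0.
  by move=> v0 /eqP; rewrite scaler_eq0 (negPf v0) orbF => /eqP.
move=> i; case: (split_ordP i) => [j ->|j ->].
  apply: scal0 (neg0 j) _; apply: (z (- (kn j).+1%:R, k (lshift (s + t) j) *: neg`_j)).
  rewrite inE mem_cat; apply/or3P/Or32.
  by apply/mapP; exists j; rewrite ?mem_enum.
case: (split_ordP j) => [l ->|l ->].
  have /freeP cf := car_free.
  exact: (cf (fun l => k (rshift r (lshift t l))) (z (0, hsum) (mem_head _ _)) l).
apply: scal0 (pos0 l) _; apply: (z ((kp l).+1%:R, k (rshift r (rshift s l)) *: pos`_l)).
rewrite inE mem_cat; apply/or3P/Or33.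
by apply/mapP; exists l; rewrite ?mem_enum.
Qed.

Hypothesis span_all : <<cat_tuple neg (cat_tuple car pos)>>%VS = lie_space D.
Hypothesis span_car : <<car>>%VS = bd_cartan D.
Hypothesis span_pos : <<pos>>%VS = bd_nil D.
Hypothesis car_comm : forall x y, x \in car -> y \in car -> lieb x y = 0.

(** Brackets add eigenvalues of H, and the elements of D with positive
    integral eigenvalue lie in the span of pos. *)
Lemma triangular_of_grading : triangular D neg car pos.
Proof.
split=> //; first exact: graded_free.
pose b := cat_tuple neg (cat_tuple car pos).
have b_free : free b := graded_free.
pose ev (i : 'I_(r + (s + t))) : K := match split i with
  | inl j => - (kn j).+1%:R
  | inr j => match split j with inl _ => 0 | inr l => (kp l).+1%:R end end.
have bH (i : 'I_(r + (s + t))) : lieb H b`_i = ev i *: b`_i.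
  rewrite /ev; case: (split_ordP i) => j ->; first by rewrite (nth_neg neg car pos) negH.
  case: (split_ordP j) => l ->; first by rewrite (nth_car neg car pos) carH scale0r.
  by rewrite (nth_pos neg car pos) posH.
have pos_eig k z : z \in lie_space D -> lieb H z = k.+1%:R *: z -> z \in <<pos>>%VS.
  rewrite -span_all => zD Hz; rewrite (coord_span zD); apply: rpred_sum => i _.
  have : coord b i z * (ev i - k.+1%:R) = 0.
    have /freeP bf := b_free; apply: (bf (fun i => coord b i z * (ev i - k.+1%:R))).
    transitivity (\sum_i coord b i z *: lieb H b`_i - k.+1%:R *: \sum_i coord b i z *: b`_i).
      rewrite scaler_sumr -sumrB; apply: eq_bigr => j _.
      by rewrite bH !scalerA -scalerBl mulrBr [k.+1%:R * _]mulrC.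
    rewrite -(coord_span zD); apply/eqP; rewrite subr_eq0 -Hz {2}(coord_span zD) lieb_sumr.
    by apply/eqP; apply: eq_bigr => j _; rewrite liebZr.
  move=> /eqP; rewrite mulf_eq0 => /orP[/eqP ->|]; first by rewrite scale0r mem0v.
  rewrite /ev subr_eq0; case: (split_ordP i) => j ->.
    by rewrite eq_sym => /eqP /natK_neq_opp.
  case: (split_ordP j) => l ->; first by rewrite eq_sym (negPf (char0 k)).
  by move=> _; apply: rpredZ; rewrite (nth_pos neg car pos) memv_span // mem_nth ?size_tuple.
have inD x : x \in cat_tuple car pos -> x \in lie_space D.
  by move=> xb; rewrite -span_all memv_span // mem_cat xb orbT.
have borE x : x \in cat_tuple car pos ->
    (x \in car /\ lieb H x = 0) \/ exists k : nat, lieb H x = k.+1%:R *: x.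
  rewrite mem_cat => /orP[xc|xp]; [left|right].
    split=> //; have := xc; rewrite -index_mem size_tuple => lt.
    by have := carH (Ordinal lt); rewrite [nth _ _ _]nth_index.
  have := xp; rewrite -index_mem size_tuple => lt; exists (kp (Ordinal lt)).
  by have := posH (Ordinal lt); rewrite [nth _ _ _]nth_index.
move=> x y xb yb; have xyD : lieb x y \in lie_space D by apply: lie_closed; apply: inD.
have [[xc xH]|[k kE]] := borE x xb; have [[yc yH]|[l lE]] := borE y yb.
- by rewrite car_comm // mem0v.
- apply: (pos_eig l) => //; rewrite lieb_jacobi xH lE liebZr.
  by rewrite lieb_anti lieb0r oppr0 add0r.
- by apply: (pos_eig k) => //; rewrite lieb_jacobi yH kE liebZl lieb0r addr0.
apply: (pos_eig (k + l).+1) => //; rewrite lieb_jacobi kE lE liebZl liebZr -scalerDl.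
by rewrite -natrD addSn addnS.
Qed.

End Grading.

(** * Bases of direct sums *)

Lemma sum_mword (V : zmodType) N (a : {ffun 'I_N -> nat}) (rho : 'I_N -> V) :
  \sum_(i <- mword a) rho i = \sum_i rho i *+ a i.
Proof.
have sum_cat (s1 s2 : seq 'I_N) :
    \sum_(i <- s1 ++ s2) rho i = \sum_(i <- s1) rho i + \sum_(i <- s2) rho i.
  exact: big_cat.
have sum_nil : \sum_(i <- [::] : seq 'I_N) rho i = 0 by rewrite big_nil.
rewrite /mword (big_morph (fun s : seq 'I_N => \sum_(i <- s) rho i) sum_cat sum_nil).
apply: eq_bigr => i _; elim: (a i) => [|k IH]; first by rewrite big_nil.
by rewrite big_cons IH mulrS.
Qed.

(** The weight of a monomial is obtained by adding the roots of its
    letters. *)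
Lemma act_zword (K : fieldType) n (D : borelData K n) (M : lieModule D) r
    (neg : r.-tuple 'M[K]_n) (rho : 'I_r -> K) x (c : K) (s : seq 'I_r) (v : M) :
  x \in lie_space D -> (forall i : 'I_r, neg`_i \in lie_space D) ->
  (forall i : 'I_r, lieb x neg`_i = rho i *: neg`_i) ->
  act_at x v = c *: v ->
  act_at x (zword (fun i : 'I_r => neg`_i) (fun=> 0) s v) =
    (c + \sum_(i <- s) rho i) *: zword (fun i : 'I_r => neg`_i) (fun=> 0) s v.
Proof.
move=> xD nD xn xv; elim: s => [|i s IH]; first by rewrite big_nil addr0.
rewrite big_cons [zword _ _ (i :: s) v]/= {1 2}/zact !scale0r !subr0.
set u := zword _ _ s v in IH *; rewrite -/(act_at neg`_i u) act_at_br // IH act_atZ.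
by rewrite xn act_atZl -scalerDl addrCA addrC.
Qed.

Section DirectSumBasis.
Variables (K : fieldType) (n : nat) (g : linLie K n) (I : Type) (V : I -> lieModule g).
Variables (A J : choiceType) (phi : J -> I) (B : forall i, A -> V i).
Hypothesis phi_inj : injective phi.
Hypothesis phi_surj : forall i, exists j, i = phi j.
Hypothesis B_basis : forall i, lin_basis (B i).

(** The summands have different types, so a vector is transported along the
    equality of indices. *)
Definition inj_fun (i : I) (v : V i) (i' : I) : V i' :=
  match pselect (i = i') with
  | left e => eq_rect i (fun k => V k) v i' e
  | right _ => 0
  end.

Lemma inj_fun_same i v : inj_fun (i := i) v i = v.
Proof. by rewrite /inj_fun; case: pselect => // e; rewrite (Prop_irrelevance e erefl). Qed.

Lemma inj_fun_other i i' v : i <> i' -> inj_fun (i := i) v i' = 0.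
Proof. by rewrite /inj_fun; case: pselect. Qed.

Lemma inj_fun_fin i v : finite_set [set i' | inj_fun (i := i) v i' != 0]%classic.
Proof.
apply: (sub_finite_set (B := [set i]%classic)); last exact: finite_set1.
by move=> i' /=; have [e //|ne] := pselect (i = i'); rewrite inj_fun_other ?eqxx.
Qed.

Lemma inj_funZ i a (v : V i) i' : inj_fun (a *: v) i' = a *: inj_fun v i'.
Proof.
have [<-|ne] := pselect (i = i'); first by rewrite !inj_fun_same.
by rewrite !inj_fun_other // scaler0.
Qed.

Definition ds_inj i (v : V i) : direct_sum V := Dsum (inj_fun_fin v).

Lemma ds_inj_lin i a (u v : V i) : ds_inj (a *: u + v) = a *: ds_inj u + ds_inj v.
Proof.
apply: dsumP => i'; rewrite dsumDE dsumZE /=.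
have [<-|ne] := pselect (i = i'); first by rewrite !inj_fun_same.
by rewrite !inj_fun_other // scaler0 addr0.
Qed.

Lemma ds_inj_act i x (v : V i) : lm_act x (ds_inj v) = ds_inj (lm_act x v).
Proof.
apply: dsumP => i' /=; have [<-|ne] := pselect (i = i'); first by rewrite !inj_fun_same.
by rewrite !inj_fun_other // lm_act0.
Qed.

Lemma ds_eigen i x a (v : V i) : lm_act x v = a *: v -> lm_act x (ds_inj v) = a *: ds_inj v.
Proof. by rewrite ds_inj_act => ->; apply: dsumP => i'; rewrite dsumZE /= inj_funZ. Qed.

Lemma ds_sumE (T : Type) (l : seq T) (F : T -> direct_sum V) i :
  (\sum_(t <- l) F t : direct_sum V) i = \sum_(t <- l) (F t) i.
Proof.
elim: l => [|t l IH]; first by rewrite !big_nil.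
by rewrite !big_cons -IH; exact: dsumDE.
Qed.

Definition ds_mon (x : A * J) : direct_sum V := ds_inj (B (phi x.2) x.1).

(** The surjection phi enumerates the summands. *)
Lemma ds_basis : lin_basis ds_mon.
Proof.
split=> [f|l k lU sum0].
  have fin : finite_set [set j | ds_fun f (phi j) != 0]%classic.
    apply: (@finite_preimage _ _ [set i | ds_fun f i != 0]%classic phi); last exact: ds_fin.
    by move=> x y _ _; apply: phi_inj.
  have /finite_seqP[s sE] := fin.
  have -> : f = \sum_(j <- undup s) ds_inj (ds_fun f (phi j)).
    apply: dsumP => i; rewrite ds_sumE; have [j ->] := phi_surj i.
    have [js|js] := boolP (j \in s).
      rewrite (bigD1_seq j) ?undup_uniq ?mem_undup //= inj_fun_same big1 ?addr0 // => j' jj'.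
      by rewrite inj_fun_other // => /phi_inj E; rewrite E eqxx in jj'.
    rewrite big_seq big1 => [|j' j's].
      apply/eqP/negPn/negP => fj; move: js; suff : [set` s]%classic j by move=> /= ->.
      by rewrite -sE.
    rewrite /= inj_fun_other // => /phi_inj E; move: j's; rewrite mem_undup E.
    by rewrite (negPf js).
  apply: lspan_sum => j.
  have := (B_basis (phi j)).1 (ds_fun f (phi j)).
  apply: (lspan_image (f := @ds_inj (phi j))) => [a u v|_ [a ->]].
    exact: ds_inj_lin.
  by apply: lspan_gen; exists (a, j).
move=> [a j] ajl.
pose l' := [seq x.1 | x <- l & x.2 == j].
have l'U : uniq l'.
  rewrite map_inj_in_uniq ?filter_uniq // => -[a1 j1] [a2 j2].
  by rewrite !mem_filter /= => /andP[/eqP -> _] /andP[/eqP -> _] ->.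
apply: ((B_basis (phi j)).2 l' (fun a => k (a, j)) l'U); last first.
  by apply/mapP; exists (a, j); rewrite ?mem_filter ?eqxx.
have sum0j : \sum_(x <- l) k x *: ds_fun (ds_mon x) (phi j) = 0.
  transitivity (ds_fun (\sum_(x <- l) k x *: ds_mon x) (phi j)); last by rewrite sum0.
  by rewrite ds_sumE; apply: eq_bigr => x _; rewrite dsumZE.
rewrite big_map big_filter.
rewrite -[RHS]sum0j [RHS](bigID (fun x => x.2 == j)) /= [X in _ = _ + X]big1 ?addr0.
  by apply: eq_bigr => -[a1 j1] /= /eqP ->; rewrite inj_fun_same.
move=> [a1 j1] /= j1j; rewrite inj_fun_other ?scaler0 // => /phi_inj E.
by rewrite E eqxx in j1j.
Qed.

End DirectSumBasis.

(** * Cartan elements and roots in coordinates *)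

Section Coordinates.
Variable K : fieldType.

(** The matrices of the setting over an arbitrary field. They agree by
    definition with those over the complex numbers. *)
Definition Eg (i j : nat) : 'M[K]_7 := delta_mx (inord i.-1) (inord j.-1).
Definition Hg (k : nat) : 'M[K]_7 := Eg k k - Eg (k + 3) (k + 3).
Definition Jg : 'M[K]_7 :=
  Eg 1 4 + Eg 4 1 + (Eg 2 5 + Eg 5 2) + (Eg 3 6 + Eg 6 3) + Eg 7 7.

Lemma EgE i j a b : (a < 7)%N -> (b < 7)%N -> (i.-1 < 7)%N -> (j.-1 < 7)%N ->
  Eg i j (inord a) (inord b) = ((a == i.-1) && (b == j.-1))%:R.
Proof. by move=> a7 b7 i7 j7; rewrite mxE -!val_eqE /= !inordK. Qed.

Lemma Eg_mul (i j k l : nat) : (j.-1 < 7)%N -> (k.-1 < 7)%N ->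
  Eg i j *m Eg k l = Eg i l *+ (j.-1 == k.-1).
Proof.
by move=> j7 k7; rewrite /Eg mul_delta_mx_cond -val_eqE /= !inordK.
Qed.

Lemma Jg_tr : Jg^T = Jg.
Proof.
have tE i j : (Eg i j)^T = Eg j i by rewrite /Eg trmx_delta.
by rewrite /Jg !linearD /= !tE [Eg 4 1 + _]addrC [Eg 5 2 + _]addrC [Eg 6 3 + _]addrC.
Qed.

Lemma JgK : Jg *m Jg = 1%:M.
Proof.
rewrite mx1_sum_delta.
have -> : \sum_(i < 7) delta_mx i i = \sum_(i < 7) Eg i.+1 i.+1 :> 'M[K]_7.
  by apply: eq_bigr => i _; rewrite /Eg /= inord_val.
rewrite !big_ord_recl big_ord0 /= /bump /= /Jg.
rewrite !mulmxDl !mulmxDr !Eg_mul //= !(mulr0n, mulr1n, addr0, add0r) !addrA.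
rewrite -!addrA; congr (_ + _).
rewrite addrCA; congr (_ + _); rewrite !(addn0, add1n).
by rewrite [X in Eg 4 4 + X = _]addrCA [LHS]addrCA.
Qed.

(** The element of the Cartan subalgebra of so(7) whose values under the
    coordinate forms are c1, c2 and c3. It lies in the Cartan subalgebra of G2
    exactly when c1 = c2 + c3. *)
Definition hc (c1 c2 c3 : K) : 'M[K]_7 := c1 *: Hg 1 + c2 *: Hg 2 + c3 *: Hg 3.

Lemma hcD a b c a' b' c' : hc a b c + hc a' b' c' = hc (a + a') (b + b') (c + c').
Proof. by rewrite /hc !scalerDl [LHS]addrACA; congr (_ + _); exact: addrACA. Qed.

Lemma hcZ k a b c : k *: hc a b c = hc (k * a) (k * b) (k * c).
Proof. by rewrite /hc !scalerDr !scalerA. Qed.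

Lemma Hd1E : Hg 1 = hc 1 0 0. Proof. by rewrite /hc !scale0r !addr0 scale1r. Qed.
Lemma Hd2E : Hg 2 = hc 0 1 0. Proof. by rewrite /hc !scale0r addr0 add0r scale1r. Qed.
Lemma Hd3E : Hg 3 = hc 0 0 1. Proof. by rewrite /hc !scale0r !add0r scale1r. Qed.

Definition Ha1 := Hg 1 - Hg 2 + Hg 3 *+ 2.
Definition Ha2 := Hg 2 - Hg 3.

Lemma Ha1E : Ha1 = hc 1 (-1) 2.
Proof.
rewrite /Ha1 Hd1E Hd2E Hd3E -scaleN1r -scaler_nat !hcZ !hcD.
by congr hc; ring.
Qed.

Lemma Ha2E : Ha2 = hc 0 1 (-1).
Proof. by rewrite /Ha2 Hd2E Hd3E -scaleN1r !hcZ !hcD; congr hc; ring. Qed.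

Lemma H31E : Hg 1 + Hg 3 = hc 1 0 1.
Proof. by rewrite Hd1E Hd3E !hcD; congr hc; ring. Qed.

Lemma H32E : Hg 1 + Hg 2 = hc 1 1 0.
Proof. by rewrite Hd1E Hd2E !hcD; congr hc; ring. Qed.

Lemma h_so7P x : x \in <<[:: Hg 1; Hg 2; Hg 3]>>%VS -> exists c1 c2 c3, x = hc c1 c2 c3.
Proof.
rewrite !span_cons span_nil addv0.
move=> /memv_addP[_ /vlineP[c1 ->] [_ /memv_addP[_ /vlineP[c2 ->] [_ /vlineP[c3 ->] ->]] ->]].
by exists c1, c2, c3; rewrite /hc addrA.
Qed.

Lemma hc_so7 a b c : hc a b c \in <<[:: Hg 1; Hg 2; Hg 3]>>%VS.
Proof.
rewrite /hc; do 2?apply: rpredD; apply: rpredZ; apply: memv_span; by rewrite !inE eqxx ?orbT.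
Qed.

Lemma h_g2P x : x \in <<[:: Ha1; Ha2]>>%VS -> exists c2 c3, x = hc (c2 + c3) c2 c3.
Proof.
rewrite !span_cons span_nil addv0.
move=> /memv_addP[_ /vlineP[a ->] [_ /vlineP[b ->] ->]].
exists (b - a), (a * 2 - b); rewrite Ha1E Ha2E !hcZ hcD.
by congr hc; ring.
Qed.

Lemma hc_g2 a b : hc (a + b) a b \in <<[:: Ha1; Ha2]>>%VS.
Proof.
have -> : hc (a + b) a b = (a + b) *: Ha1 + (a *+ 2 + b) *: Ha2.
  by rewrite Ha1E Ha2E !hcZ hcD; congr hc; ring.
by apply: rpredD; apply: rpredZ; apply: memv_span; rewrite !inE eqxx ?orbT.
Qed.

Lemma hc_comm a b c a' b' c' : lieb (hc a b c) (hc a' b' c') = 0.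
Proof.
have HH k l : (0 < k <= 3)%N -> (0 < l <= 3)%N -> lieb (Hg k) (Hg l) = 0.
  case: k => [|[|[|[|//]]]] // _; case: l => [|[|[|[|//]]]] // _;
  by rewrite /lieb /Hg !mulmxBl !mulmxBr !Eg_mul //= !(mulr0n, mulr1n, subr0, sub0r, subrr, opprK) ?subrr.
by rewrite /hc !liebDl !liebDr !liebZl !liebZr !HH // !scaler0 !addr0.
Qed.

Lemma epsE k j : (j < 3)%N -> (k.-1 < 3)%N -> (eps k) 0 (inord j) = (j == k.-1)%:R.
Proof. by move=> j3 k3; rewrite /eps mxE -!val_eqE /= !inordK. Qed.

Definition diag_at (k : nat) (x : 'M[K]_7) : K := x (inord k) (inord k).

Lemma diag_hc c1 c2 c3 :
  [/\ diag_at 0 (hc c1 c2 c3) = c1, diag_at 1 (hc c1 c2 c3) = c2 &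
      diag_at 2 (hc c1 c2 c3) = c3].
Proof.
have d i k : (i < 3)%N -> (0 < k <= 3)%N -> Hg k (inord i) (inord i) = (i == k.-1)%:R.
  have sE (A B : 'M[K]_7) : (A - B) (inord i) (inord i) = A (inord i) (inord i) - B (inord i) (inord i).
    by rewrite !mxE.
  move=> i3; have i7 : (i < 7)%N by apply: ltn_trans i3 _.
  by rewrite /Hg sE; case: k => [|[|[|[|//]]]] // _; rewrite !EgE //;
    case: i i3 {i7 sE} => [|[|[|//]]] // _; rewrite ?subr0 ?subrr.
have e i : (i < 3)%N -> diag_at i (hc c1 c2 c3) =
    c1 * (i == 0)%:R + c2 * (i == 1)%:R + c3 * (i == 2)%:R.
  move=> i3; rewrite /diag_at /hc.
  have -> (A B : 'M[K]_7) : (A + B) (inord i) (inord i) = A (inord i) (inord i) + B (inord i) (inord i).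
    by rewrite mxE.
  have -> (A B : 'M[K]_7) : (A + B) (inord i) (inord i) = A (inord i) (inord i) + B (inord i) (inord i).
    by rewrite mxE.
  have z a (A : 'M[K]_7) : (a *: A) (inord i) (inord i) = a * A (inord i) (inord i).
    by rewrite mxE.
  by rewrite !z !d.
by split; rewrite e //=; ring.
Qed.

Lemma hc_inj a b c : hc a b c = 0 -> [/\ a = 0, b = 0 & c = 0].
Proof.
have [da db dc] := diag_hc a b c => h0.
by split; [rewrite -da|rewrite -db|rewrite -dc]; rewrite h0 /diag_at mxE.
Qed.

Lemma car_so7_free : free [:: Hg 1; Hg 2; Hg 3].
Proof.
apply/(@freeP _ _ 3 [tuple Hg 1; Hg 2; Hg 3]) => k.
rewrite !big_ord_recl big_ord0 addr0 /= addrA => /hc_inj[a b c] i.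
by case: i => [[|[|[|//]]] lt]; [rewrite -[RHS]a|rewrite -[RHS]b|rewrite -[RHS]c]; congr k; apply: val_inj.
Qed.

Lemma car_g2_free : free [:: Ha1; Ha2].
Proof.
apply/(@freeP _ _ 2 [tuple Ha1; Ha2]) => k.
rewrite !big_ord_recl big_ord0 addr0 /= Ha1E Ha2E !hcZ hcD => /hc_inj[a b c] i.
have k0 : k ord0 = 0 by move: a; rewrite mulr1 mulr0 addr0.
move: b; rewrite k0 mul0r add0r mulr1 => b.
by case: i => [[|[|//]] lt]; [rewrite -[RHS]k0|rewrite -[RHS]b]; congr k; apply: val_inj.
Qed.

(** The value at hc c1 c2 c3 of the root with integral coordinates r. *)
Definition rv (r : 'rV[int]_3) (c1 c2 c3 : K) : K :=
  (r 0 (inord 0))%:~R * c1 + (r 0 (inord 1))%:~R * c2 + (r 0 (inord 2))%:~R * c3.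

Variable X : 'rV[int]_3 -> 'M[K]_7.
Hypothesis X_root : forall r, r \in so7_roots -> forall k, (0 < k <= 3)%N ->
      lieb (Hg k) (X r) = (r 0 (inord k.-1))%:~R *: X r.

Lemma lieb_hc r a b c : r \in so7_roots -> lieb (hc a b c) (X r) = rv r a b c *: X r.
Proof.
move=> rr; rewrite /hc !liebDl !liebZl !X_root //= !scalerA -!scalerDl /rv.
by congr (_ *: _); ring.
Qed.

End Coordinates.

(** * Root vectors of so(7) and of its subalgebra of type G2 *)

Local Notation e1 := (eps 1).
Local Notation e2 := (eps 2).
Local Notation e3 := (eps 3).

(** The first six roots restrict to the positive roots of G2, and the last
    three restrict again to the short ones, in the same order as the entries
    3, 4 and 5. *)
Definition pos_roots9 : seq 'rV[int]_3 :=
  [:: e2 - e3; e1 + e3; e1 + e2; e3; e2; e1; e1 - e2; e1 - e3; e2 + e3].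

Definition neg_roots9 : seq 'rV[int]_3 :=
  [:: e3 - e2; - e1 - e3; - e1 - e2; - e3; - e2; - e1; e2 - e1; e3 - e1; - e2 - e3].

Lemma neg_roots9E : neg_roots9 = [seq - r | r <- pos_roots9].
Proof. by rewrite /= !opprB !opprD. Qed.

Lemma pos_roots9_sub : {subset pos_roots9 <= so7_pos}.
Proof.
have -> : pos_roots9 = [seq so7_pos`_i | i <- [:: 2; 4; 3; 8; 7; 6; 0; 1; 5]%N] by [].
move=> _ /mapP[i i9 ->]; apply: mem_nth; move: i i9; exact/allP.
Qed.

Lemma so7_pos_sub : {subset so7_pos <= so7_roots}.
Proof. by move=> r; rewrite mem_cat => ->. Qed.

Lemma pos_root i : (i < 9)%N -> pos_roots9`_i \in so7_roots.
Proof. by move=> i9; apply/so7_pos_sub/pos_roots9_sub/mem_nth. Qed.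

Lemma neg_root i : (i < 9)%N -> neg_roots9`_i \in so7_roots.
Proof.
move=> i9; rewrite mem_cat; apply/orP; right; rewrite neg_roots9E (nth_map 0) //.
by apply: map_f; apply: pos_roots9_sub; apply: mem_nth.
Qed.

Section RootVectors.
Variable K : fieldType.
Hypothesis char0 : forall k : nat, k.+1%:R != 0 :> K.

Lemma rvD r r' (a b c : K) : rv (r + r') a b c = rv r a b c + rv r' a b c.
Proof.
have E (j : 'I_3) : (r + r') 0 j = r 0 j + r' 0 j by rewrite mxE.
by rewrite /rv !E !intrD; ring.
Qed.

Lemma rvN r (a b c : K) : rv (- r) a b c = - rv r a b c.
Proof.
have E (j : 'I_3) : (- r) 0 j = - r 0 j by rewrite mxE.
by rewrite /rv !E !mulrNz; ring.
Qed.

Lemma rv1 (a b c : K) : rv e1 a b c = a. Proof. by rewrite /rv !epsE //=; ring. Qed.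
Lemma rv2 (a b c : K) : rv e2 a b c = b. Proof. by rewrite /rv !epsE //=; ring. Qed.
Lemma rv3 (a b c : K) : rv e3 a b c = c. Proof. by rewrite /rv !epsE //=; ring. Qed.

Definition rv_val := (rvD, rvN, rv1, rv2, rv3).

Variable X : 'rV[int]_3 -> 'M[K]_7.
Hypothesis X_root : forall r, r \in so7_roots -> forall k, (0 < k <= 3)%N ->
      lieb (Hg K k) (X r) = (r 0 (inord k.-1))%:~R *: X r.
Hypothesis X_neq0 : forall r, r \in so7_roots -> X r != 0.

(** The negative roots are listed in the order that matches their
    restrictions; the order of the positive ones is that of the definition of
    the nilradical. *)
Definition neg9 : 9.-tuple 'M[K]_7 := @Tuple 9 _ (map X neg_roots9) isT.
Definition pos9 : 9.-tuple 'M[K]_7 := @Tuple 9 _ (map X so7_pos) isT.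
Definition car3 : 3.-tuple 'M[K]_7 := [tuple Hg K 1; Hg K 2; Hg K 3].

Definition pos6 : 6.-tuple 'M[K]_7 :=
  [tuple X (e2 - e3); - X (e1 + e3); - X (e1 + e2);
      X e3 + X (e1 - e2); X e2 - X (e1 - e3); - X e1 - X (e2 + e3)].

Definition neg6 : 6.-tuple 'M[K]_7 :=
  [tuple X (e3 - e2); X (- e1 - e3); X (- e1 - e2);
      X (- e3) + X (e2 - e1); X (- e2) - X (e3 - e1); - X (- e1) - X (- e2 - e3)].

Definition car2 : 2.-tuple 'M[K]_7 := [tuple Ha1 K; Ha2 K].

Lemma neg9E (i : 'I_9) : neg9`_i = X neg_roots9`_i.
Proof. by rewrite /neg9 /= -[LHS]/((map X neg_roots9)`_i) (nth_map 0). Qed.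

Lemma lieb_neg9 a b c (i : 'I_9) :
  lieb (hc a b c) neg9`_i = rv neg_roots9`_i a b c *: neg9`_i.
Proof. by rewrite neg9E (lieb_hc X_root) // neg_root. Qed.

Lemma lieb_pos9 a b c (i : 'I_9) :
  lieb (hc a b c) pos9`_i = rv so7_pos`_i a b c *: pos9`_i.
Proof.
rewrite /pos9 -[(tval _)`_i]/((map X so7_pos)`_i) (nth_map 0) //.
by rewrite (lieb_hc X_root) //; apply/so7_pos_sub/mem_nth.
Qed.

Lemma X_rv r s a b c : r \in so7_roots -> rv r a b c = rv s a b c ->
  lieb (hc a b c) (X r) = rv s a b c *: X r.
Proof. by move=> rr <-; rewrite (lieb_hc X_root). Qed.

(** The short root vectors are sums of two root vectors of so(7) whose roots
    coincide on the Cartan subalgebra of G2. *)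
Lemma lieb_neg6 b c (i : 'I_6) :
  lieb (hc (b + c) b c) neg6`_i = rv neg_roots9`_i (b + c) b c *: neg6`_i.
Proof.
have N k : (k < 9)%N -> neg_roots9`_k \in so7_roots := @neg_root k.
case: i => [[|[|[|[|[|[|//]]]]]] lt] /=.
- exact: X_rv (N 0%N isT) erefl.
- exact: X_rv (N 1%N isT) erefl.
- exact: X_rv (N 2%N isT) erefl.
- rewrite liebDr scalerDr (X_rv (N 3%N isT) erefl); congr (_ + _).
  by apply: X_rv (N 6%N isT) _; rewrite !rv_val; ring.
- rewrite liebDr scalerDr liebNr scalerN (X_rv (N 4%N isT) erefl); congr (_ - _).
  by apply: X_rv (N 7%N isT) _; rewrite !rv_val; ring.
- rewrite liebDr scalerDr !liebNr !scalerN (X_rv (N 5%N isT) erefl); congr (- _ - _).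
  by apply: X_rv (N 8%N isT) _; rewrite !rv_val; ring.
Qed.

Lemma lieb_pos6 b c (i : 'I_6) :
  lieb (hc (b + c) b c) pos6`_i = rv pos_roots9`_i (b + c) b c *: pos6`_i.
Proof.
have N k : (k < 9)%N -> pos_roots9`_k \in so7_roots := @pos_root k.
case: i => [[|[|[|[|[|[|//]]]]]] lt] /=.
- exact: X_rv (N 0%N isT) erefl.
- by rewrite liebNr scalerN; congr (- _); apply: X_rv (N 1%N isT) erefl.
- by rewrite liebNr scalerN; congr (- _); apply: X_rv (N 2%N isT) erefl.
- rewrite liebDr scalerDr (X_rv (N 3%N isT) erefl); congr (_ + _).
  by apply: X_rv (N 6%N isT) _; rewrite !rv_val; ring.
- rewrite liebDr scalerDr liebNr scalerN (X_rv (N 4%N isT) erefl); congr (_ - _).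
  by apply: X_rv (N 7%N isT) _; rewrite !rv_val; ring.
- rewrite liebDr scalerDr !liebNr !scalerN (X_rv (N 5%N isT) erefl); congr (- _ - _).
  by apply: X_rv (N 8%N isT) _; rewrite !rv_val; ring.
Qed.

(** The coordinates 9, 3, 1 are chosen such that the nine positive roots take
    distinct positive values; kneg9 and kpos9 list the predecessors of these
    values, in the order of the negative and of the positive root vectors. *)
Definition kneg9 (i : 'I_9) : nat := nth 0%N [:: 1; 9; 11; 0; 2; 8; 5; 7; 3]%N i.
Definition kpos9 (i : 'I_9) : nat := nth 0%N [:: 5; 7; 1; 11; 9; 3; 8; 2; 0]%N i.
(** The same for G2, with the element hc 5 4 1 of its Cartan subalgebra. *)
Definition k6 (i : 'I_6) : nat := nth 0%N [:: 2; 5; 8; 0; 3; 4]%N i.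

Lemma nth_uniq_inj N (s : seq nat) : size s = N -> uniq s ->
  injective (fun i : 'I_N => nth 0%N s i).
Proof.
move=> sN sU i j /eqP; rewrite nth_uniq ?sN // => /eqP ij; exact: val_inj.
Qed.

Lemma kneg9_inj : injective kneg9. Proof. exact: nth_uniq_inj. Qed.
Lemma kpos9_inj : injective kpos9. Proof. exact: nth_uniq_inj. Qed.
Lemma k6_inj : injective k6. Proof. exact: nth_uniq_inj. Qed.

Lemma neg9_eig (i : 'I_9) : lieb (hc 9 3 1) neg9`_i = - (kneg9 i).+1%:R *: neg9`_i.
Proof.
rewrite lieb_neg9; congr (_ *: _).
by case: i => [[|[|[|[|[|[|[|[|[|//]]]]]]]]] lt] /=; rewrite !rv_val /kneg9 /=; ring.
Qed.

Lemma pos9_eig (i : 'I_9) : lieb (hc 9 3 1) pos9`_i = (kpos9 i).+1%:R *: pos9`_i.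
Proof.
rewrite lieb_pos9; congr (_ *: _).
by case: i => [[|[|[|[|[|[|[|[|[|//]]]]]]]]] lt] /=; rewrite !rv_val /kpos9 /=; ring.
Qed.

Lemma neg6_eig (i : 'I_6) : lieb (hc 5 4 1) neg6`_i = - (k6 i).+1%:R *: neg6`_i.
Proof.
have -> : hc (5 : K) 4 1 = hc (4 + 1) 4 1 by congr hc; ring.
rewrite lieb_neg6; congr (_ *: _).
by case: i => [[|[|[|[|[|[|//]]]]]] lt] /=; rewrite !rv_val /k6 /=; ring.
Qed.

Lemma pos6_eig (i : 'I_6) : lieb (hc 5 4 1) pos6`_i = (k6 i).+1%:R *: pos6`_i.
Proof.
have -> : hc (5 : K) 4 1 = hc (4 + 1) 4 1 by congr hc; ring.
rewrite lieb_pos6; congr (_ *: _).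
by case: i => [[|[|[|[|[|[|//]]]]]] lt] /=; rewrite !rv_val /k6 /=; ring.
Qed.

Lemma neg9_neq0 (i : 'I_9) : neg9`_i != 0.
Proof. by rewrite neg9E X_neq0 // neg_root. Qed.

Lemma pos9_neq0 (i : 'I_9) : pos9`_i != 0.
Proof.
rewrite /pos9 -[(tval _)`_i]/((map X so7_pos)`_i) (nth_map 0) //.
by apply: X_neq0; apply/so7_pos_sub/mem_nth.
Qed.

(** A Cartan element on which only one of the two roots vanishes sends the sum
    to a non-zero multiple of one root vector. *)
Lemma X_sum_neq0 r s e a b c : r \in so7_roots -> s \in so7_roots ->
  rv r a b c != 0 :> K -> rv s a b c = 0 -> X r + e *: X s != 0.
Proof.
move=> rr ss r0 s0; apply: contra_neq (X_neq0 rr) => E; apply: (scalerI r0).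
rewrite scaler0 -(lieb_hc X_root) // -[RHS](lieb0r (hc a b c)) -E liebDr liebZr.
by rewrite (lieb_hc X_root _ _ _ ss) s0 scale0r scaler0 addr0.
Qed.

Lemma neg6_neq0 (i : 'I_6) : neg6`_i != 0.
Proof.
have N k : (k < 9)%N -> neg_roots9`_k \in so7_roots := @neg_root k.
case: i => [[|[|[|[|[|[|//]]]]]] lt] /=.
- exact: X_neq0 (N 0%N isT).
- exact: X_neq0 (N 1%N isT).
- exact: X_neq0 (N 2%N isT).
- rewrite -[X (e2 - e1)]scale1r; apply: (X_sum_neq0 (a := 0) (b := 0) (c := 1) _ (N 3%N isT) (N 6%N isT));
    rewrite !rv_val ?oppr_eq0 ?oner_eq0 //; ring.
- rewrite -[- X (e3 - e1)]scaleN1r; apply: (X_sum_neq0 (a := 0) (b := 1) (c := 0) _ (N 4%N isT) (N 7%N isT));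
    rewrite !rv_val ?oppr_eq0 ?oner_eq0 //; ring.
- rewrite -opprD oppr_eq0 -[X (- e2 - e3)]scale1r.
  apply: (X_sum_neq0 (a := 1) (b := 0) (c := 0) _ (N 5%N isT) (N 8%N isT));
    rewrite !rv_val ?oppr_eq0 ?oner_eq0 //; ring.
Qed.

Lemma pos6_neq0 (i : 'I_6) : pos6`_i != 0.
Proof.
have N k : (k < 9)%N -> pos_roots9`_k \in so7_roots := @pos_root k.
case: i => [[|[|[|[|[|[|//]]]]]] lt] /=; rewrite ?oppr_eq0.
- exact: X_neq0 (N 0%N isT).
- exact: X_neq0 (N 1%N isT).
- exact: X_neq0 (N 2%N isT).
- rewrite -[X (e1 - e2)]scale1r; apply: (X_sum_neq0 (a := 0) (b := 0) (c := 1) _ (N 3%N isT) (N 6%N isT));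
    rewrite !rv_val ?oppr_eq0 ?oner_eq0 //; ring.
- rewrite -[- X (e1 - e3)]scaleN1r; apply: (X_sum_neq0 (a := 0) (b := 1) (c := 0) _ (N 4%N isT) (N 7%N isT));
    rewrite !rv_val ?oppr_eq0 ?oner_eq0 //; ring.
- rewrite -opprD oppr_eq0 -[X (e2 + e3)]scale1r.
  apply: (X_sum_neq0 (a := 1) (b := 0) (c := 0) _ (N 5%N isT) (N 8%N isT));
    rewrite !rv_val ?oppr_eq0 ?oner_eq0 //; ring.
Qed.

Section Dimension.
Variable L : {vspace 'M[K]_7}.
Hypothesis LP : forall A, A \in L -> A^T *m Jg K + Jg K *m A = 0.
Hypothesis HL : forall k, (0 < k <= 3)%N -> Hg K k \in L.
Hypothesis XL : forall r, r \in so7_roots -> X r \in L.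

Let idx : seq (nat * nat) := [seq (i, j) | i <- iota 0 7, j <- iota i.+1 (6 - i)].

Let phi (A : 'M[K]_7) : 'rV[K]_21 :=
  \row_k (Jg K *m A) (inord (nth (0%N, 0%N) idx k).1) (inord (nth (0%N, 0%N) idx k).2).

Let phi_lin : linear phi.
Proof. by move=> a A B; apply/rowP => k; rewrite mxE mulmxDr -scalemxAr !mxE. Qed.

Let phi_inj A : A \in L -> phi A = 0 -> A = 0.
Proof.
move=> /LP AL phi0; pose B := Jg K *m A.
have BT i j : B i j = - B j i.
  have BtE : B^T = - B.
    by apply/eqP; rewrite -addr_eq0 /B trmx_mul Jg_tr AL.
  by move/matrixP/(_ j i): BtE; rewrite [B^T j i]mxE [(- B) j i]mxE.
have up (i j : 'I_7) : (i < j)%N -> B i j = 0.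
  move=> ij; have ix : (val i, val j) \in idx.
    apply/allpairsPdep; exists (val i), (val j); rewrite !mem_iota ltn_ord ij /=; split=> //.
    by rewrite addSn subnKC // -ltnS ltn_ord.
  have k21 : (index (val i, val j) idx < 21)%N.
    by rewrite -index_mem in ix.
  by move/rowP/(_ (Ordinal k21)): phi0; rewrite !mxE /= nth_index //= !inord_val.
have B0 : B = 0.
  apply/matrixP => i j; rewrite [RHS]mxE; case: (ltngtP i j) => [/up //|ji|/val_inj <-].
    by rewrite BT up // oppr0.
  have := BT i i => /eqP; rewrite -addr_eq0 -mulr2n -mulr_natr mulf_eq0 (negPf (char0 1)) orbF.
  by move/eqP.
by rewrite -[A]mul1mx -(JgK K) -mulmxA -/B B0 mulmx0.
Qed.

(** A matrix A is skew-adjoint when Jg A is skew-symmetric, and a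
    skew-symmetric matrix of size 7 is given by its 21 entries above the
    diagonal. *)
Lemma so7_dim : (\dim L <= 21)%N.
Proof.
pose f : {linear 'M[K]_7 -> 'rV[K]_21} := HB.pack phi (GRing.isLinear.Build K _ _ _ phi phi_lin).
have ker0 : (L :&: lker (linfun f))%VS = 0%VS.
  apply/eqP; rewrite -subv0; apply/subvP => A; rewrite memv_cap memv_ker lfunE memv0.
  by move=> /andP[AL /eqP/(phi_inj AL) ->].
rewrite -(limg_dim_eq ker0); apply: leq_trans (dimvS (subvf _)) _.
by rewrite dimvf /dim /= mul1n.
Qed.

Lemma so7_free : free (cat_tuple neg9 (cat_tuple car3 pos9)).
Proof.
apply: (graded_free char0 (H := hc 9 3 1) (kn := kneg9) (kp := kpos9)).
- exact: neg9_neq0.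
- exact: pos9_neq0.
- exact: kneg9_inj.
- exact: kpos9_inj.
- exact: neg9_eig.
- exact: pos9_eig.
- move=> i; case: i => [[|[|[|//]]] lt] /=; rewrite ?Hd1E ?Hd2E ?Hd3E; exact: hc_comm.
- exact: car_so7_free.
Qed.

(** The root vectors and the Cartan elements are 21 independent elements. *)
Lemma so7_span : <<cat_tuple neg9 (cat_tuple car3 pos9)>>%VS = L.
Proof.
apply/eqP; rewrite eqEdim; apply/andP; split.
  apply/span_subvP => A; rewrite !mem_cat => /or3P[/mapP[r rn ->]||/mapP[r rp ->]].
  - by apply: XL; move: rn => /(nthP 0)[i i9 <-]; apply: neg_root.
  - by rewrite !inE => /or3P[] /eqP ->; apply: HL.
  - by apply: XL; apply: so7_pos_sub.
by move: so7_free; rewrite /free => /eqP ->; apply: so7_dim.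
Qed.

End Dimension.
End RootVectors.

(** * Comparison of the two weight bases *)

Lemma lin_basis_reindex (K : fieldType) (V : lmodType K) (T U : eqType)
    (E : U -> V) (f : T -> U) (f' : U -> T) :
  cancel f f' -> cancel f' f -> lin_basis E -> lin_basis (fun t => E (f t)).
Proof.
move=> fK f'K [sp fr]; split=> [x|l k lU sum0 t tl].
  by apply: (lspan_sub _ (sp x)) => _ [u ->]; apply: lspan_gen; exists (f' u); rewrite f'K.
rewrite -[t]fK; apply: (fr (map f l) (fun u => k (f' u))).
- by rewrite (map_inj_uniq (can_inj fK)).
- by rewrite big_map -[RHS]sum0; apply: eq_bigr => u _; rewrite fK.
- exact: map_f.
Qed.

Section RootForms.
Variable K : fieldType.

(** Roots are extended to all matrices through the first three diagonal
    entries, so that they restrict to both Cartan subalgebras. *)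
Definition root_form (r : 'rV[int]_3) (x : 'M[K]_7) : K^o :=
  rv r (diag_at 0 x) (diag_at 1 x) (diag_at 2 x).

Lemma root_form_lin r : linear (root_form r).
Proof.
have d k a (x y : 'M[K]_7) : diag_at k (a *: x + y) = a * diag_at k x + diag_at k y.
  by rewrite /diag_at !mxE.
move=> a x y; rewrite /root_form /rv !d /GRing.scale /=; ring.
Qed.

HB.instance Definition _ r := GRing.isLinear.Build K 'M[K]_7 K^o *:%R (root_form r) (root_form_lin r).

Definition root_wt (h : {vspace 'M[K]_7}) (r : 'rV[int]_3) : hdual h :=
  linfun (root_form r \o vsval).

Lemma root_wtE (h : {vspace 'M[K]_7}) r x : x \in h -> wt_at (root_wt h r) x = root_form r x.
Proof. by move=> hx; rewrite /wt_at lfunE /= vsprojK. Qed.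

Lemma root_form_hc r a b c : root_form r (hc a b c) = rv r a b c.
Proof. by rewrite /root_form; have [-> -> ->] := diag_hc a b c. Qed.

(** The highest weights of the summands, and the weights of the monomials, are
    of this form. *)
Definition shifted_wt (h' h : {vspace 'M[K]_7}) (lambda : hdual h') N
    (r : 'I_N -> 'rV[int]_3) (a : 'I_N -> nat) : hdual h :=
  hdual_res h lambda + \sum_(i < N) root_wt h (r i) *+ a i.

Lemma shifted_wtE (h' h : {vspace 'M[K]_7}) (lambda : hdual h') N (r : 'I_N -> 'rV[int]_3) a x : x \in h ->
  wt_at (shifted_wt h lambda r a) x = wt_at lambda x + \sum_(i < N) root_form (r i) x *+ a i.
Proof.
move=> hx; rewrite /wt_at /shifted_wt add_lfunE hdual_resE vsprojK // sum_lfunE.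
congr (_ + _); apply: eq_bigr => i _.
have -> (f : hdual h) m u : (f *+ m) u = f u *+ m.
  by elim: m => [|m IH]; rewrite ?mulr0n ?lfunE // !mulrS add_lfunE IH.
congr (_ *+ _); exact: root_wtE.
Qed.

End RootForms.

Section Branching.
Variable K : fieldType.
Hypothesis char0 : forall k : nat, k.+1%:R != 0 :> K.
Variable X : 'rV[int]_3 -> 'M[K]_7.
Hypothesis X_root : forall r, r \in so7_roots -> forall k, (0 < k <= 3)%N ->
      lieb (Hg K k) (X r) = (r 0 (inord k.-1))%:~R *: X r.
Hypothesis X_neq0 : forall r, r \in so7_roots -> X r != 0.

Variables D D' : borelData K 7.
Hypothesis D_span : <<cat_tuple (neg6 X) (cat_tuple (car2 K) (pos6 X))>>%VS = lie_space D.
Hypothesis D_car : <<car2 K>>%VS = bd_cartan D.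
Hypothesis D_pos : <<pos6 X>>%VS = bd_nil D.
Hypothesis D'_so7 : forall A, A \in lie_space D' -> A^T *m Jg K + Jg K *m A = 0.
Hypothesis D'_X : forall r, r \in so7_roots -> X r \in lie_space D'.
Hypothesis D'_car : <<car3 K>>%VS = bd_cartan D'.
Hypothesis D'_pos : <<pos9 X>>%VS = bd_nil D'.
Hypothesis sub : (lie_space D <= lie_space D')%VS.

Lemma tri_so7 : triangular D' (neg9 X) (car3 K) (pos9 X).
Proof.
have HL k : (0 < k <= 3)%N -> Hg K k \in lie_space D'.
  move=> k3; apply: h_sub; rewrite -D'_car; apply: memv_span.
  by case: k k3 => [|[|[|[|//]]]] // _; rewrite !inE eqxx ?orbT.
apply: (triangular_of_grading char0 (H := hc 9 3 1) (kn := kneg9) (kp := kpos9)) => //.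
- exact: neg9_neq0.
- exact: pos9_neq0.
- exact: kneg9_inj.
- exact: kpos9_inj.
- exact: neg9_eig.
- exact: pos9_eig.
- move=> i; case: i => [[|[|[|//]]] lt] /=; rewrite ?Hd1E ?Hd2E ?Hd3E; exact: hc_comm.
- exact: car_so7_free.
- exact: so7_span.
- move=> x y /memv_span xc /memv_span yc.
  have [a [b [c ->]]] := h_so7P xc; have [a' [b' [c' ->]]] := h_so7P yc.
  exact: hc_comm.
Qed.

Lemma tri_g2 : triangular D (neg6 X) (car2 K) (pos6 X).
Proof.
apply: (triangular_of_grading char0 (H := hc 5 4 1) (kn := k6) (kp := k6)) => //.
- exact: neg6_neq0.
- exact: pos6_neq0.
- exact: k6_inj.
- exact: k6_inj.
- exact: neg6_eig.
- exact: pos6_eig.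
- move=> i; case: i => [[|[|//]] lt] /=; rewrite ?Ha1E ?Ha2E; exact: hc_comm.
- exact: car_g2_free.
- move=> x y /memv_span xc /memv_span yc.
  have [b [c ->]] := h_g2P xc; have [b' [c' ->]] := h_g2P yc.
  exact: hc_comm.
Qed.

(** An element of the Cartan subalgebra of G2 on which the simple roots of
    so(7), hence those of G2, all take the value 1. *)
Definition rho : 'M[K]_7 := hc 3 2 1.

Lemma rho_h : rho \in bd_cartan D.
Proof.
by rewrite -D_car (_ : rho = hc (2 + 1) 2 1) ?hc_g2 //; congr hc; ring.
Qed.

Let nrt (i : 'I_6) : hdual (bd_cartan D) := root_wt _ neg_roots9`_i.
Let prt (i : 'I_6) : hdual (bd_cartan D) := root_wt _ pos_roots9`_i.

Lemma neg6_root (i : 'I_6) x : x \in bd_cartan D ->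
  lieb x (neg6 X)`_i = root_form neg_roots9`_i x *: (neg6 X)`_i.
Proof.
by rewrite -D_car => /h_g2P[b [c ->]]; rewrite root_form_hc lieb_neg6.
Qed.

Lemma neg6_D (i : 'I_6) : (neg6 X)`_i \in lie_space D.
Proof. by rewrite -D_span memv_span // mem_cat mem_nth ?size_tuple. Qed.

(** The heights of the roots of so(7), in the order of the lists above. *)
Definition height9 (i : nat) : nat := nth 0%N [:: 1; 4; 5; 1; 2; 3; 1; 2; 3]%N i.

Lemma height_root (i : 'I_9) : root_form neg_roots9`_i rho = - (height9 i)%:R.
Proof.
rewrite root_form_hc.
by case: i => [[|[|[|[|[|[|[|[|[|//]]]]]]]]] lt] /=; rewrite !rv_val /height9 /=; ring.
Qed.

Lemma g2_graded : graded (neg6 X) (pos6 X) rho nrt prt.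
Proof.
split.
- rewrite -D_span -D_car -D_pos -!span_cat; apply: sub_span => x.
  by rewrite !mem_cat.
- exact: neg6_D.
- exact: D_pos.
- exact: rho_h.
- by move=> i x hx; rewrite root_wtE // neg6_root.
- move=> i x hx; rewrite root_wtE //; move: hx.
  by rewrite -D_car => /h_g2P[b [c ->]]; rewrite root_form_hc lieb_pos6.
- move=> i; rewrite root_wtE ?rho_h // -[val i]/(val (widen_ord (isT : 6 <= 9)%N i)) height_root.
  exists (height9 i).-1; congr (- _%:R).
  by case: i => [[|[|[|[|[|[|//]]]]]] lt].
- move=> i; rewrite root_wtE ?rho_h // root_form_hc; exists (height9 i).-1.
  by case: i => [[|[|[|[|[|[|//]]]]]] lt] /=; rewrite !rv_val /height9 /=; ring.
Qed.

Variable lambda : hdual (bd_cartan D').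
Variables (I : Type) (delta : I -> hdual (bd_cartan D)).
Local Notation A := {ffun 'I_6 -> nat}.
Local Notation J := {ffun 'I_3 -> nat}.
Variable phi : J -> I.
Hypothesis phi_inj : injective phi.
Hypothesis phi_surj : forall i, exists j, i = phi j.
Hypothesis deltaE : forall j x, x \in bd_cartan D ->
  wt_at (delta (phi j)) x =
  wt_at lambda x + \sum_(i < 3) root_form neg_roots9`_(3 + i) x *+ j i.

Let exps (t : A * J) : {ffun 'I_(6 + 3) -> nat} := ffun_cat t.1 t.2.

(** The weight of the monomial of so(7) with exponents a and j, where j
    belongs to the roots whose restrictions repeat short roots of G2. *)
Let w (t : A * J) : hdual (bd_cartan D) :=
  shifted_wt (bd_cartan D) lambda (fun i : 'I_(6 + 3) => neg_roots9`_i) (exps t).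

Let d (t : A * J) : nat := (\sum_(i < 6 + 3) height9 i * exps t i)%N.

Lemma car_sub x : x \in bd_cartan D -> x \in bd_cartan D'.
Proof. by rewrite -D_car -D'_car => /h_g2P[b [c ->]]; apply: hc_so7. Qed.

Let w_at t x : x \in bd_cartan D ->
  wt_at (w t) x = wt_at lambda x + \sum_(i < 6 + 3) root_form neg_roots9`_i x *+ exps t i.
Proof.
exact: shifted_wtE.
Qed.

Let w_d t : wt_at (w t) rho = wt_at lambda rho - (d t)%:R.
Proof.
rewrite w_at ?rho_h //; congr (_ + _); rewrite /d natr_sum -sumrN.
by apply: eq_bigr => i _; rewrite (height_root i) natrM mulNrn mulr_natr.
Qed.

Let d_fin k : exists s : seq (A * J), forall t, (d t <= k)%N -> t \in s.
Proof.
pose g (f : {ffun 'I_6 -> 'I_k.+1} * {ffun 'I_3 -> 'I_k.+1}) : A * J :=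
  ([ffun i => val (f.1 i)], [ffun i => val (f.2 i)]).
exists (map g (enum {: {ffun 'I_6 -> 'I_k.+1} * {ffun 'I_3 -> 'I_k.+1}})) => -[a j] dk.
have le i : (exps (a, j) i <= k)%N.
  apply: leq_trans dk; rewrite /d (bigD1 i) //=; apply: leq_trans (leq_addr _ _).
  apply: leq_pmull; case: i => [[|[|[|[|[|[|[|[|[|//]]]]]]]]] lt] //.
apply/mapP; exists ([ffun i => inord (a i)], [ffun i => inord (j i)]); rewrite ?mem_enum //.
congr (_, _); apply/ffunP => i; rewrite !ffunE /= inordK //.
  by have /ffunP/(_ i) := ffun_catl a j; rewrite ffunE ltnS => <-; apply: le.
by have /ffunP/(_ i) := ffun_catr a j; rewrite ffunE ltnS => <-; apply: le.
Qed.

Let M := lm_restrict sub (verma (D := D') lambda).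
Let N := direct_sum (fun i => verma (D := D) (delta i)).

Let E (t : A * J) : M := verma_mon (neg9 X) lambda (exps t).
Let F : A * J -> N := ds_mon phi (fun i => verma_mon (neg6 X) (delta i)).

Let E_basis : weight_basis w E.
Proof.
split.
  pose unexps (a : {ffun 'I_(6 + 3) -> nat}) : A * J :=
    ([ffun i => a (lshift 3 i)], [ffun i => a (rshift 6 i)]).
  have expsK : cancel exps unexps.
    by move=> [a j]; rewrite /unexps ffun_catl ffun_catr.
  have expsK' : cancel unexps exps.
    move=> a; apply/ffunP => i; rewrite ffunE.
    by case: split_ordP => k ->; rewrite ffunE.
  exact: (lin_basis_reindex expsK expsK' (verma_basis char0 tri_so7 lambda)).
move=> t x hx.
have xD : x \in lie_space D by apply: h_sub.
have -> : act_at (D := D) (M := M) x (E t) = act_at (D := D') (M := verma lambda) x (E t).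
  by rewrite /act_at /= vsprojK.
have xD' := subvP sub _ xD.
have [b [c xE]] : exists b c, x = hc (b + c) b c by apply: h_g2P; rewrite D_car.
rewrite w_at // -sum_mword.
apply: (act_zword (D := D') (rho := fun i => root_form neg_roots9`_i x)) => //.
- by move=> i; rewrite -(tri_span tri_so7) memv_span // mem_cat mem_nth ?size_tuple.
- by move=> i; rewrite xE root_form_hc lieb_neg9.
by have := verma_vec_act lambda (car_sub hx) (mem0v _); rewrite addr0.
Qed.

Let F_basis : weight_basis w F.
Proof.
split; first exact: (ds_basis phi_inj phi_surj (fun i => verma_basis char0 tri_g2 (delta i))).
move=> [a j] x hx.
have xD : x \in lie_space D by apply: h_sub.
have wE : wt_at (w (a, j)) x =
    wt_at (delta (phi j)) x + \sum_(i <- mword a) root_form neg_roots9`_i x.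
  rewrite w_at // big_split_ord /= sum_mword deltaE // -[RHS]addrA [X in _ = _ + X]addrC.
  congr (_ + (_ + _)).
    by apply: eq_bigr => i _; have /ffunP/(_ i) := ffun_catl a j; rewrite [LHS]ffunE => <-.
  apply: eq_bigr => i _; have /ffunP/(_ i) := ffun_catr a j; rewrite [LHS]ffunE => <-.
  congr (_ *+ _).
  have [b [c ->]] : exists b c, x = hc (b + c) b c by apply: h_g2P; rewrite D_car.
  rewrite !root_form_hc.
  by case: i => [[|[|[|//]]] lt] /=; rewrite !rv_val; ring.
have vE : act_at x (verma_mon (neg6 X) (delta (phi j)) a) =
    wt_at (w (a, j)) x *: verma_mon (neg6 X) (delta (phi j)) a.
  rewrite wE.
  apply: (act_zword (D := D) (rho := fun i : 'I_6 => root_form neg_roots9`_i x)) => //.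
  - exact: neg6_D.
  - by move=> i; rewrite neg6_root.
  by have := verma_vec_act (delta (phi j)) hx (mem0v _); rewrite addr0.
exact (@ds_eigen _ _ _ _ (fun i => verma (D := D) (delta i)) (phi j) (vsproj D x) _ _ vE).
Qed.

(** Any indexing phi of the summands by the exponents of the three short roots
    will do. *)
Theorem branching : eq_Groth (D := D) M N.
Proof.
exact: (eq_Groth_of_bases char0 g2_graded w_d d_fin E_basis F_basis).
Qed.

End Branching.

(** * The branching formula *)

Section G2Weights.
Variable K : fieldType.
Local Notation h := (<<[:: Ha1 K; Ha2 K]>>%VS : {vspace 'M[K]_7}).

(** The coroots of the two long roots span the Cartan subalgebra of G2. *)
Lemma g2_weight_inj (nu nu' : hdual h) :
  wt_at nu (Hg K 1 + Hg K 3) = wt_at nu' (Hg K 1 + Hg K 3) ->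
  wt_at nu (Hg K 1 + Hg K 2) = wt_at nu' (Hg K 1 + Hg K 2) -> nu = nu'.
Proof.
rewrite H31E H32E /wt_at => E1 E2; apply/lfunP => x; rewrite -[x]vsvalK.
have [b [c ->]] := h_g2P (subvsP x).
have -> : hc (b + c) b c = c *: hc 1 0 1 + b *: hc 1 1 0.
  by rewrite !hcZ hcD; congr hc; ring.
by rewrite !linearP !linearZ /= E1 E2.
Qed.

Definition short_root (i : 'I_3) : 'rV[int]_3 := neg_roots9`_(3 + i).

(** The coroots of 3 a1 + a2 and of 3 a1 + 2 a2 take the values 1, 0, 1 and 0,
    1, 1 at the short roots a1, a1 + a2 and 2 a1 + a2. *)
Lemma short_shiftE (h' : {vspace 'M[K]_7}) (lambda : hdual h') (j : {ffun 'I_3 -> nat}) :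
  let mu := hdual_res h lambda - shifted_wt h lambda short_root j in
  wt_at mu (Hg K 1 + Hg K 3) = (j 0%R + j 2%R)%:R /\
  wt_at mu (Hg K 1 + Hg K 2) = (j 1%R + j 2%R)%:R.
Proof.
have E x : x \in h -> wt_at (hdual_res h lambda - shifted_wt h lambda short_root j) x =
    - \sum_(i < 3) root_form (short_root i) x *+ j i.
  move=> hx; rewrite /wt_at add_lfunE opp_lfunE -/(wt_at (shifted_wt _ _ _ _) x) shifted_wtE //.
  by rewrite hdual_resE vsprojK // opprD addrA subrr add0r.
have s0 : ord0 = 0 :> 'I_3 by []. 
have s1 : lift ord0 ord0 = 1 :> 'I_3 by apply: val_inj.
have s2 : lift ord0 (lift ord0 ord0) = 2 :> 'I_3 by apply: val_inj.
have F x : \sum_(i < 3) root_form (short_root i) x *+ j i =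
    root_form (short_root 0) x *+ j 0 + root_form (short_root 1) x *+ j 1 +
    root_form (short_root 2) x *+ j 2.
  by rewrite !big_ord_recl big_ord0 addr0 s2 s1 addrA.
have in1 : hc (1 : K) 0 1 \in h by rewrite (_ : hc _ _ _ = hc (0 + 1) 0 1) ?hc_g2 ?add0r.
have in2 : hc (1 : K) 1 0 \in h by rewrite (_ : hc _ _ _ = hc (1 + 0) 1 0) ?hc_g2 ?addr0.
split; rewrite ?H31E ?H32E E // F !root_form_hc /short_root /= !rv_val.
  by ring.
by ring.
Qed.

End G2Weights.

Section Index.
Variable R : realType.
Local Notation C := R[i]%C.
Variable lambda : hdual (h_so7 R).

Lemma branch_weight_eq (b b' : branch_weight lambda) :
  bw_p b = bw_p b' -> bw_q b = bw_q b' -> b = b'.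
Proof.
case: b b' => [nu p q pE qE] [nu' p' q' pE' qE'] /= pp qq; subst p' q'.
have nunu : nu = nu'.
  apply: oppr_inj; apply: (addrI (hdual_res (h_g2 R) lambda)).
  apply: (@g2_weight_inj C); [exact: (etrans pE (esym pE'))|exact: (etrans qE (esym qE'))].
subst nu'; congr BranchWeight; exact: Prop_irrelevance.
Qed.

Definition branch_idx : Type := {b : branch_weight lambda & 'I_(1 + minn (bw_p b) (bw_q b))}.

Lemma branch_idx_eq (i i' : branch_idx) : bw_p (tag i) = bw_p (tag i') ->
  bw_q (tag i) = bw_q (tag i') -> val (tagged i) = val (tagged i') -> i = i'.
Proof.
case: i i' => [b k] [b' k'] /= pp qq; have bb := branch_weight_eq pp qq; subst b'.
by move=> /val_inj ->.
Qed.

Definition branch_shift (j : {ffun 'I_3 -> nat}) : branch_weight lambda :=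
  BranchWeight (short_shiftE lambda j).1 (short_shiftE lambda j).2.

Lemma branch_idx_proof (j : {ffun 'I_3 -> nat}) :
  (j 2%R < 1 + minn (bw_p (branch_shift j)) (bw_q (branch_shift j)))%N.
Proof. by rewrite ltnS leq_min !leq_addl. Qed.

(** The triple (i, j, k) gives the weight with p = i + k and q = j + k, and
    the copy number k of its multiplicity space; the inverse maps (p, q, k) to
    (p - k, q - k, k). *)
Definition idx_of_short (j : {ffun 'I_3 -> nat}) : branch_idx :=
  existT _ (branch_shift j) (Ordinal (branch_idx_proof j)).

Lemma idx_of_short_inj : injective idx_of_short.
Proof.
move=> j j' E.
have E2 : j 2%R = j' 2%R := congr1 (fun i : branch_idx => val (tagged i)) E.
have E0 : (j 0%R + j 2%R = j' 0%R + j' 2%R)%N := congr1 (fun i : branch_idx => bw_p (tag i)) E.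
have E1 : (j 1%R + j 2%R = j' 1%R + j' 2%R)%N := congr1 (fun i : branch_idx => bw_q (tag i)) E.
move: E0 E1; rewrite E2 => /addIn E0 /addIn E1; apply/ffunP => i.
case: i => [[|[|[|//]]] lt]; [move: E0|move: E1|move: E2];
  by congr (j _ = j' _); apply: val_inj.
Qed.

Lemma idx_of_short_surj i : exists j, i = idx_of_short j.
Proof.
case: i => [b k]; pose p := bw_p b; pose q := bw_q b.
have /andP[kp kq] : (k <= p)%N && (k <= q)%N by rewrite -leq_min -ltnS; apply: ltn_ord.
exists [ffun i : 'I_3 => nth 0%N [:: (p - k)%N; (q - k)%N; val k] i].
by apply: branch_idx_eq; rewrite /= !ffunE /= ?subnK.
Qed.

End Index.

Theorem proposition4p3 (R : realType) (X : 'rV[int]_3 -> 'M[R[i]%C]_7)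
    (nX : g2_normalized X) (lambda : hdual (h_so7 R)) :
  eq_Groth (D := g2_data nX)
    (lm_restrict (g2_sub_so7 nX) (verma (D := so7_data nX) lambda))
    (direct_sum
       (fun i : {b : branch_weight lambda & 'I_(1 + minn (bw_p b) (bw_q b))} =>
          verma (D := g2_data nX) (bw_delta (tag i)))).
Proof.
have char0 k : k.+1%:R != 0 :> R[i]%C by rewrite Num.Theory.pnatr_eq0.
have Xr r : r \in so7_roots -> is_root_vector r (X r) := @g2n_root _ _ nX r.
have X_root r (rr : r \in so7_roots) := let: And3 _ _ H := Xr r rr in H.
have X_neq0 r (rr : r \in so7_roots) := let: And3 _ H _ := Xr r rr in H.
have X_so7 r (rr : r \in so7_roots) := let: And3 H _ _ := Xr r rr in H.
have D_span : <<cat_tuple (neg6 X) (cat_tuple (car2 _) (pos6 X))>>%VS = lie_space (g2_data nX).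
  transitivity <<car2 R[i]%C ++ (pos6 X ++ neg6 X)>>%VS; last by [].
  by rewrite !span_cat addvC -addvA.
apply (branching char0 X_root X_neq0 (D := g2_data nX) (D' := so7_data nX) D_span
  (erefl _) (erefl _) (fun A => elimT (so7P A)) X_so7 (erefl _) (erefl _) (g2_sub_so7 nX)
  (lambda := lambda) (delta := fun i : branch_idx lambda => bw_delta (tag i))
  (@idx_of_short_inj R lambda) (@idx_of_short_surj R lambda)).
by move=> j x hx; exact: shifted_wtE.
Qed.
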